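(* Let $N\ge 1$ and $1\le m<p$. Set $p_m:=m+\frac{2}{N}$ and $\theta:=\frac{p-m}{2(p-1)}$. (1) Let $T\in(0,\infty)$ and let $u$ be a solution to problem (E) in $\mathbb{R}^N\times(0,T)$. Then there exists a unique nonnegative Radon measure $\nu$ on $\mathbb{R}^N$ such that $$\operatorname*{ess\,lim}_{t\to+0}\int_{\mathbb{R}^N}u(x,t)\psi(x)\,dx=\int_{\mathbb{R}^N}\psi\,d\nu\qquad\text{for all }\psi\in C_c(\mathbb{R}^N).$$ Furthermore, there exists a constant $C=C(N,m,p)>0$ (depending only on $N,m,p$) such that, for all $\sigma\in(0,T^{\theta})$, $$\sup_{z\in\mathbb{R}^N}\nu(B(z,\sigma))\le\begin{cases}C\sigma^{N-\frac{2}{p-m}} & \text{if } p\neq p_m,\\[4pt] C\left[\log\left(e+\frac{T^{\theta}}{\sigma}\right)\right]^{-\frac{N}{2}} & \text{if } p=p_m.\end{cases}$$ (2) Let $\mu$ be a nonnegative Radon measure on $\mathbb{R}^N$, let $T\in(0,\infty]$, and let $u$ be a solution to problem (P) in $\mathbb{R}^N\times(0,T)$ with initial data $\mu$. Then $u$ is a solution to problem (E) in $\mathbb{R}^N\times(0,T)$, and the initial trace of $u$ (the measure $\nu$ characterized by the limit relation in (1)) coincides with $\mu$.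
   Context: $B(z,r):=\{x\in\mathbb{R}^N:|x-z|<r\}$. Problem (E) is $\partial_t u=\Delta u^m+u^p$, $u\ge 0$, in $\mathbb{R}^N\times(0,T)$; problem (P) is $\partial_t u=\Delta u^m+u^p$ in $\mathbb{R}^N\times(0,T)$ with $u(\cdot,0)=\mu$ in $\mathbb{R}^N$, where $\mu$ is a nonnegative Radon measure on $\mathbb{R}^N$. Solutions are defined as follows. Let $1\le m<p$, $T\in(0,\infty]$, and let $u\in L^p_{\rm loc}(\mathbb{R}^N\times[0,T))$ be nonnegative in $\mathbb{R}^N\times(0,T)$. (i) $u$ is a solution to problem (E) in $\mathbb{R}^N\times(0,T)$ if $$\int_\tau^T\int_{\mathbb{R}^N}(-u\,\partial_t\phi-u^m\Delta\phi-u^p\phi)\,dx\,dt=\int_{\mathbb{R}^N}u(x,\tau)\phi(x,\tau)\,dx$$ for $\phi\in C^{2;1}_c(\mathbb{R}^N\times[0,T))$ and almost all $\tau\in(0,T)$. (ii) $u$ is a solution to problem (P) in $\mathbb{R}^N\times(0,T)$ with initial data $\mu$ if $$\int_0^T\int_{\mathbb{R}^N}(-u\,\partial_t\phi-u^m\Delta\phi-u^p\phi)\,dx\,dt=\int_{\mathbb{R}^N}\phi(x,0)\,d\mu(x)$$ for all $\phi\in C^{2;1}_c(\mathbb{R}^N\times[0,T))$. Here $C^{2;1}_c(\mathbb{R}^N\times[0,T))$ denotes compactly supported functions on $\mathbb{R}^N\times[0,T)$ that are $C^2$ in $x$ and $C^1$ in $t$. *)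

(* Defs.v *)
From HB Require Import structures.
From mathcomp Require Import all_boot all_order all_algebra.
From mathcomp Require Import all_classical all_reals all_analysis.
From mathcomp Require Import measurable_realfun.

Set Implicit Arguments.
Unset Strict Implicit.
Unset Printing Implicit Defensive.

Import Order.TTheory GRing.Theory Num.Theory.
Import numFieldNormedType.Exports.

Local Open Scope classical_set_scope.
Local Open Scope ring_scope.

Section borel_matrix.
Variables (R : realType) (m n : nat).

HB.instance Definition _ := @isMeasurable.Build
  default_measure_display 'M[R]_(m, n) <<s @open 'M[R]_(m, n) >>
  (@sigma_algebra0 _ setT _) (@sigma_algebraC _ _) (@sigma_algebra_bigcup _ setT _).

Lemma open_measurable_mx (U : set 'M[R]_(m, n)) : open U -> measurable U.
Proof. by move=> oU; exact: sub_sigma_algebra. Qed.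

Lemma measurable_coord_mx i j :
  measurable_fun setT (fun A : 'M[R]_(m, n) => A i j).
Proof.
apply: (@measurability _ _ _ R _ _ _ (RGenOpens.measurableE R)).
move=> _ [_ [x [y ->]] <-].
rewrite setTI; apply: open_measurable_mx.
apply: open_comp; last exact: interval_open.
by move=> A _; exact: coord_continuous.
Qed.

Lemma measurable_fun_mx d (T : measurableType d) (f : T -> 'M[R]_(m, n)) :
  (forall i j, measurable_fun setT (fun x => f x i j)) -> measurable_fun setT f.
Proof.
move=> mf.
apply: (@measurability _ _ _ _ _ _ (@open 'M[R]_(m, n))) => // _ [U oU <-].
rewrite setTI.
pose r (k : nat) : R := k.+1%:R^-1.
have r_gt0 k : 0 < r k by rewrite invr_gt0 ltr0Sn.
pose V (q : 'M[rat]_(m, n) * nat) := ball (map_mx ratr q.1 : 'M[R]_(m, n)) (r q.2).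
have -> : f @^-1` U = \bigcup_(q in [set q | V q `<=` U]) (f @^-1` V q).
  apply/seteqP; split=> x /=; last by move=> [q qU]; exact: qU.
  move=> Ufx.
  have /nbhs_ballP[e /= e0 eU] : nbhs (f x) U by exact: open_nbhs_nbhs.
  have [k ke] : exists k, r k < e / 2.
    exists (Num.truncn (e / 2)^-1).
    have e2 : 0 < e / 2 by rewrite divr_gt0.
    rewrite /r invf_plt ?posrE ?ltr0Sn//.
    exact: truncnS_gt.
  have q_ i j : {q : rat | `|f x i j - ratr q| < r k}.
    apply: cid.
    have /rat_in_itvoo[q] : f x i j - r k < f x i j + r k.
      by rewrite ltrBlDr -addrA ltrDl addr_gt0.
    rewrite in_itv/= => /andP[q1 q2]; exists q.
    by rewrite distrC ltr_distl q1.
  pose Q : 'M[rat]_(m, n) := \matrix_(i, j) sval (q_ i j).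
  have Qfx : ball (map_mx ratr Q : 'M[R]_(m, n)) (r k) (f x).
    by split=> // i j; rewrite !mxE; case: (q_ i j) => q /=; rewrite -ball_normE/= distrC.
  exists (Q, k) => //= y Qy; apply: eU.
  rewrite [e]splitr; apply: (@ball_triangle _ _ (map_mx ratr Q : 'M[R]_(m, n))).
    by apply/ball_sym; apply: le_ball Qfx; exact: ltW.
  by apply: le_ball Qy; exact: ltW.
rewrite bigcup_mkcond; apply: countable_bigcupT_measurable => // q.
case: ifP => // _.
have -> : f @^-1` V q = \bigcap_(i in [set: 'I_m]) \bigcap_(j in [set: 'I_n])
    ((fun x => f x i j) @^-1` ball (ratr (q.1 i j) : R) (r q.2)).
  apply/seteqP; split=> x /=.
    by move=> [_ h] i _ j _ /=; have := h i j; rewrite mxE.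
  by move=> h; split=> // i j; rewrite mxE; exact: h.
apply: fin_bigcap_measurable => // i _; apply: fin_bigcap_measurable => // j _.
rewrite -[X in measurable X]setTI; apply: mf => //.
exact: measurable_ball.
Qed.

End borel_matrix.

Section lebesgue_rV.
Variable R : realType.

Section cons.
Variable n : nat.

Definition cons_rV (z : measurableTypeR R * 'rV[R]_n) : 'rV[R]_n.+1 := row_mx z.1%:M z.2.

Lemma cons_rV0 z : cons_rV z 0 0 = z.1.
Proof.
have -> : (0 : 'I_n.+1) = lshift n (0 : 'I_1) by apply: val_inj.
by rewrite /cons_rV (row_mxEl z.1%:M z.2) mxE eqxx.
Qed.

Lemma cons_rVS z (i : 'I_n) : cons_rV z 0 (lift ord0 i) = z.2 0 i.
Proof.
have -> : lift ord0 i = rshift 1 i by apply: val_inj.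
exact: (row_mxEr z.1%:M z.2).
Qed.

Lemma measurable_cons_rV : measurable_fun setT cons_rV.
Proof.
apply: measurable_fun_mx => i j; rewrite (ord1 i).
case: (unliftP ord0 j) => [k ->|->].
  rewrite (_ : (fun _ => _) = (fun x : 'rV[R]_n => x 0 k) \o snd); last first.
    by apply/funext => z /=; exact: cons_rVS.
  by apply: measurableT_comp; [exact: measurable_coord_mx|exact: measurable_snd].
rewrite (_ : (fun _ => _) = fst); first exact: measurable_fst.
by apply/funext => z /=; exact: cons_rV0.
Qed.

Definition uncons_rV (x : 'rV[R]_n.+1) :
    measurableTypeR R * 'rV[R]_n :=
  (x 0 0, \row_i x 0 (lift ord0 i)).

Lemma measurable_uncons_rV : measurable_fun setT uncons_rV.
Proof.
apply/measurable_fun_pairP; split => /=; first exact: measurable_coord_mx.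
apply: measurable_fun_mx => i j.
by under eq_fun do rewrite /= mxE; exact: measurable_coord_mx.
Qed.

Lemma cons_rVK : cancel cons_rV uncons_rV.
Proof.
move=> z; rewrite /uncons_rV cons_rV0 [RHS]surjective_pairing; congr pair.
by apply/rowP => i; rewrite mxE cons_rVS.
Qed.

Lemma uncons_rVK : cancel uncons_rV cons_rV.
Proof.
move=> x; apply/rowP => j; case: (unliftP ord0 j) => [k ->|->].
  by rewrite cons_rVS mxE.
by rewrite cons_rV0.
Qed.

Variable mu : {sigma_finite_measure set 'rV[R]_n -> \bar R}.

Definition lebesgue_cons : set 'rV[R]_n.+1 -> \bar R :=
  pushforward (@lebesgue_measure R \x mu)%E cons_rV.

Let measurable_preimage_cons (A : set 'rV[R]_n.+1) :
  measurable A -> measurable (cons_rV @^-1` A).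
Proof.
by move=> mA; rewrite -[X in measurable X]setTI; exact: measurable_cons_rV.
Qed.

Let lebesgue_cons0 : lebesgue_cons set0 = 0%E.
Proof. by rewrite /lebesgue_cons /pushforward preimage_set0 measure0. Qed.

Let lebesgue_cons_ge0 A : (0 <= lebesgue_cons A)%E.
Proof. by rewrite /lebesgue_cons /pushforward; exact: measure_ge0. Qed.

Let lebesgue_cons_sigma_additive : semi_sigma_additive lebesgue_cons.
Proof.
move=> F mF tF mUF; rewrite /lebesgue_cons /pushforward preimage_bigcup.
apply: measure_semi_sigma_additive.
- by move=> k; exact: measurable_preimage_cons.
- apply/trivIsetP => /= i j _ _ ij; rewrite -preimage_setI.
  by move/trivIsetP : tF => /(_ _ _ _ _ ij) ->//; rewrite preimage_set0.
- by rewrite -preimage_bigcup; exact: measurable_preimage_cons.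
Qed.

HB.instance Definition _ := isMeasure.Build _ _ _ lebesgue_cons
  lebesgue_cons0 lebesgue_cons_ge0 lebesgue_cons_sigma_additive.

Let lebesgue_cons_sigma_finite : sigma_finite setT lebesgue_cons.
Proof.
have /sigma_finiteP[F [TF ndF Foo]] := sigma_finiteT (@lebesgue_measure R).
have /sigma_finiteP[G [TG ndG Goo]] := sigma_finiteT mu.
exists (fun k => uncons_rV @^-1` (F k `*` G k)).
  rewrite -preimage_bigcup -(preimage_setT uncons_rV); congr (_ @^-1` _).
  apply/seteqP; split => // -[x y] _.
  have [/= k _ Fkx] : (\bigcup_k F k) x by rewrite -TF.
  have [/= l _ Gly] : (\bigcup_k G k) y by rewrite -TG.
  exists (maxn k l) => //; split => /=.
  - by move: x Fkx; exact/subsetPset/ndF/leq_maxl.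
  - by move: y Gly; exact/subsetPset/ndG/leq_maxr.
move=> k; have [mF Ffin] := Foo k; have [mG Gfin] := Goo k; split.
  rewrite -[X in measurable X]setTI; apply: measurable_uncons_rV => //.
  exact: measurableX.
rewrite /lebesgue_cons /pushforward -comp_preimage.
rewrite (_ : uncons_rV \o cons_rV = id); last by apply/funext; exact: cons_rVK.
by rewrite preimage_id product_measure1E// lte_mul_pinfty// ge0_fin_numE.
Qed.

HB.instance Definition _ := Measure_isSigmaFinite.Build _ _ _ lebesgue_cons
  lebesgue_cons_sigma_finite.

End cons.

Fixpoint lebesgue_rV n : {sigma_finite_measure set 'rV[R]_n -> \bar R} :=
  match n with
  | 0 => \d_(0 : 'rV[R]_0)
  | n'.+1 => lebesgue_cons (lebesgue_rV n')
  end.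

Lemma measurable_box_rV n (a b : 'rV[R]_n) :
  measurable [set x : 'rV[R]_n | forall i, a 0 i <= x 0 i <= b 0 i].
Proof.
rewrite (_ : mkset _ = \bigcap_(i in [set: 'I_n])
    ((fun x : 'rV[R]_n => x 0 i) @^-1` `[a 0 i, b 0 i])); last first.
  apply/seteqP; split => x /= h i; first by move=> _ /=; rewrite in_itv/=; exact: h.
  by have := h i I; rewrite /= in_itv.
apply: fin_bigcap_measurable => // i _; rewrite -[X in measurable X]setTI.
by apply: measurable_coord_mx => //; exact: measurable_itv.
Qed.

Lemma lebesgue_rV_box n (a b : 'rV[R]_n) : (forall i, a 0 i <= b 0 i) ->
  lebesgue_rV n [set x | forall i, a 0 i <= x 0 i <= b 0 i] =
  (\prod_i (b 0 i - a 0 i))%:E.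
Proof.
elim: n a b => [|n IHn] a b ab.
  by rewrite big_ord0 /= diracE mem_set//= => -[].
rewrite /= /lebesgue_cons /pushforward.
pose a' := (uncons_rV a).2; pose b' := (uncons_rV b).2.
have -> : @cons_rV n @^-1` [set x | forall i, a 0 i <= x 0 i <= b 0 i] =
    `[a 0 0, b 0 0]%classic `*`
    [set x : 'rV[R]_n | forall i, a' 0 i <= x 0 i <= b' 0 i].
  apply/seteqP; split => -[x y] /=.
    move=> h; split; first by have := h 0; rewrite cons_rV0/= in_itv.
    by move=> i; have := h (lift ord0 i); rewrite cons_rVS !mxE.
  rewrite in_itv/= => -[h1 h2] i.
  case: (unliftP ord0 i) => [k ->|->]; last by rewrite cons_rV0.
  by have := h2 k; rewrite cons_rVS !mxE.
rewrite product_measure1E//; last exact: measurable_box_rV.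
rewrite IHn; last by move=> i; rewrite !mxE; exact: ab.
rewrite [X in (X * _)%E](_ : _ = (b 0 0 - a 0 0)%:E); last first.
  have := ab 0; rewrite le_eqVlt => /predU1P[->|ab0].
    by rewrite subrr set_itv1; exact: lebesgue_measure_set1.
  by apply: (etrans (lebesgue_measure_itv _)); rewrite /= lte_fin ab0 -EFinB.
rewrite -EFinM big_ord_recl; congr (_ * _)%:E.
by apply: eq_bigr => i _; rewrite !mxE.
Qed.

End lebesgue_rV.

(* The library norm on ['rV[R]_N] is the sup norm. *)
Definition euclidean_norm (R : realType) N (x : 'rV[R]_N) : R :=
  Num.sqrt (\sum_i x 0 i ^+ 2).

Definition euclidean_ball (R : realType) N (z : 'rV[R]_N) (r : R) : set 'rV[R]_N :=
  [set x | euclidean_norm (x - z) < r].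

(* Locally finite Borel measures on [R^N] are automatically regular. *)
Definition radon (R : realType) N (mu : {measure set 'rV[R]_N -> \bar R}) :=
  forall K : set 'rV[R]_N, compact K -> (mu K < +oo)%E.

Definition compactly_supported (R : realType) N (psi : 'rV[R]_N -> R) :=
  compact (closure [set x | psi x != 0]).

(* Convergence from the right after removal of a null set. *)
Definition ess_cvg_at_right (R : realType) (f : R -> \bar R) (a : R) (l : \bar R) :=
  exists2 Z : set R, (@lebesgue_measure R).-negligible Z &
    f t @[t --> within (~` Z) a^'+] --> l.

Section test_functions.
Variables (R : realType) (N : nat).
Implicit Types (T : \bar R) (phi : 'rV[R]_N -> R -> R).

Definition space_time T : set ('rV[R]_N * R) :=
  [set z | 0 <= z.2 /\ (z.2%:E < T)%E].

(* Difference quotients in time never leave [[0, +oo[], so that at [t = 0] the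
   derivative is the right derivative. *)
Definition time_quotient phi x t : R -> R :=
  fun h => h^-1 * (phi x (t + h) - phi x t).

Definition time_steps (t : R) : set_system R := within [set h | 0 <= t + h] 0^'.

Definition dt phi x t : R := lim (time_quotient phi x t @ time_steps t).

Definition dx (i : 'I_N) phi x t : R := 'D_(delta_mx 0 i) (phi ^~ t) x.

Definition laplacian phi x t : R := \sum_i dx i (dx i phi) x t.

Definition continuous_on_space_time T phi :=
  {within space_time T, continuous (fun z => phi z.1 z.2)}.

Definition C21 T phi := [/\
  forall x t, space_time T (x, t) ->
    [/\ cvg (time_quotient phi x t @ time_steps t),
        forall i, derivable (phi ^~ t) x (delta_mx 0 i) &
        forall i j, derivable (dx j phi ^~ t) x (delta_mx 0 i)],
  continuous_on_space_time T phi,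
  continuous_on_space_time T (dt phi),
  forall i, continuous_on_space_time T (dx i phi) &
  forall i j, continuous_on_space_time T (dx i (dx j phi))].

(* The support is the closure relative to [space_time T]. *)
Definition C21c T phi := C21 T phi /\
  compact (space_time T `&`
    closure [set z | space_time T z /\ phi z.1 z.2 != 0]).

End test_functions.

Section solutions.
Variables (R : realType) (N : nat) (m p : R).
Implicit Types (T : \bar R) (u phi : 'rV[R]_N -> R -> R).

Definition space_time_measure : set ('rV[R]_N * measurableTypeR R) -> \bar R :=
  (lebesgue_rV R N \x @lebesgue_measure R)%E.

(* Every class in [L^p_loc] has a Borel representative, and the notions below
   do not depend on the representative chosen. *)
Definition Lp_loc T u :=
  measurable_fun (space_time T) (fun z : 'rV[R]_N * R => u z.1 z.2) /\
  forall K : set ('rV[R]_N * R), compact K -> K `<=` space_time T ->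
    (\int[space_time_measure]_(z in K) (`|u z.1 z.2| `^ p)%:E < +oo)%E.

Definition ae_nonneg T u :=
  {ae space_time_measure, forall z,
    0 < z.2 -> (z.2%:E < T)%E -> 0 <= u z.1 z.2}.

Definition weak_form T u phi (tau : R) : \bar R :=
  (\int[@lebesgue_measure R]_(t in [set t : R | (tau < t)%R /\ t%:E < T])
    \int[lebesgue_rV R N]_x
      (- u x t * dt phi x t - u x t `^ m * laplacian phi x t
       - u x t `^ p * phi x t)%R%:E)%E.

Definition solution_E T u := [/\ Lp_loc T u, ae_nonneg T u &
  forall phi, C21c T phi ->
    {ae @lebesgue_measure R, forall tau : R, 0 < tau -> (tau%:E < T)%E ->
      weak_form T u phi tau =
      (\int[lebesgue_rV R N]_x (u x tau * phi x tau)%:E)%E}].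

Definition solution_P T (mu : {measure set 'rV[R]_N -> \bar R}) u :=
  [/\ Lp_loc T u, ae_nonneg T u &
  forall phi, C21c T phi ->
    weak_form T u phi 0 = (\int[mu]_x (phi x 0)%:E)%E].

End solutions.

Definition initial_trace (R : realType) N (u : 'rV[R]_N -> R -> R)
    (nu : {measure set 'rV[R]_N -> \bar R}) :=
  radon nu /\
  forall psi : 'rV[R]_N -> R, continuous psi -> compactly_supported psi ->
    ess_cvg_at_right (fun t => \int[lebesgue_rV R N]_x (u x t * psi x)%:E)%E 0
      (\int[nu]_x (psi x)%:E)%E.

Definition same_measure (R : realType) N
    (mu nu : {measure set 'rV[R]_N -> \bar R}) :=
  forall A, measurable A -> mu A = nu A.

(* Main.v *)
From HB Require Import structures.
Require Import Defs.
From mathcomp Require Import all_boot all_order all_algebra.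
From mathcomp Require Import all_classical all_reals all_analysis.
From mathcomp Require Import measurable_realfun ring lra.

(** For a fixed test function [phi], equation (E) says that at almost every time $t$ the pairing of
    $u(\cdot,t)$ with [phi] is the integral of one integrable space-time function over the times
    after $t$. Dominated convergence then gives an essential limit as $t\to0+$ ([slab_cvg],
    [solution_E_trace]). Taking for [phi] a function $f(x)$ times a cutoff equal to $1$ near time
    $0$ yields a functional of $f\in C^2_c$, linear and positive because it is a limit of pairings
    with $u(\cdot,t)\ge0$. [riesz], obtained from Daniell's outer measure, represents it by a Radon
    measure; uniform approximation ([C2c_dense], [trace_of_C2c]) extends the limit to $C_c$, and
    [radon_unique] gives uniqueness.

    The bound comes from testing (E) with [barrier], a power $\varphi=\Phi^{k+3}$. For a large
    exponent, $|\partial_t\varphi|$ and $|\Delta\varphi|$ are controlled by multiples of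
    $\Phi^{k+1}$, and Young's inequality absorbs $u|\partial_t\varphi|$ and $u^m|\Delta\varphi|$
    into $u^p\varphi$ ([barrier_integrand_le]). What remains is a cost depending on the cutoff
    alone, which bounds the pairing of $u(\cdot,t)$ with $\varphi$ uniformly in $t$
    ([barrier_energy]). Since $\varphi$ is bounded below on $B(z,\sigma)$ at small times, this cost
    bounds $\nu(B(z,\sigma))$ ([trace_ball_le]). A single cutoff of size $\sigma$ and duration
    $\sigma^{1/\theta}<T$ costs a multiple of $\sigma^{N-2/(p-m)}$ ([trace_bound]).

    For $p=p_m$ that exponent is zero and a logarithm has to be gained, as for capacities in a
    critical dimension. There $\Phi$ is the average of $n$ cutoffs at dyadic scales, whose
    derivatives on the $i$-th shell are $1/n$ times those of one cutoff at scale $i$. Stretching all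
    durations by $n^{(m-1)/(p-m)}$ balances the costs of the time derivative and of the Laplacian,
    and the $n$ shells together cost a multiple of $n^{-N/2}$ ([critical_trace_bound]). All scales
    fit below $T$ as soon as $4^{n-1}\sigma<T^\theta$, so $n$ can be taken comparable to
    $\log(e+T^\theta/\sigma)$ ([critical_log_bound]).

    For (2), testing (P) with [phi] times a ramp that starts at $\tau$ removes the initial term; as
    the ramp steepens, (E) results at every Lebesgue point $\tau$ of the pairing ([solution_PE]).
    The weak form at time $0$ is the integral against [mu], so the essential limit is [mu]
    ([solution_P_initial_trace]). *)

Set Implicit Arguments.
Unset Strict Implicit.
Unset Printing Implicit Defensive.

Import Order.TTheory GRing.Theory Num.Theory.
Import numFieldNormedType.Exports.

Local Open Scope classical_set_scope.
Local Open Scope ring_scope.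

(** * Difference quotients along a filter of increments tending to zero *)

Section difference_quotients.
Context {R : realType} (G : set_system R) {FG : Filter G}.
Hypothesis G0 : h @[h --> G] --> (0 : R).
Implicit Types f g : R -> R.

Lemma cvg_of_quotient f (y d : R) :
  G (fun h => h != 0) ->
  h^-1 * (f h - y) @[h --> G] --> d -> f h @[h --> G] --> y.
Proof.
move=> Gn0 qd.
have : y + h * (h^-1 * (f h - y)) @[h --> G] --> y + 0 * d.
  by apply: cvgD; [exact: cvg_cst|exact: cvgM].
rewrite mul0r addr0; apply: cvg_trans; apply: near_eq_cvg.
near=> h; have h0 : h != 0 by near: h.
by rewrite mulrA mulfV// mul1r addrC subrK.
Unshelve. all: by end_near. Qed.

Lemma quotientM f g (a b df dg : R) : G (fun h => h != 0) ->
  h^-1 * (f h - a) @[h --> G] --> df ->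
  h^-1 * (g h - b) @[h --> G] --> dg ->
  h^-1 * (f h * g h - a * b) @[h --> G] --> df * b + a * dg.
Proof.
move=> Gn0 fd gd; have ga := cvg_of_quotient Gn0 gd.
rewrite (_ : (fun _ => _) = (fun h => (h^-1 * (f h - a)) * g h + a * (h^-1 * (g h - b)))).
  by apply: cvgD; [exact: cvgM|apply: cvgM => //; exact: cvg_cst].
by apply/funext => h; ring.
Qed.

(* Caratheodory's form of differentiability: [F z - F y = Q z * (z - y)] with
   [Q] continuous at [y]. *)
Lemma quotient_comp (F : R -> R) f (y d dF : R) : G (fun h => h != 0) ->
  is_derive y 1 F dF ->
  h^-1 * (f h - y) @[h --> G] --> d ->
  h^-1 * (F (f h) - F y) @[h --> G] --> dF * d.
Proof.
move=> Gn0 [Fd FE] fd; have fy := cvg_of_quotient Gn0 fd.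
pose Q z := if z == y then dF else (z - y)^-1 * (F z - F y).
have Qy : Q z @[z --> y] --> dF.
  have : h^-1 *: (F (h *: 1 + y) - F y) @[h --> 0^'] --> dF.
    by rewrite -FE; exact: Fd.
  move/cvgrPdist_lt => H; apply/cvgrPdist_lt => e e0.
  have [r /= r0 Hr] := (@nbhs_ballP _ _ _ _).1 (H _ e0).
  apply/nbhs_ballP; exists r => //= z yz.
  rewrite /Q; case: eqP => [_|/eqP zy]; first by rewrite subrr normr0.
  have := Hr (z - y); rewrite /ball/= sub0r normrN [_ *: 1]mulr1 subrK distrC.
  by apply => //; rewrite subr_eq0.
have QE z : F z - F y = Q z * (z - y).
  rewrite /Q; case: eqP => [->|/eqP zy]; first by rewrite !subrr mulr0.
  by rewrite mulrAC mulVf ?mul1r// subr_eq0.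
rewrite (_ : (fun _ => _) = (fun h => Q (f h) * (h^-1 * (f h - y)))).
  by apply: cvgM => //; exact: (cvg_comp _ _ fy Qy).
by apply/funext => h; rewrite QE; ring.
Unshelve. all: by end_near. Qed.

End difference_quotients.

(** * Functions of class $C^{2;1}$ together with named derivatives *)

Section jets.
Context {R : realType} {N : nat}.
Implicit Types (T : \bar R) (phi psi : 'rV[R]_N -> R -> R) (x : 'rV[R]_N) (t : R).

Definition space_quotient phi (i : 'I_N) x t : R -> R :=
  fun h => h^-1 * (phi (h *: delta_mx 0 i + x) t - phi x t).

Definition ST_continuous T phi := forall z, space_time T z ->
  phi y.1 y.2 @[y --> within (space_time T) (nbhs z)] --> phi z.1 z.2.

(** The derivatives are separate functions tied to [phi] by convergence of quotients. They can thus
    be given by closed formulas and combined by limit rules, without rewriting under the [lim] of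
    [dt] and [dx]. *)
Record jet T phi phit (g : 'I_N -> 'rV[R]_N -> R -> R)
    (H : 'I_N -> 'I_N -> 'rV[R]_N -> R -> R) : Prop := Jet {
  jet_t : forall x t, space_time T (x, t) ->
    time_quotient phi x t h @[h --> time_steps t] --> phit x t;
  jet_x : forall i x t, space_time T (x, t) ->
    space_quotient phi i x t h @[h --> 0^'] --> g i x t;
  jet_xx : forall i j x t, space_time T (x, t) ->
    space_quotient (g j) i x t h @[h --> 0^'] --> H i j x t;
  jet_c : ST_continuous T phi;
  jet_ct : ST_continuous T phit;
  jet_cx : forall i, ST_continuous T (g i);
  jet_cxx : forall i j, ST_continuous T (H i j) }.

Lemma time_steps0 t : h @[h --> time_steps t] --> (0 : R).
Proof.
apply: cvg_trans (cvg_within _) _.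
by apply: cvg_trans (cvg_within _) _; exact: cvg_id.
Qed.

Lemma dnbhs0 : h @[h --> 0^'] --> (0 : R).
Proof. by apply: cvg_trans (cvg_within _) _; exact: cvg_id. Qed.

Lemma dnbhs_neq0 : (0 : R)^' (fun h => h != 0).
Proof. exact: withinT. Qed.

Lemma time_steps_neq0 t : time_steps t (fun h => h != 0).
Proof. by apply: filterS dnbhs_neq0 => h h0 _. Qed.

Lemma time_steps_proper t : 0 <= t -> ProperFilter (time_steps t).
Proof.
move=> t0; apply: Build_ProperFilter_ex => A /nbhs_ballP[e /= e0 He].
exists (e / 2); apply: He.
- rewrite /ball/= sub0r normrN gtr0_norm ?divr_gt0//.
  by rewrite ltr_pdivrMr// ltr_pMr// ltr1n.
- by rewrite gt_eqF// divr_gt0.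
- by rewrite /= addr_ge0// divr_ge0// ltW.
Qed.

Lemma ST_continuousP T phi :
  continuous_on_space_time T phi <-> ST_continuous T phi.
Proof. exact: (@subspace_continuousP _ (space_time T) _ (fun z => phi z.1 z.2)). Qed.

Lemma ST_continuous_near T phi psi z : space_time T z ->
  (forall x t, space_time T (x, t) -> phi x t = psi x t) ->
  phi y.1 y.2 @[y --> within (space_time T) (nbhs z)] --> phi z.1 z.2 ->
  psi y.1 y.2 @[y --> within (space_time T) (nbhs z)] --> psi z.1 z.2.
Proof.
case: z => x t zT e; rewrite /= -e//.
apply: cvg_trans; apply: near_eq_cvg.
by apply: filterS (withinT _ _) => -[y s] ysT /=; exact: e.
Qed.

Lemma ST_continuous_eq T phi psi :
  (forall x t, space_time T (x, t) -> phi x t = psi x t) ->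
  ST_continuous T phi -> ST_continuous T psi.
Proof.
by move=> e c z zT; apply: ST_continuous_near (c z zT).
Qed.

Lemma space_quotientE phi i x t d :
  space_quotient phi i x t h @[h --> 0^'] --> d ->
  derivable (phi ^~ t) x (delta_mx 0 i) /\ dx i phi x t = d.
Proof. by move=> qd; split; [apply/cvg_ex; exists d|exact: cvg_lim]. Qed.

Lemma jet_dt T phi phit g H x t : jet T phi phit g H -> space_time T (x, t) ->
  dt phi x t = phit x t.
Proof.
move=> J xtT; have ? := time_steps_proper xtT.1.
by apply: cvg_lim => //; exact: jet_t J _ _ _.
Qed.

Lemma jet_dx T phi phit g H i x t : jet T phi phit g H -> space_time T (x, t) ->
  dx i phi x t = g i x t.
Proof. by move=> J xtT; have [] := space_quotientE (jet_x (i := i) J xtT). Qed.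

Lemma space_quotient_eq phi psi i x t : (forall y, phi y t = psi y t) ->
  space_quotient phi i x t = space_quotient psi i x t.
Proof. by move=> e; apply/funext => h; rewrite /space_quotient !e. Qed.

(** Membership in [space_time] depends on time only, so a spatial quotient never leaves the domain:
    [dx j phi] and [g j] agree on the whole slice and have the same quotients. *)
Lemma jet_dxdx T phi phit g H i j x t : jet T phi phit g H -> space_time T (x, t) ->
  derivable (dx j phi ^~ t) x (delta_mx 0 i) /\ dx i (dx j phi) x t = H i j x t.
Proof.
move=> J xtT; apply: space_quotientE.
rewrite (@space_quotient_eq _ (g j)); first exact: jet_xx J _ _ _ _ _.
by move=> y; exact: jet_dx J _.
Qed.

Lemma jet_laplacian T phi phit g H x t : jet T phi phit g H ->
  space_time T (x, t) -> laplacian phi x t = \sum_i H i i x t.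
Proof. by move=> J xtT; apply: eq_bigr => i _; have [] := jet_dxdx i i J xtT. Qed.

Lemma jet_C21 T phi phit g H : jet T phi phit g H -> C21 T phi.
Proof.
move=> J; split.
- move=> x t xtT; split.
  + by apply/cvg_ex; exists (phit x t); exact: jet_t J _ _ _.
  + by move=> i; have [] := space_quotientE (jet_x (i := i) J xtT).
  + by move=> i j; have [] := jet_dxdx i j J xtT.
- by apply/ST_continuousP; exact: jet_c J.
- apply/ST_continuousP; apply: (@ST_continuous_eq _ phit); last exact: jet_ct J.
  by move=> x t xtT; rewrite (jet_dt J).
- move=> i; apply/ST_continuousP.
  apply: (@ST_continuous_eq _ (g i)); last exact: jet_cx J _.
  by move=> x t xtT; rewrite (jet_dx _ J).
- move=> i j; apply/ST_continuousP.
  apply: (@ST_continuous_eq _ (H i j)); last exact: jet_cxx J _ _.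
  by move=> x t xtT; have [_ ->] := jet_dxdx i j J xtT.
Qed.

Lemma C21_jet T phi : C21 T phi ->
  jet T phi (dt phi) (fun i => dx i phi) (fun i j => dx i (dx j phi)).
Proof.
move=> [D c ct cx cxx]; split.
- by move=> x t /D[].
- by move=> i x t /D[_ + _] => /(_ i).
- by move=> i j x t /D[_ _ +] => /(_ i j).
- exact/ST_continuousP.
- exact/ST_continuousP.
- by move=> i; exact/ST_continuousP.
- by move=> i j; exact/ST_continuousP.
Qed.

Lemma space_time_le T T' x t : (T' <= T)%E -> space_time T' (x, t) -> space_time T (x, t).
Proof. by move=> TT' [/= t0 tT]; split => //=; exact: lt_le_trans TT'. Qed.

Lemma ST_continuous_le T T' phi : (T' <= T)%E -> ST_continuous T phi -> ST_continuous T' phi.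
Proof.
move=> TT' c [x t] zT; apply: cvg_trans (c _ (space_time_le TT' zT)).
have sub (P : set ('rV[R]_N * R)) : within (space_time T) (nbhs (x, t)) P ->
    within (space_time T') (nbhs (x, t)) P.
  rewrite /within/=; move=> H; apply: filterS H => -[y s] /= + ysT'.
  by apply; exact: space_time_le ysT'.
by move=> A; exact: (sub (_ @^-1` A)).
Qed.

Lemma jet_le T T' phi phit g H : (T' <= T)%E -> jet T phi phit g H -> jet T' phi phit g H.
Proof.
move=> TT' []; split; do ?by [move=> *; apply: (@ST_continuous_le T)].
- by move=> x t /(space_time_le TT'); auto.
- by move=> i x t /(space_time_le TT'); auto.
- by move=> i j x t /(space_time_le TT'); auto.
Qed.

End jets.

(** * Sums, products and compositions of jets *)

Section jet_calculus.
Context {R : realType} {N : nat}.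
Implicit Types (T : \bar R) (phi psi : 'rV[R]_N -> R -> R) (x : 'rV[R]_N) (t : R).

Lemma ST_continuousD T phi psi : ST_continuous T phi -> ST_continuous T psi ->
  ST_continuous T (fun x t => phi x t + psi x t).
Proof. by move=> c1 c2 z zT; apply: cvgD; [exact: c1|exact: c2]. Qed.

Lemma ST_continuousM T phi psi : ST_continuous T phi -> ST_continuous T psi ->
  ST_continuous T (fun x t => phi x t * psi x t).
Proof. by move=> c1 c2 z zT; apply: cvgM; [exact: c1|exact: c2]. Qed.

Lemma ST_continuous_comp T (F : R -> R) phi : continuous F ->
  ST_continuous T phi -> ST_continuous T (fun x t => F (phi x t)).
Proof. by move=> cF c z zT; apply: (cvg_comp _ _ (c z zT)); exact: cF. Qed.

Lemma ST_continuous_cst T (c : R) : ST_continuous T (fun (_ : 'rV[R]_N) _ => c).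
Proof. by move=> z zT; exact: cvg_cst. Qed.

Lemma ST_continuous_time T (e : R -> R) : continuous e ->
  ST_continuous T (fun (_ : 'rV[R]_N) t => e t).
Proof.
move=> ce z zT; apply: cvg_trans; first exact/cvg_app/cvg_within.
apply: (@cvg_comp _ _ _ (fun y : 'rV[R]_N * R => y.2) e); first exact: cvg_snd.
exact: ce.
Qed.

Lemma ST_continuous_space T (f : 'rV[R]_N -> R) : continuous f ->
  ST_continuous T (fun x _ => f x).
Proof.
move=> cf z zT; apply: cvg_trans; first exact/cvg_app/cvg_within.
apply: (@cvg_comp _ _ _ (fun y : 'rV[R]_N * R => y.1) f); first exact: cvg_fst.
exact: cf.
Qed.

Lemma jet_cst T (c : R) :
  jet T (fun (_ : 'rV[R]_N) _ => c) (fun _ _ => 0) (fun _ _ _ => 0)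
    (fun _ _ _ _ => 0).
Proof.
have q0 (d : R) : (fun h : R => h^-1 * (d - d)) = (fun _ => 0).
  by apply/funext => h; rewrite subrr mulr0.
split; do ?by move=> *; exact: ST_continuous_cst.
- by move=> x t _; rewrite /time_quotient q0; exact: cvg_cst.
- by move=> i x t _; rewrite /space_quotient q0; exact: cvg_cst.
- by move=> i j x t _; rewrite /space_quotient q0; exact: cvg_cst.
Qed.

Lemma jet_coord T (k : 'I_N) :
  jet T (fun (x : 'rV[R]_N) _ => x 0 k) (fun _ _ => 0)
    (fun i _ _ => (i == k)%:R) (fun _ _ _ _ => 0).
Proof.
split; do ?by move=> *; exact: ST_continuous_cst.
- move=> x t _; rewrite /time_quotient.
  by under eq_fun do rewrite subrr mulr0; exact: cvg_cst.
- move=> i x t _; rewrite /space_quotient.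
  apply: cvg_near_cst; apply: filterS dnbhs_neq0 => h h0.
  by rewrite !mxE eqxx/= addrK eq_sym mulrA mulVf// mul1r.
- move=> i j x t _; rewrite /space_quotient.
  by under eq_fun do rewrite subrr mulr0; exact: cvg_cst.
- by apply: ST_continuous_space => x; exact: coord_continuous.
Qed.

Lemma jet_time T (e e' : R -> R) : (forall t, is_derive t 1 e (e' t)) ->
  continuous e' ->
  jet T (fun (_ : 'rV[R]_N) t => e t) (fun _ t => e' t) (fun _ _ _ => 0)
    (fun _ _ _ _ => 0).
Proof.
move=> de ce'.
split; do ?by move=> *; exact: ST_continuous_cst.
- move=> x t _; rewrite /time_quotient.
  have [det <-] := de t.
  have : h^-1 *: (e (h *: 1 + t) - e t) @[h --> 0^'] --> 'D_1 e t by exact: det.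
  rewrite (_ : (fun h => _) = (fun h => h^-1 * (e (t + h) - e t))).
    move=> H; apply: cvg_trans H; apply: cvg_app.
    by rewrite /time_steps; exact: cvg_within.
  by apply/funext => h; rewrite -[h *: 1]/(h * 1) mulr1 [h + t]addrC.
- move=> i x t _; rewrite /space_quotient.
  by under eq_fun do rewrite subrr mulr0; exact: cvg_cst.
- move=> i j x t _; rewrite /space_quotient.
  by under eq_fun do rewrite subrr mulr0; exact: cvg_cst.
- apply: ST_continuous_time => t; apply: differentiable_continuous.
  by apply/derivable1_diffP; have [] := de t.
- exact: ST_continuous_time.
Qed.

Lemma jetD T phi phit g H psi psit k K : jet T phi phit g H -> jet T psi psit k K ->
  jet T (fun x t => phi x t + psi x t) (fun x t => phit x t + psit x t)
    (fun i x t => g i x t + k i x t) (fun i j x t => H i j x t + K i j x t).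
Proof.
move=> [t1 x1 xx1 c1 ct1 cx1 cxx1] [t2 x2 xx2 c2 ct2 cx2 cxx2].
have qD (a b c d h : R) : h^-1 * (a + b - (c + d)) = h^-1 * (a - c) + h^-1 * (b - d).
  by ring.
split; do ?by move=> *; apply: ST_continuousD.
- move=> x t xtT; rewrite /time_quotient; under eq_fun do rewrite qD.
  by apply: cvgD; [exact: t1|exact: t2].
- move=> i x t xtT; rewrite /space_quotient; under eq_fun do rewrite qD.
  by apply: cvgD; [exact: x1|exact: x2].
- move=> i j x t xtT; rewrite /space_quotient; under eq_fun do rewrite qD.
  by apply: cvgD; [exact: xx1|exact: xx2].
Qed.

Lemma space_quotientM (f k : 'rV[R]_N -> R -> R) i x t (df dk : R) :
  space_quotient f i x t h @[h --> 0^'] --> df ->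
  space_quotient k i x t h @[h --> 0^'] --> dk ->
  space_quotient (fun x t => f x t * k x t) i x t h @[h --> 0^'] -->
    df * k x t + f x t * dk.
Proof. exact: (quotientM dnbhs0 dnbhs_neq0). Qed.

Lemma space_quotientD (f k : 'rV[R]_N -> R -> R) i x t (df dk : R) :
  space_quotient f i x t h @[h --> 0^'] --> df ->
  space_quotient k i x t h @[h --> 0^'] --> dk ->
  space_quotient (fun x t => f x t + k x t) i x t h @[h --> 0^'] --> df + dk.
Proof.
move=> H1 H2; rewrite (_ : space_quotient _ i x t =
  (fun h => space_quotient f i x t h + space_quotient k i x t h)); first exact: cvgD.
by apply/funext => h; rewrite /space_quotient; ring.
Qed.

Lemma jetM T phi phit g H psi psit k K : jet T phi phit g H -> jet T psi psit k K ->
  jet T (fun x t => phi x t * psi x t)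
    (fun x t => phit x t * psi x t + phi x t * psit x t)
    (fun i x t => g i x t * psi x t + phi x t * k i x t)
    (fun i j x t => H i j x t * psi x t + g j x t * k i x t +
       (g i x t * k j x t + phi x t * K i j x t)).
Proof.
move=> [t1 x1 xx1 c1 ct1 cx1 cxx1] [t2 x2 xx2 c2 ct2 cx2 cxx2].
split.
- move=> x t xtT.
  by apply: (quotientM (@time_steps0 _ t) (@time_steps_neq0 _ t)); [exact: t1|exact: t2].
- move=> i x t xtT; by apply: space_quotientM; [exact: x1|exact: x2].
- move=> i j x t xtT; apply: space_quotientD; apply: space_quotientM.
  + exact: xx1.
  + exact: x2.
  + exact: x1.
  + exact: xx2.
- exact: ST_continuousM.
- by apply: ST_continuousD; exact: ST_continuousM.
- by move=> i; apply: ST_continuousD; exact: ST_continuousM.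
- by move=> i j; do 2 apply: ST_continuousD; exact: ST_continuousM.
Qed.

Lemma jet_comp T phi phit g H (F F' F'' : R -> R) :
  (forall y : R, is_derive y 1 F (F' y)) -> (forall y : R, is_derive y 1 F' (F'' y)) ->
  continuous F'' -> jet T phi phit g H ->
  jet T (fun x t => F (phi x t)) (fun x t => F' (phi x t) * phit x t)
    (fun i x t => F' (phi x t) * g i x t)
    (fun i j x t => F'' (phi x t) * g i x t * g j x t + F' (phi x t) * H i j x t).
Proof.
move=> dF dF' cF'' [t1 x1 xx1 c1 ct1 cx1 cxx1].
have cont (f f' : R -> R) : (forall y : R, is_derive y 1 f (f' y)) -> continuous f.
  move=> df y; apply: differentiable_continuous.
  by apply/derivable1_diffP; have [] := df y.
have cF := cont _ _ dF; have cF' := cont _ _ dF'.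
split.
- move=> x t xtT.
  apply: (quotient_comp (@time_steps0 _ t) (@time_steps_neq0 _ t) (dF _)); exact: t1.
- by move=> i x t xtT; apply: (quotient_comp dnbhs0 dnbhs_neq0 (dF _)); exact: x1.
- move=> i j x t xtT; apply: space_quotientM; last exact: xx1.
  by apply: (quotient_comp dnbhs0 dnbhs_neq0 (dF' _)); exact: x1.
- exact: ST_continuous_comp.
- by apply: ST_continuousM => //; exact: ST_continuous_comp.
- by move=> i; apply: ST_continuousM => //; exact: ST_continuous_comp.
- move=> i j; apply: ST_continuousD; apply: ST_continuousM => //.
  + by apply: ST_continuousM => //; exact: ST_continuous_comp.
  + exact: ST_continuous_comp.
Qed.

Lemma jetZ T phi phit g H (c : R) : jet T phi phit g H ->
  jet T (fun x t => c * phi x t) (fun x t => c * phit x t)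
    (fun i x t => c * g i x t) (fun i j x t => c * H i j x t).
Proof.
move=> [t1 x1 xx1 c1 ct1 cx1 cxx1].
have qZ (a b h : R) : h^-1 * (c * a - c * b) = c * (h^-1 * (a - b)) by ring.
split; do ?by move=> *; apply: ST_continuousM => //; exact: ST_continuous_cst.
- move=> x t xtT; rewrite /time_quotient; under eq_fun do rewrite qZ.
  by apply: cvgM; [exact: cvg_cst|exact: t1].
- move=> i x t xtT; rewrite /space_quotient; under eq_fun do rewrite qZ.
  by apply: cvgM; [exact: cvg_cst|exact: x1].
- move=> i j x t xtT; rewrite /space_quotient; under eq_fun do rewrite qZ.
  by apply: cvgM; [exact: cvg_cst|exact: xx1].
Qed.

Lemma jet_ext T phi phit g H psi psit k K :
  (forall x t, phi x t = psi x t) -> (forall x t, phit x t = psit x t) ->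
  (forall i x t, g i x t = k i x t) -> (forall i j x t, H i j x t = K i j x t) ->
  jet T phi phit g H -> jet T psi psit k K.
Proof.
move=> e1 e2 e3 e4.
have -> : psi = phi by apply/funext => x; apply/funext => t.
have -> : psit = phit by apply/funext => x; apply/funext => t.
have -> : k = g by apply/funext => i; apply/funext => x; apply/funext => t.
suff -> : K = H by [].
by apply/funext => i; apply/funext => j; apply/funext => x; apply/funext => t.
Qed.

Lemma jet_sum T (I : Type) (r : seq I) (phi phit : I -> 'rV[R]_N -> R -> R) g H :
  (forall k, jet T (phi k) (phit k) (g k) (H k)) ->
  jet T (fun x t => \sum_(k <- r) phi k x t) (fun x t => \sum_(k <- r) phit k x t)
    (fun i x t => \sum_(k <- r) g k i x t)
    (fun i j x t => \sum_(k <- r) H k i j x t).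
Proof.
move=> J; elim: r => [|k r IH].
  by apply: jet_ext (jet_cst T 0) => *; rewrite big_nil.
by apply: jet_ext (jetD (J k) IH) => *; rewrite big_cons.
Qed.

End jet_calculus.

(** * Powers of the positive part *)

Section scalar_functions.
Context {R : realType}.
Implicit Types y z : R.

(** A quadratic remainder is convenient for piecewise polynomials: at the kink of [pos] it reduces
    differentiability to polynomial inequalities, one for each sign pattern. *)
Lemma is_derive_quadratic (f : R -> R) y d C :
  (forall h, `|h| <= 1 -> `|f (h + y) - f y - d * h| <= C * h ^+ 2) ->
  is_derive y 1 f d.
Proof.
move=> fq; have fd : h^-1 *: (f (h *: 1 + y) - f y) @[h --> 0^'] --> d.
  apply/cvgrPdist_le => e e0.
  have C0 : 0 <= C.
    by have := fq 1; rewrite normr1 expr1n !mulr1 => /(_ (lexx _)); apply: le_trans.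
  near=> h.
  have h0 : h != 0 by near: h; exact: dnbhs_neq0.
  have h1 : `|h| <= 1 by near: h; apply: dnbhs0_le.
  have he : `|h| <= e / (C + 1).
    by near: h; apply: dnbhs0_le; rewrite divr_gt0// ltr_wpDl.
  rewrite -[h *: 1]/(h * 1) mulr1 -[_ *: _]/(_ * _) distrC.
  rewrite (_ : _ - d = h^-1 * (f (h + y) - f y - d * h)); last first.
    by field.
  rewrite normrM normfV ler_pdivrMl ?normr_gt0//.
  apply: (le_trans (fq _ h1)); rewrite -real_normK ?num_real// expr2 mulrA.
  rewrite mulrC ler_wpM2l// (le_trans (ler_wpM2l C0 he))//.
  by rewrite mulrA ler_pdivrMr ?ltr_wpDl// mulrC ler_pM2l// lerDl.
by split; [apply/cvg_ex; exists d|exact: cvg_lim].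
Unshelve. all: by end_near. Qed.

Definition pos y : R := Num.max y 0.

Lemma pos_ge0 y : 0 <= pos y. Proof. by rewrite /pos le_max lexx orbT. Qed.

Lemma pos_le0 y : y <= 0 -> pos y = 0. Proof. exact: max_r. Qed.

Lemma pos_gt0 y : 0 < y -> pos y = y. Proof. by move=> /ltW; exact: max_l. Qed.

Lemma continuous_pos : continuous pos.
Proof. by move=> y; apply: (@continuous_max _ _ id (fun _ => 0)); [exact: cvg_id|exact: cvg_cst]. Qed.

Lemma is_derive_pos2 y : is_derive y 1 (fun y => pos y ^+ 2) (2 * pos y).
Proof.
apply: (@is_derive_quadratic _ _ _ 1) => h h1; rewrite ler_norml.
rewrite /pos; case: (leP (h + y) 0) => ?; case: (leP y 0) => ?; apply/andP; split; nra.
Qed.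

Lemma is_derive_pos3 y : is_derive y 1 (fun y => pos y ^+ 3) (3 * pos y ^+ 2).
Proof.
apply: (@is_derive_quadratic _ _ _ (3 * `|y| + 1)) => h h1.
have {}h1 : -1 <= h <= 1 by rewrite -ler_norml.
have [y1 y2] : y <= `|y| /\ - y <= `|y| by rewrite ler_norm -normrN ler_norm.
move: y1 y2; set a := `|y| => y1 y2; have h2 : 0 <= h ^+ 2 by exact: sqr_ge0.
have p1 : 0 <= h ^+ 2 * (a - y) by rewrite mulr_ge0// subr_ge0.
have p2 : 0 <= h ^+ 2 * (a + y) by rewrite mulr_ge0//; lra.
have p3 : 0 <= h ^+ 2 * (1 - h) by rewrite mulr_ge0//; lra.
have p4 : 0 <= h ^+ 2 * (1 + h) by rewrite mulr_ge0//; lra.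
rewrite ler_norml /pos; case: (leP (h + y) 0) => hy; case: (leP y 0) => y0;
  apply/andP; split; try nra.

Qed.

End scalar_functions.

(** * A monotone $C^2$ step from $0$ to $1$ *)

Section step.
Context {R : realType}.
Implicit Types y z : R.

(* Third differences: the step below is the distribution function of the
   quadratic B-spline. *)
Definition third_difference (F : R -> R) y : R :=
  F (3 * y) - 3 * F (3 * y - 1) + 3 * F (3 * y - 2) - F (3 * y - 3).

Lemma is_derive_third_difference (F F' : R -> R) y :
  (forall y, is_derive y 1 F (F' y)) ->
  is_derive y 1 (third_difference F) (3 * third_difference F' y).
Proof.
move=> dF.
have dA c : is_derive y 1 (fun y => F (3 * y - c)) (F' (3 * y - c) * 3).
  apply: (is_derive1_comp (dF _)).
  have d3 : is_derive y 1 (fun y : R => 3 * y) 3.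
    rewrite -[X in is_derive _ _ _ X]mulr1; apply: (is_deriveZ 3 (is_derive_id y 1)).
  have := is_deriveB d3 (is_derive_cst c y 1); rewrite subr0; exact.
have dA0 : is_derive y 1 (fun y => F (3 * y)) (F' (3 * y) * 3).
  by have := dA 0; under eq_fun do rewrite subr0; rewrite subr0.
have := is_deriveB (is_deriveD (is_deriveB dA0 (is_deriveZ 3 (dA 1)))
  (is_deriveZ 3 (dA 2))) (dA 3).
rewrite (_ : _ - _ = 3 * third_difference F' y); first exact.
by rewrite /third_difference -![3 *: _]/(3 * _); ring.
Qed.

Lemma continuous_third_difference F : continuous F -> continuous (third_difference F).
Proof.
move=> cF y.
have cA c : F (3 * z - c) @[z --> y] --> F (3 * y - c).
  apply: (@cvg_comp _ _ _ (fun z => 3 * z - c) F); last exact: cF.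
  by apply: cvgB; [apply: cvgM; [exact: cvg_cst|exact: cvg_id]|exact: cvg_cst].
have cA0 : F (3 * z) @[z --> y] --> F (3 * y).
  by have := cA 0; under eq_fun do rewrite subr0; rewrite subr0.
apply: cvgB => //; apply: cvgD; [apply: cvgB => //|];
  by apply: cvgM => //; exact: cvg_cst.
Qed.

Definition step y : R := 6^-1 * third_difference (fun z => pos z ^+ 3) y.
Definition step1 y : R := 6^-1 * (3 * third_difference (fun z => 3 * pos z ^+ 2) y).
Definition step2 y : R :=
  6^-1 * (3 * (3 * third_difference (fun z => 3 * (2 * pos z)) y)).

Lemma is_derive_step y : is_derive y 1 step (step1 y).
Proof. exact: (is_deriveZ _ (is_derive_third_difference _ (@is_derive_pos3 R))). Qed.

Lemma is_derive_step1 y : is_derive y 1 step1 (step2 y).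
Proof.
do 2 apply: is_deriveZ.
by apply: is_derive_third_difference => z; apply: is_deriveZ; exact: is_derive_pos2.
Qed.

Lemma continuous_step2 : continuous step2.
Proof.
move=> y; do 3 (apply: cvgM; first exact: cvg_cst).
apply: continuous_third_difference => z.
by do 2 (apply: cvgM; first exact: cvg_cst); exact: continuous_pos.
Qed.

Lemma continuous_step : continuous step.
Proof.
move=> y; apply: differentiable_continuous.
by apply/derivable1_diffP; have [] := is_derive_step y.
Qed.

Lemma continuous_step1 : continuous step1.
Proof.
move=> y; apply: differentiable_continuous.
by apply/derivable1_diffP; have [] := is_derive_step1 y.
Qed.

Lemma step_le0 y : y <= 0 -> step y = 0.
Proof.
by move=> y0; rewrite /step /third_difference !pos_le0; [ring|lra..].
Qed.

Lemma step_ge1 y : 1 <= y -> step y = 1.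
Proof.
move=> y1; rewrite /step /third_difference.
have [->|y1'] := eqVneq y 1.
  rewrite (_ : 3 * 1 - 3 = 0); last by ring.
  by rewrite (@pos_le0 _ 0)// !pos_gt0; [field|lra..].
have {y1'}y1 : 1 < y by rewrite lt_neqAle eq_sym y1'.
by rewrite !pos_gt0; [field|lra..].
Qed.

Lemma step1_bounds y : 0 <= step1 y <= 3.
Proof.
rewrite /step1 /third_difference /pos.
case: (leP (3 * y) 0) => h0; case: (leP (3 * y - 1) 0) => h1;
case: (leP (3 * y - 2) 0) => h2; case: (leP (3 * y - 3) 0) => h3; try lra;
by apply/andP; split; nra.
Qed.

Lemma step1_outside y : y <= 0 \/ 1 <= y -> step1 y = 0.
Proof.
case=> [y0|y1]; rewrite /step1 /third_difference; first by rewrite !pos_le0; [ring|lra..].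
rewrite /pos; case: (leP (3 * y) 0) => h0; case: (leP (3 * y - 1) 0) => h1;
case: (leP (3 * y - 2) 0) => h2; case: (leP (3 * y - 3) 0) => h3; try lra.
have -> : y = 1 by lra.
by field.
Qed.

Lemma le_step y z : y <= z -> step y <= step z.
Proof.
move=> yz; rewrite -subr_ge0.
have [c _ ->] := @MVT_segment _ step step1 _ _ yz (fun x _ => is_derive_step x)
  (continuous_subspaceT continuous_step).
by rewrite mulr_ge0 ?subr_ge0//; have /andP[] := step1_bounds c.
Qed.

Lemma step_ge0 y : 0 <= step y.
Proof.
have [y0|/ltW y0] := leP y 0; first by rewrite step_le0.
by rewrite -(@step_le0 0)// le_step.
Qed.

Lemma step_le1 y : step y <= 1.
Proof.
have [y0|/ltW y0] := leP 1 y; first by rewrite step_ge1.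
by rewrite -(@step_ge1 1)// le_step.
Qed.

End step.

(** * Compact supports inside cylinders *)

Section supports.
Context {R : realType} {N : nat}.
Implicit Types (T : \bar R) (phi psi : 'rV[R]_N -> R -> R) (x : 'rV[R]_N) (t : R).

Lemma normrV_leP (x : 'rV[R]_N) r : 0 <= r ->
  reflect (forall i, `|x 0 i| <= r) (`|x| <= r).
Proof.
move=> r0; have -> : `|x| = mx_norm x by [].
rewrite mx_normrE; apply: (iffP idP) => [xr i|xr].
  apply: le_trans xr.
  exact: (le_bigmax _ (fun i : 'I_1 * 'I_N => `|x i.1 i.2|) (0, i)).
by apply/bigmax_leP; split => //= -[i j] _ /=; rewrite ord1.
Qed.

Lemma coord_le_norm (x : 'rV[R]_N) i : `|x 0 i| <= `|x|.
Proof. exact/normrV_leP. Qed.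

Lemma compact_norm_ball r : compact [set x : 'rV[R]_N | `|x| <= r].
Proof.
apply: bounded_closed_compact.
  by exists r; split; [exact: num_real|move=> s rs x /= xr; exact: le_trans xr (ltW rs)].
apply: (@closed_comp _ _ (fun x : 'rV[R]_N => `|x|) [set y | y <= r]).
  by move=> x _; exact: norm_continuous.
exact: closed_le.
Qed.

Definition cylinder (r s : R) : set ('rV[R]_N * R) :=
  [set z | `|z.1| <= r /\ 0 <= z.2 <= s].

Lemma compact_cylinder r s : compact (cylinder r s).
Proof.
have -> : cylinder r s = [set x : 'rV[R]_N | `|x| <= r] `*` `[0, s].
  by apply/seteqP; split => -[x t] /=; rewrite in_itv.
by apply: compact_setX; [exact: compact_norm_ball|exact: segment_compact].
Qed.

Lemma closed_cylinder r s : closed (cylinder r s).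
Proof. by apply: compact_closed; [exact: norm_hausdorff|exact: compact_cylinder]. Qed.

Definition vanishes_off T r s phi := forall x t, space_time T (x, t) ->
  ~ cylinder r s (x, t) -> phi x t = 0.

Lemma cylinder_space_time T r s : (s%:E < T)%E -> cylinder r s `<=` space_time T.
Proof.
by move=> sT [x t] [/= _ /andP[t0 ts]]; split => //=; apply: le_lt_trans sT; rewrite lee_fin.
Qed.

(** The maxima of $|x|$ and of $t$ over the compact support provide [r] and [s]. The maximum in time
    is attained at a point of [space_time], which is why [s] stays strictly below [T]. *)
Lemma C21cP T phi : (0 < T)%E -> C21c T phi <->
  C21 T phi /\ exists r s, [/\ 0 <= r, 0 <= s, (s%:E < T)%E & vanishes_off T r s phi].
Proof.
move=> T0; split=> -[Cphi].
  set K := _ `&` _ => cK; split => //.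
  have [K0|/set0P[z0 Kz0]] := eqVneq K set0.
    exists 0, 0; split => // x t xtT _; apply/eqP/negPn/negP => phi0.
    suff : K (x, t) by rewrite K0.
    by split => //; apply: subset_closure.
  have [z1 _ H1] : exists2 c, c \in K & forall z, z \in K -> `|z.1| <= `|c.1|.
    apply: compact_EVT_max => //; first by exists z0.
    apply: continuous_subspaceT => z.
    by apply: (@cvg_comp _ _ _ fst (fun x => `|x|)); [exact: cvg_fst|exact: norm_continuous].
  have [z2 Kz2 H2] : exists2 c, c \in K & forall z, z \in K -> z.2 <= c.2.
    apply: compact_EVT_max => //; first by exists z0.
    by apply: continuous_subspaceT => z; exact: cvg_snd.
  move: Kz2; rewrite inE => -[[z20 z2T] _].
  exists `|z1.1|, z2.2; split => // x t xtT nc; apply/eqP/negPn/negP => phi0.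
  have Kxt : K (x, t) by split => //; apply: subset_closure.
  apply: nc; split => /=; first by apply: (H1 (x, t)); rewrite inE.
  by case: xtT => /= -> _ /=; apply: (H2 (x, t)); rewrite inE.
move=> [r [s [r0 s0 sT v]]]; split => //.
have sub : closure [set z | space_time T z /\ phi z.1 z.2 != 0] `<=` cylinder r s.
  have -> := (closure_id _).1 (@closed_cylinder r s).
  apply: closure_subset => -[x t] /= [xtT phi0]; apply: contrapT => /(v _ _ xtT) e.
  by rewrite e eqxx in phi0.
rewrite setIidr; last by apply: subset_trans sub _; exact: cylinder_space_time.
by apply: (subclosed_compact _ (compact_cylinder (r := r) (s := s))) => //; exact: closed_closure.
Qed.

Lemma vanishes_near T r s phi x t : vanishes_off T r s phi -> space_time T (x, t) ->
  ~ cylinder r s (x, t) ->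
  \forall z \near (x, t), space_time T z -> phi z.1 z.2 = 0.
Proof.
move=> v xtT nc.
have : nbhs (x, t) (~` cylinder r s).
  by apply: open_nbhs_nbhs; split => //; exact/closed_openC/closed_cylinder.
by move=> H; apply: (filterS _ H) => -[y u] /= ncz yuT; exact: v.
Qed.

(** Cylinders are closed, so outside one the function vanishes on a neighbourhood in the domain and
    its quotients are eventually zero. *)
Lemma vanishes_dx T r s phi i : vanishes_off T r s phi -> vanishes_off T r s (dx i phi).
Proof.
move=> v x t xtT nc; have phi0 := v _ _ xtT nc.
have [] // := @space_quotientE _ _ phi i x t 0.
apply: cvg_near_cst.
have c : (h *: delta_mx 0 i + x, t) @[h --> 0^'] --> (x, t).
  apply: (@cvg_pair _ _ _ _ (nbhs x) (nbhs t)); last exact: cvg_cst.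
  have {2}-> : x = 0 *: delta_mx 0 i + x by rewrite scale0r add0r.
  by apply: cvgD; [apply: cvgZr_tmp; exact: dnbhs0|exact: cvg_cst].
have Hc : \forall h \near (0 : R)^', space_time T (h *: delta_mx 0 i + x, t) ->
    phi (h *: delta_mx 0 i + x) t = 0 := c _ (vanishes_near v xtT nc).
apply: (filterS _ Hc) => h H; rewrite /space_quotient phi0 H ?subrr ?mulr0//.
Qed.

Lemma vanishes_dt T r s phi : vanishes_off T r s phi -> vanishes_off T r s (dt phi).
Proof.
move=> v x t xtT nc; have phi0 := v _ _ xtT nc; case: (xtT) => /= t0 tT.
have ? := time_steps_proper t0.
apply: cvg_lim => //; apply: cvg_near_cst.
have c : (x, t + h) @[h --> time_steps t] --> (x, t).
  apply: (@cvg_pair _ _ _ _ (nbhs x) (nbhs t)); first exact: cvg_cst.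
  have {3}-> : t = t + 0 by rewrite addr0.
  by apply: cvgD; [exact: cvg_cst|exact: time_steps0].
(* The filter [time_steps] only keeps $t+h\ge0$; staying below [T] has to be added for small
   increments. *)
have cT : \forall h \near time_steps t, ((t + h)%:E < T)%E.
  case: T {v xtT} tT => [T||] // tT.
    have : \forall h \near time_steps t, t + h < T.
      have ct : t + h @[h --> time_steps t] --> t.
        have {3}-> : t = t + 0 by rewrite addr0.
        by apply: cvgD; [exact: cvg_cst|exact: time_steps0].
      by apply: (ct [set y | y < T]); exact: lt_nbhsl.
    by apply: filterS => h; rewrite lte_fin.
  by apply: filterE => h; rewrite ltry.
have Hc : \forall h \near time_steps t, space_time T (x, t + h) ->
    phi x (t + h) = 0 := c _ (vanishes_near v xtT nc).
near=> h; have H : space_time T (x, t + h) -> phi x (t + h) = 0 by near: h.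
rewrite /time_quotient phi0 H ?subrr ?mulr0//; split => /=.
  by near: h; exact: withinT.
by near: h.
Unshelve. all: by end_near. Qed.

Lemma vanishes_laplacian T r s phi : vanishes_off T r s phi ->
  vanishes_off T r s (laplacian phi).
Proof.
move=> v x t xtT nc; rewrite /laplacian big1// => i _.
exact: (vanishes_dx i (vanishes_dx i v)).
Qed.

End supports.

(** * Borel sets and Lebesgue measure in space-time *)

Notation lam R N := (lebesgue_rV R N \x @lebesgue_measure R)%E.

Section space_time_measurability.
Context {R : realType} {N : nat}.
Implicit Types (T : \bar R) (phi psi : 'rV[R]_N -> R -> R) (x : 'rV[R]_N) (t : R).

Lemma continuous_uncons_swap :
  continuous (fun y : 'rV[R]_N.+1 => ((uncons_rV y).2, (uncons_rV y).1 : R)).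
Proof.
move=> y A /nbhs_ballP[e /= e0 eA].
pose f (y : 'rV[R]_N.+1) := ((uncons_rV y).2, (uncons_rV y).1 : R).
have H : nbhs y (f @^-1` A); last exact: H.
apply/nbhs_ballP; exists e => //= z [_ yz]; apply: eA; split => /=.
  by split => // i j; rewrite !mxE; exact: (yz 0 (lift ord0 j)).
exact: (yz 0 0).
Qed.

(** Measurability here refers to the product sigma-algebra. Putting the time coordinate in front
    identifies the product with row vectors of length $N+1$, where open sets are measurable by
    definition. *)
Lemma open_measurable_prod (U : set ('rV[R]_N * R)) : open U -> measurable U.
Proof.
move=> oU.
pose sw (z : 'rV[R]_N * R) := @cons_rV R N (z.2, z.1).
have mU : measurable ((fun y : 'rV[R]_N.+1 => ((uncons_rV y).2, (uncons_rV y).1 : R)) @^-1` U).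
  apply: open_measurable_mx; apply: open_comp => // y _.
  exact: continuous_uncons_swap.
have msw : measurable_fun setT sw.
  apply: measurableT_comp; first exact: measurable_cons_rV.
  by apply/measurable_fun_pairP; split; [exact: measurable_snd|exact: measurable_fst].
have := msw measurableT _ mU; rewrite setTI.
rewrite (_ : sw @^-1` _ = U)//; apply/seteqP; split => -[x t];
  by rewrite /preimage /mkset /sw cons_rVK.
Qed.

Lemma closed_measurable_prod (U : set ('rV[R]_N * R)) : closed U -> measurable U.
Proof.
move=> cU; rewrite -(setCK U); apply: measurableC.
by apply: open_measurable_prod; exact: closed_openC.
Qed.

Lemma measurable_cylinder r s : measurable (@cylinder R N r s).
Proof. by apply: closed_measurable_prod; exact: closed_cylinder. Qed.

Definition slab (tau : R) T : set ('rV[R]_N * R) := [set z | tau < z.2 /\ (z.2%:E < T)%E].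

Lemma measurable_lte T : measurable [set t : R | (t%:E < T)%E].
Proof.
case: T => [r||].
- have -> : [set t : R | (t%:E < r%:E)%E] = `]-oo, r[%classic.
    by apply/seteqP; split => y /=; rewrite in_itv/= lte_fin.
  exact: measurable_itv.
- have -> : [set t : R | (t%:E < +oo)%E] = setT by apply/seteqP; split => y //= _; rewrite ltry.
  exact: measurableT.
- have -> : [set t : R | (t%:E < -oo)%E] = set0 by apply/seteqP; split.
  exact: measurable0.
Qed.

Lemma measurable_after tau T : measurable [set t : R | tau < t /\ (t%:E < T)%E].
Proof.
apply: measurableI; last exact: measurable_lte.
suff -> : (fun t : R => is_true (tau < t)) = `]tau, +oo[%classic.
  exact: measurable_itv.
by apply/seteqP; split => y /=; rewrite in_itv/= ?andbT.
Qed.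

Lemma measurable_slab tau T : measurable (slab tau T).
Proof.
rewrite (_ : slab tau T = setT `&` snd @^-1` [set t : R | tau < t /\ (t%:E < T)%E]); last first.
  by rewrite setTI.
by apply: measurable_snd => //; exact: measurable_after.
Qed.

Lemma measurable_space_time T : measurable (@space_time R N T).
Proof.
rewrite (_ : space_time T = setT `&` snd @^-1` [set t : R | 0 <= t /\ (t%:E < T)%E]); last first.
  by rewrite setTI.
apply: measurable_snd => //; apply: measurableI; last exact: measurable_lte.
suff -> : (fun t : R => is_true (0 <= t)) = `[0, +oo[%classic.
  exact: measurable_itv.
by apply/seteqP; split => y /=; rewrite in_itv/= ?andbT.
Qed.

Lemma slab_space_time tau T : 0 <= tau -> slab tau T `<=` space_time T.
Proof. by move=> tau0 [x t] /= [h1 h2]; split => //=; apply: le_trans tau0 (ltW _). Qed.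

Lemma ST_continuous_measurable T phi : ST_continuous T phi ->
  measurable_fun (space_time T) (fun z : 'rV[R]_N * R => phi z.1 z.2).
Proof.
move=> c; apply: (@measurability _ _ _ R _ _ _ (RGenOpens.measurableE R)).
move=> _ [_ [a [b ->]] <-].
set f := (fun z => _).
have : forall z, space_time T z -> f z \in `]a, b[ -> exists2 U, open U & U z /\
    U `&` space_time T `<=` f @^-1` `]a, b[.
  move=> z zT fz.
  have : nbhs (f z) `]a, b[%classic by apply: open_nbhs_nbhs; split => //; exact: interval_open.
  move/(c z zT); rewrite nbhs_filterE/= /fmap/= /within/= => H.
  rewrite /prop_near1 nbhsE in H; case: H => U [oU Uz] sU; exists U => //; split => //.
  by move=> y [Uy Ty]; exact: sU.
move=> H.
rewrite (_ : _ `&` _ = space_time T `&`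
   \bigcup_(U in [set U | open U /\ U `&` space_time T `<=` f @^-1` `]a, b[]) U); last first.
  apply/seteqP; split=> z [zT].
    by move=> fz; split => //; have [U oU [Uz sU]] := H z zT fz; exists U.
  by move=> [U [oU sU] Uz]; split => //; exact: sU.
apply: measurableI; first exact: measurable_space_time.
by apply: open_measurable_prod; apply: bigcup_open => U [].
Qed.

Lemma lebesgue_rV_norm_ball r : 0 <= r ->
  lebesgue_rV R N [set x | `|x| <= r] = ((2 * r) ^+ N)%:E.
Proof.
move=> r0; rewrite (_ : mkset _ = [set x : 'rV[R]_N | forall i,
    (const_mx (- r) : 'rV[R]_N) 0 i <= x 0 i <= (const_mx r : 'rV[R]_N) 0 i]); last first.
  apply/seteqP; split => x /=.
    by move/(normrV_leP _ r0) => h i; rewrite !mxE -ler_norml.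
  by move=> h; apply/(normrV_leP _ r0) => i; have := h i; rewrite !mxE -ler_norml.
rewrite lebesgue_rV_box; last by move=> i; rewrite !mxE; lra.
under eq_bigr do rewrite !mxE opprK.
by rewrite prodr_const card_ord; congr (_ ^+ _)%:E; ring.
Qed.

Lemma closed_norm_ball r : closed [set x : 'rV[R]_N | `|x| <= r].
Proof. by apply: compact_closed; [exact: norm_hausdorff|exact: compact_norm_ball]. Qed.

Lemma measurable_norm_ball r : measurable [set x : 'rV[R]_N | `|x| <= r].
Proof.
by rewrite -(setCK (mkset _)); apply: measurableC;
  apply: open_measurable_mx; exact/closed_openC/closed_norm_ball.
Qed.

Lemma lam_cylinder r s : 0 <= r -> 0 <= s ->
  lam R N (cylinder r s) = ((2 * r) ^+ N * s)%:E.
Proof.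
move=> r0 s0.
have -> : cylinder r s = [set x : 'rV[R]_N | `|x| <= r] `*` `[0, s]%classic.
  by apply/seteqP; split => -[x t] /=; rewrite in_itv.
rewrite product_measure1E//; last exact: measurable_norm_ball.
rewrite EFinM; congr (_ * _)%E; first exact: lebesgue_rV_norm_ball.
rewrite [LHS](lebesgue_measure_itv `[0, s])/= lte_fin -EFinB subr0.
by case: ltP => // s1; congr EFin; apply/eqP; rewrite eq_le s0 s1.
Qed.

End space_time_measurability.

(** * Integrability of the weak formulation *)

Section weak_formulation.
Context {R : realType} {N : nat}.
Implicit Types (T : \bar R) (phi psi u : 'rV[R]_N -> R -> R) (x : 'rV[R]_N) (t : R).

Lemma ST_bounded T r s phi : 0 <= r -> 0 <= s -> (s%:E < T)%E ->
  ST_continuous T phi -> vanishes_off T r s phi ->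
  exists2 C, 0 <= C & forall x t, space_time T (x, t) -> `|phi x t| <= C.
Proof.
move=> r0 s0 sT c v.
have [z Kz H] : exists2 z, z \in cylinder r s &
    forall y, y \in cylinder r s -> `|phi y.1 y.2| <= `|phi z.1 z.2|.
  apply: compact_EVT_max; last 1 first.
  - apply/subspace_continuousP => y Ky.
    apply: (@cvg_comp _ _ _ (fun y : 'rV[R]_N * R => phi y.1 y.2) (fun a => `|a|));
      last exact: norm_continuous.
    have cy := c y (cylinder_space_time sT Ky).
    have sub (P : set ('rV[R]_N * R)) : within (space_time T) (nbhs y) P ->
        within (cylinder r s) (nbhs y) P.
      rewrite /within/= => Q; apply: filterS Q => w /= + Kw.
      by apply; exact: cylinder_space_time Kw.
    by move=> A /cy; exact: (sub (_ @^-1` A)).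
  - by exists (0, 0); rewrite /cylinder/= normr0 lexx.
  - exact: compact_cylinder.
exists `|phi z.1 z.2| => // x t xtT.
have [Kxt|nK] := pselect (cylinder r s (x, t)); first by apply: (H (x, t)); rewrite inE.
by rewrite v// normr0.
Qed.

Lemma le1_powR (a b : R) : 0 < a -> 0 <= b -> b <= 1 -> b `^ a <= 1.
Proof.
move=> a0 b0 b1; have -> : 1 = 1 `^ a :> R by rewrite powR1.
by rewrite ge0_ler_powR ?nnegrE// ltW.
Qed.

Lemma powR_le1D (a p b : R) : 0 < a -> a <= p -> `|b `^ a| <= 1 + `|b| `^ p.
Proof.
move=> a0 ap; rewrite ger0_norm ?powR_ge0//.
have [b0|b0] := ltP b 0.
  (* Since [ln] is $0$ at nonpositive arguments, a power of a negative base has the value $1$. *)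
  have -> : b `^ a = 1 by rewrite /powR lt_eqF// ln0 ?ltW// mulr0 expR0.
  by rewrite lerDl powR_ge0.
rewrite (ger0_norm b0); have [b1|b1] := leP b 1.
  by apply: (le_trans (le1_powR a0 b0 b1)); rewrite lerDl powR_ge0.
by rewrite ler_wpDl// ler_powR// ltW.
Qed.

Lemma norm_le1D (p b : R) : 1 <= p -> `|b| <= 1 + `|b| `^ p.
Proof.
move=> p1; have [b1|b1] := leP `|b| 1; first by rewrite ler_wpDr// powR_ge0.
by rewrite ler_wpDl// -[leLHS]powRr1// ler_powR// ltW.
Qed.

(** The single place where the $L^p_{\rm loc}$ bound enters: $1+|u|^p$ is integrable on the compact
    cylinder, which has finite measure, and its extension by zero dominates [f]. *)
Lemma integrable_dominated (p : R) T r s u (f : 'rV[R]_N -> R -> R) C :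
  0 <= r -> 0 <= s -> (s%:E < T)%E -> Lp_loc p T u ->
  measurable_fun (space_time T) (fun z : 'rV[R]_N * R => f z.1 z.2) ->
  vanishes_off T r s f ->
  (forall x t, space_time T (x, t) -> `|f x t| <= C * (1 + `|u x t| `^ p)) ->
  (lam R N).-integrable (space_time T) (fun z => (f z.1 z.2)%:E).
Proof.
move=> r0 s0 sT [mu iu] mf v fC.
have mK := @measurable_cylinder R N r s; have mS := @measurable_space_time R N T.
have KS := cylinder_space_time sT : cylinder r s `<=` @space_time R N T.
pose g (z : 'rV[R]_N * R) := (1 + `|u z.1 z.2| `^ p)%:E.
have ig : (lam R N).-integrable (cylinder r s) g.
  apply: (@integrableD _ _ _ (lam R N) _ mK (cst 1%E)
    (fun z : 'rV[R]_N * R => (`|u z.1 z.2| `^ p)%:E)).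
    apply/integrableP; split; first exact: measurable_cst.
    rewrite [X in (X < _)%E](_ : _ = (\int[lam R N]_(z in cylinder r s) (cst 1%E z))%E).
      rewrite integral_cst// mul1e.
      by rewrite [X in (X < _)%E](lam_cylinder (N := N) r0 s0) ltry.
    by apply: eq_integral => z _; rewrite /= normr1.
  apply/integrableP; split.
    apply/measurable_EFinP.
    apply: (measurableT_comp (measurable_powR p)).
    apply: measurableT_comp; first exact: normr_measurable.
    exact: measurable_funS KS mu.
  rewrite [X in (X < _)%E](_ : _ =
    (\int[@space_time_measure R N]_(z in cylinder r s) (`|u z.1 z.2| `^ p)%:E)%E).
    by apply: iu => //; exact: compact_cylinder.
  by apply: eq_integral => z _; rewrite /= ger0_norm// powR_ge0.
have ig' : (lam R N).-integrable (space_time T) (fun z => C%:E * (g \_ (cylinder r s)) z)%E.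
  apply: integrableZl => //; apply: (iffLR (integrable_restrict (lam R N) mK mS g)).
  by rewrite (_ : _ `&` _ = cylinder r s)//; exact: setIidr.
apply: le_integrable ig' => //; first exact/measurable_EFinP.
move=> [x t] xtT; rewrite /patch; case: ifPn => [_|].
  by rewrite /= lee_fin (le_trans (fC _ _ xtT))// ler_norm.
by rewrite notin_setE => nK; rewrite mule0 v// normr0.
Qed.

Definition weak_integrand (m p : R) u phi x t : R :=
  - u x t * dt phi x t - u x t `^ m * laplacian phi x t - u x t `^ p * phi x t.

Lemma ST_continuous_laplacian T phi : C21 T phi -> ST_continuous T (laplacian phi).
Proof.
move=> C; have J := jet_cxx (C21_jet C); rewrite /laplacian.
elim: (index_enum _) => [|i e IH].
  apply: (@ST_continuous_eq _ _ T (fun _ _ => 0)); last exact: ST_continuous_cst.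
  by move=> x t _; rewrite big_nil.
apply: (@ST_continuous_eq _ _ T (fun x t => dx i (dx i phi) x t +
  \sum_(j <- e) dx j (dx j phi) x t)); last exact: ST_continuousD (J i i) IH.
by move=> x t _; rewrite big_cons.
Qed.

(** The exponents $1$, $m$ and $p$ all lie in $[1,p]$, so each power of [u] is at most $1+|u|^p$,
    and the factors coming from [phi] are bounded with support in a cylinder. *)
Lemma weak_integrand_integrable (m p : R) T u phi : 1 <= m -> m < p -> (0 < T)%E ->
  Lp_loc p T u -> C21c T phi ->
  (lam R N).-integrable (space_time T) (fun z => (weak_integrand m p u phi z.1 z.2)%:E).
Proof.
move=> m1 mp T0 Lu /(C21cP _ T0)[Cphi [r [s [r0 s0 sT v]]]].
have J := C21_jet Cphi; have [mu _] := Lu.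
have cl := ST_continuous_laplacian Cphi.
have [C1 C10 B1] := ST_bounded r0 s0 sT (jet_ct J) (vanishes_dt v).
have [C2 C20 B2] := ST_bounded r0 s0 sT cl (vanishes_laplacian v).
have [C3 C30 B3] := ST_bounded r0 s0 sT (jet_c J) v.
apply: (@integrable_dominated p T r s u _ (C1 + C2 + C3)) => //.
- apply: measurable_funB; first apply: measurable_funB.
  + apply: measurable_funM; first exact: measurableT_comp.
    exact: ST_continuous_measurable (jet_ct J).
  + apply: measurable_funM; last exact: ST_continuous_measurable.
    exact: (measurableT_comp (measurable_powR m)).
  + apply: measurable_funM; last exact: ST_continuous_measurable (jet_c J).
    exact: (measurableT_comp (measurable_powR p)).
- move=> x t xtT nc; rewrite /weak_integrand (vanishes_dt v)// v//.
  by rewrite (vanishes_laplacian v)// !mulr0 !subr0.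
- move=> x t xtT; rewrite /weak_integrand 2!mulrDl.
  apply: (le_trans (ler_normB _ _)); apply: lerD; last first.
    rewrite normrM mulrC ler_pM//; first exact: B3.
    by apply: powR_le1D => //; lra.
  apply: (le_trans (ler_normB _ _)); apply: lerD.
    rewrite normrM normrN mulrC ler_pM//; first exact: B1.
    by apply: norm_le1D; lra.
  rewrite normrM mulrC ler_pM//; first exact: B2.
  by apply: powR_le1D; lra.
Qed.

Lemma iterated_integral T tau (f : 'rV[R]_N -> R -> R) : 0 <= tau ->
  (lam R N).-integrable (space_time T) (fun z => (f z.1 z.2)%:E) ->
  (\int[@lebesgue_measure R]_(t in [set t : R | (tau < t)%R /\ (t%:E < T)%E])
    \int[lebesgue_rV R N]_x (f x t)%:E)%E =
  (\int[lam R N]_(z in slab tau T) (f z.1 z.2)%:E)%E.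
Proof.
move=> tau0 intf.
have {}intf : (lam R N).-integrable (slab tau T) (fun z => (f z.1 z.2)%:E).
  apply: integrableS intf; [exact: measurable_space_time|exact: measurable_slab|].
  exact: slab_space_time.
rewrite [RHS]integral_mkcond -fubini2; last first.
  exact: (iffLR (@integrable_mkcond _ _ _ (lam R N) (slab tau T)
    (fun z => (f z.1 z.2)%:E) (@measurable_slab R N tau T)) intf).
rewrite integral_mkcond; apply: eq_integral => t _.
rewrite /patch; case: ifPn => tT.
  by apply: eq_integral => x _ /=; rewrite /patch mem_set//; exact: (set_mem tT).
rewrite /fubini_G integral0_eq// => x _; rewrite /patch memNset// => xt.
by move/negP : tT; apply; exact: mem_set.
Qed.

End weak_formulation.

(** * Properties of almost every time slice *)

Section time_sections.
Context {R : realType} {N : nat}.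
Implicit Types (T : \bar R) (phi u : 'rV[R]_N -> R -> R) (x : 'rV[R]_N) (t : R).
Implicit Types psi : 'rV[R]_N -> R.

Lemma negligible_section (A : set ('rV[R]_N * measurableTypeR R)) :
  (lam R N).-negligible A ->
  {ae @lebesgue_measure R, forall t, (lebesgue_rV R N).-negligible [set x | A (x, t)]}.
Proof.
move=> [B [mB B0 AB]].
have int0 : (\int[@lebesgue_measure R]_t `|fubini_G (lebesgue_rV R N) (EFin \o \1_B) t| = 0)%E.
  under eq_integral do rewrite gee0_abs ?indic_fubini_tonelli_G_ge0//.
  rewrite -fubini_tonelli2//.
  - by rewrite integral_indic// setIT.
  - by apply/measurable_EFinP; exact: measurable_indic.
  - by move=> z; rewrite lee_fin.
have mG : measurable_fun setT (fubini_G (lebesgue_rV R N) (EFin \o \1_B)).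
  exact: indic_measurable_fun_fubini_tonelli_G.
have := (ae_eq_integral_abs (@lebesgue_measure R) measurableT mG).1 int0.
apply: filterS => t /(_ I) Bt; exists (ysection B t); split.
- exact: measurable_ysection.
- by move: Bt; rewrite indic_fubini_tonelli_GE.
- by move=> x /= Axt; rewrite ysectionE; exact: AB.
Qed.

Lemma ae_section_integrable T (f : 'rV[R]_N -> R -> R) :
  (lam R N).-integrable (space_time T) (fun z => (f z.1 z.2)%:E) ->
  {ae @lebesgue_measure R, forall t, 0 <= t -> (t%:E < T)%E ->
    (lebesgue_rV R N).-integrable setT (fun x => (f x t)%:E)}.
Proof.
move=> intf.
have := ae_integrable2 (iffLR (@integrable_mkcond _ _ _ (lam R N) (space_time T)
  (fun z => (f z.1 z.2)%:E) (@measurable_space_time R N T)) intf).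
apply: filterS => t + t0 tT.
rewrite (_ : (fun x => _) = fun x => (f x t)%:E)//.
by apply/funext => x; rewrite /patch mem_set.
Qed.

Lemma measurable_section T phi t : 0 <= t -> (t%:E < T)%E ->
  measurable_fun (space_time T) (fun z : 'rV[R]_N * R => phi z.1 z.2) ->
  measurable_fun setT (phi ^~ t).
Proof.
move=> t0 tT mphi.
apply: (@measurable_comp _ _ _ _ _ _ (@space_time R N T) (fun z => phi z.1 z.2) setT
  (fun x : 'rV[R]_N => (x, t : R))) => //.
- exact: measurable_space_time.
- by move=> _ [x _ <-]; split.

Qed.

(** These are the properties that make the pairing of the slice with bounded functions of bounded
    support finite, linear and monotone. *)
Definition good_time u t := [/\ measurable_fun setT (u ^~ t),
  {ae lebesgue_rV R N, forall x, 0 <= u x t} &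
  forall r, (lebesgue_rV R N).-integrable [set x | `|x| <= r] (fun x => (u x t)%:E)].

Lemma exhausting_times T : (0 < T)%E -> exists s : nat -> R,
  (forall n, 0 <= s n /\ ((s n)%:E < T)%E) /\
  forall t, 0 <= t -> (t%:E < T)%E -> exists n, t <= s n.
Proof.
move=> T0.
exists (fun n => if unpickle n is Some q then
  if (0 <= (ratr q : R)) && ((ratr q : R)%:E < T)%E then ratr (q : rat) else 0 else 0).
split=> [n|t t0 tT].
  by case: unpickle => [q|]; rewrite ?lexx//; case: ifPn => [/andP[]|]; rewrite ?lexx.
have [q tq qT] : exists2 q : rat, t <= ratr q & ((ratr q : R)%:E < T)%E.
  case: T T0 tT => [T||]// _ tT.
    rewrite lte_fin in tT; have [q] := rat_in_itvoo tT.
    by rewrite in_itv/= => /andP[/ltW tq qT]; exists q; rewrite ?lte_fin.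
  have [q] : exists q : rat, ratr q \in `]t, (t + 1)[ by apply: rat_in_itvoo; rewrite ltrDl.
  by rewrite in_itv/= => /andP[/ltW tq _]; exists q; rewrite ?ltry.
by exists (pickle q); rewrite pickleK (le_trans t0 tq) qT.
Qed.

Lemma ae_times2 (P Q S : R -> Prop) : (forall t, P t -> Q t -> S t) ->
  {ae @lebesgue_measure R, forall t : R, P t} ->
  {ae @lebesgue_measure R, forall t : R, Q t} ->
  {ae @lebesgue_measure R, forall t : R, S t}.
Proof.
move=> PQS HP HQ; apply: negligibleS (negligibleU HP HQ) => t /= nS.
by apply: contrapT => /not_orP[/contrapT Pt /contrapT Qt]; apply: nS; exact: PQS.
Qed.

Lemma good_times (p : R) T u : 1 <= p -> (0 < T)%E -> Lp_loc p T u -> ae_nonneg T u ->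
  {ae @lebesgue_measure R, forall t, 0 < t -> (t%:E < T)%E -> good_time u t}.
Proof.
move=> p1 T0 Lu nu; have [s [sT sup]] := exhausting_times T0.
have H1 := negligible_section nu.
have H2 : {ae @lebesgue_measure R, forall t (k n : nat), 0 <= t -> t <= s n ->
    (lebesgue_rV R N).-integrable [set x | `|x| <= k%:R] (fun x => (u x t)%:E)}.
  apply/ae_foralln => k; apply/ae_foralln => n; have [s0 snT] := sT n.
  pose f x t := ((fun z : 'rV[R]_N * R => u z.1 z.2) \_ (cylinder k%:R (s n))) (x, t).
  have mS := @measurable_space_time R N T; have mK := @measurable_cylinder R N k%:R (s n).
  have KS := cylinder_space_time snT : cylinder k%:R (s n) `<=` @space_time R N T.
  have := @ae_section_integrable T f _.
  have /[swap]/[apply] : (lam R N).-integrable (space_time T) (fun z => (f z.1 z.2)%:E).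
    apply: (@integrable_dominated _ _ p T k%:R (s n) u f 1) => //.
    - rewrite (_ : (fun z => _) = (fun z : 'rV[R]_N * R => u z.1 z.2) \_ (cylinder k%:R (s n))).
        apply: (iffLR (measurable_restrict _ mK mS)).
        rewrite (_ : _ `&` _ = cylinder k%:R (s n)); last exact: setIidr.
        exact: measurable_funS KS Lu.1.
      by apply/funext => -[].
    - by move=> x t _ nK; rewrite /f /patch memNset.
    - move=> x t _; rewrite mul1r /f /patch; case: ifPn => _; first exact: norm_le1D.
      by rewrite normr0 addr_ge0// powR_ge0.
  apply: negligibleS => t; apply: contra_not => H t0 ts.
  have := H t0 (le_lt_trans _ snT); rewrite lee_fin => /(_ ts) {}H.
  have : (lebesgue_rV R N).-integrable [set x | `|x| <= k%:R] (fun x => (f x t)%:E).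
    by apply: integrableS H => //; exact: measurable_norm_ball.
  apply: eq_integrable => //; first exact: measurable_norm_ball.
  by move=> x; rewrite inE/= => xk; rewrite /f /patch mem_set//; split => //=; rewrite t0.
apply: ae_times2 H1 H2 => t H1 H2 t0 tT; split.
- by apply: measurable_section tT _; [exact: ltW|exact: Lu.1].
- apply: negligibleS H1 => x /= H; by apply: contra_not H; apply.
- move=> r; have [n tn] := sup t (ltW t0) tT.
  have := H2 (Num.truncn `|r|).+1 n (ltW t0) tn; apply: integrableS.
  + exact: measurable_norm_ball.
  + exact: measurable_norm_ball.
  + move=> x /= xr; apply: le_trans xr _; apply: le_trans (ler_norm _) _.
    exact/ltW/truncnS_gt.
Qed.

End time_sections.

(** * Time cutoffs and limits of integrals over time slabs *)

Section trace_of_solutions.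
Context {R : realType} {N : nat}.
Implicit Types (T : \bar R) (phi u : 'rV[R]_N -> R -> R) (x : 'rV[R]_N) (t : R).
Implicit Types psi : 'rV[R]_N -> R.

Lemma C21M T phi phi' : C21 T phi -> C21 T phi' -> C21 T (fun x t => phi x t * phi' x t).
Proof. by move=> /C21_jet J /C21_jet J'; exact: jet_C21 (jetM J J'). Qed.

Lemma C21D T phi phi' : C21 T phi -> C21 T phi' -> C21 T (fun x t => phi x t + phi' x t).
Proof. by move=> /C21_jet J /C21_jet J'; exact: jet_C21 (jetD J J'). Qed.

Lemma C21Z T phi c : C21 T phi -> C21 T (fun x t => c * phi x t).
Proof. by move=> /C21_jet J; exact: jet_C21 (jetZ c J). Qed.

Lemma C21_cst T c : C21 T (fun (_ : 'rV[R]_N) _ => c).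
Proof. exact: jet_C21 (jet_cst T c). Qed.

Lemma C21_step T phi : C21 T phi -> C21 T (fun x t => step (phi x t)).
Proof.
move=> /C21_jet J.
exact: (jet_C21 (jet_comp (@is_derive_step R) (@is_derive_step1 R) (@continuous_step2 R) J)).
Qed.

Lemma C21_le T T' phi : (T' <= T)%E -> C21 T phi -> C21 T' phi.
Proof. by move=> TT' /C21_jet J; exact: jet_C21 (jet_le TT' J). Qed.

Lemma is_derive_affine (a c t : R) : is_derive t 1 (fun t : R => a * t + c) a.
Proof.
have da : is_derive t 1 (fun t : R => a * t) a.
  rewrite -[X in is_derive _ _ _ X]mulr1; exact: (is_deriveZ a (is_derive_id t 1)).
by have := is_deriveD da (is_derive_cst c t 1); rewrite addr0.
Qed.

Lemma C21_affine_time T (a c : R) : C21 T (fun (_ : 'rV[R]_N) t => a * t + c).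
Proof.
apply: jet_C21 (jet_time T (is_derive_affine a c) _).
by move=> t; exact: cvg_cst.
Qed.

Lemma C21_ext T phi phi' : (forall x t, phi x t = phi' x t) -> C21 T phi -> C21 T phi'.
Proof.
move=> e; suff -> : phi' = phi by [].
by apply/funext => x; apply/funext => t.
Qed.

Definition time_cutoff (b t : R) : R := 1 - step ((2 / b) * t + -1).

Lemma time_cutoff1 b t : 0 < b -> t <= b / 2 -> time_cutoff b t = 1.
Proof.
move=> b0 tb; rewrite /time_cutoff step_le0 ?subr0// mulrAC.
by rewrite -lerBrDr opprK add0r ler_pdivrMr// mul1r; lra.
Qed.

Lemma time_cutoff0 b t : 0 < b -> b <= t -> time_cutoff b t = 0.
Proof.
move=> b0 tb; rewrite /time_cutoff step_ge1 ?subrr// mulrAC.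
by rewrite -lerBlDr opprK ler_pdivlMr//; lra.
Qed.

Lemma C21_time_cutoff T b : C21 T (fun (_ : 'rV[R]_N) t => time_cutoff b t).
Proof.
apply: C21_ext (C21D (C21_cst T 1) (C21Z (-1) (C21_step (C21_affine_time T (2 / b) (-1))))).
by move=> x t; rewrite mulN1r.
Qed.

(** A spatial test function is treated as a $C^{2;1}$ function constant in time, so that the
    calculus of jets applies without a second version. *)
Definition C2c psi := C21 +oo%E (fun x (_ : R) => psi x) /\
  exists2 r, 0 <= r & forall x, r < `|x| -> psi x = 0.

Lemma C2c_C21c T b psi : 0 < b -> (b%:E < T)%E -> C2c psi ->
  C21c T (fun x t => psi x * time_cutoff b t).
Proof.
move=> b0 bT [Cpsi [r r0 psi0]].
have T0 : (0 < T)%E by apply: le_lt_trans bT; rewrite lee_fin ltW.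
apply: (iffRL (C21cP _ T0)); split.
  exact: (C21M (C21_le (leey T) Cpsi) (C21_time_cutoff T b)).
exists r, b; split => //; first exact: ltW.
move=> x t [/= t0 tT] nK; have [xr|xr] := ltP r `|x|; first by rewrite psi0// mul0r.
rewrite time_cutoff0 ?mulr0//; rewrite leNgt; apply/negP => tb; apply: nK.
by split => //=; rewrite t0 ltW.
Qed.

(** Dominated convergence along an arbitrary sequence of positive times tending to $0$; the
    indicators of the slabs converge pointwise on the open slab. Values pass through [fine] because
    the sequential criterion is applied to a real-valued function. *)
Lemma slab_cvg T (f : 'rV[R]_N -> R -> R) :
  (lam R N).-integrable (space_time T) (fun z => (f z.1 z.2)%:E) ->
  (\int[lam R N]_(z in slab tau T) (f z.1 z.2)%:E)%E @[tau --> (0 : R)^'+] -->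
  (\int[lam R N]_(z in slab 0 T) (f z.1 z.2)%:E)%E.
Proof.
move=> intf.
have mS (tau : R) := @measurable_slab R N tau T.
have int tau : 0 <= tau -> (lam R N).-integrable (slab tau T) (fun z => (f z.1 z.2)%:E).
  move=> tau0; apply: integrableS intf; [exact: measurable_space_time|exact: mS|].
  exact: slab_space_time.
have fin tau : 0 <= tau ->
    ((fine (\int[lam R N]_(z in slab tau T) (f z.1 z.2)%:E))%:E =
    \int[lam R N]_(z in slab tau T) (f z.1 z.2)%:E)%E.
  by move=> tau0; rewrite fineK//; apply: integrable_fin_num; [exact: mS|exact: int].
rewrite -(fin 0)//.
apply: cvg_EFin.
  near=> tau; apply: integrable_fin_num; [exact: mS|exact: int].
apply/cvg_at_rightP => a [a0 acvg].
apply: fine_cvg; rewrite fin//.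
pose F z := (f z.1 z.2)%:E.
have inta := int 0 (lexx _).
have [|||||_ _] := @dominated_convergence _ _ _ (lam R N) _ (mS 0)
    (fun n => F \_ (slab (a n) T)) F (abse \o F).
- move=> n; apply: (iffLR (measurable_restrict _ (mS (a n)) (mS 0))).
  apply: measurable_funS (mS 0) (@subIsetl _ _ _) _.
  exact: measurable_int inta.
- exact: measurable_int inta.
- apply: aeW => -[x t] [/= t0 tT]; apply: cvg_near_cst.
  have : \forall n \near \oo, a n < t by apply: (acvg [set y | y < t]); exact: lt_nbhsl.
  by apply: filterS => n ant; rewrite /patch mem_set.
- exact: integrable_abse.
- apply: aeW => -[x t] n [/= t0 tT]; rewrite /patch; case: ifPn => // _.
  by rewrite abse0.
apply: cvg_trans; apply: near_eq_cvg; apply: nearW => n /=.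
rewrite -integral_mkcondr setIidr// => -[x t] [/= at_ tT]; split => //=.
exact: lt_trans (a0 n) at_.
Unshelve. all: by end_near. Qed.

End trace_of_solutions.

(** * A one-sided approximate identity in time *)

Section approximate_identity.
Context {R : realType}.
Implicit Types (g : R -> R) (t tau : R).
Local Notation mu := (@lebesgue_measure R).

(** A smoothed indicator of the times after [tau], rising within $1/(n+1)$; its derivative
    [time_bump] is the approximate identity. *)
Definition ramp (n : nat) tau t : R := step (n.+1%:R * t + - (n.+1%:R * tau)).
Definition time_bump (n : nat) tau t : R := n.+1%:R * step1 (n.+1%:R * t + - (n.+1%:R * tau)).

Lemma is_derive_ramp n tau t : is_derive t 1 (ramp n tau) (time_bump n tau t).
Proof.
rewrite /time_bump mulrC.
exact: (is_derive1_comp (is_derive_step _) (is_derive_affine _ _ _)).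
Qed.

Lemma continuous_bump n tau : continuous (time_bump n tau).
Proof.
move=> t; apply: cvgM; first exact: cvg_cst.
apply: (@cvg_comp _ _ _ (fun t : R => n.+1%:R * t + - (n.+1%:R * tau)) step1);
  last exact: continuous_step1.
by apply: cvgD; [apply: cvgM; [exact: cvg_cst|exact: cvg_id]|exact: cvg_cst].
Qed.

Lemma measurable_bump n tau : measurable_fun setT (time_bump n tau).
Proof. exact: continuous_measurable_fun (@continuous_bump n tau). Qed.

Lemma bump_bounds n tau t : 0 <= time_bump n tau t <= 3 * n.+1%:R.
Proof.
rewrite /time_bump; have /andP[h1 h2] := step1_bounds (n.+1%:R * t + - (n.+1%:R * tau)).
by rewrite mulr_ge0//= mulrC ler_wpM2r.
Qed.

Lemma bump_outside n tau t : ~ (tau <= t <= tau + n.+1%:R^-1) -> time_bump n tau t = 0.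
Proof.
move=> h; rewrite /time_bump step1_outside ?mulr0// -mulrBr.
have [tt|tt] := leP t tau; first by left; rewrite pmulr_rle0// subr_le0.
right; rewrite -ler_pdivrMl// mulr1 lerBrDl leNgt; apply/negP => H.
by apply: h; rewrite !ltW.
Qed.

Lemma ramp_before n tau t : t <= tau -> ramp n tau t = 0.
Proof. by move=> tt; rewrite /ramp step_le0// -mulrBr pmulr_rle0// subr_le0. Qed.

Lemma ramp_after n tau t : tau + n.+1%:R^-1 <= t -> ramp n tau t = 1.
Proof.
move=> tt; rewrite /ramp step_ge1// -mulrBr -ler_pdivrMl// mulr1.
by rewrite lerBrDl.
Qed.

Lemma ramp_cvg tau t : ramp n tau t @[n --> \oo] --> (if tau < t then 1 else 0 : R).
Proof.
have [tt|tt] := ltP tau t; last by apply: cvg_near_cst; apply: nearW => n; rewrite ramp_before.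
have t0 : 0 < t - tau by rewrite subr_gt0.
apply: cvg_near_cst; near=> n; apply: ramp_after.
rewrite -lerBrDl ltW//; near: n; exact: (near_infty_natSinv_lt (PosNum t0)).
Unshelve. all: by end_near. Qed.

Lemma integral_bump n tau :
  (\int[mu]_(t in `[tau, (tau + n.+1%:R^-1)%R]) (time_bump n tau t)%:E = 1)%E.
Proof.
have lt : tau < tau + n.+1%:R^-1 by rewrite ltrDl invr_gt0.
rewrite (@continuous_FTC2 _ _ (ramp n tau))//.
- by rewrite ramp_after// ramp_before// sube0.
- exact/continuous_subspaceT/continuous_bump.
- split.
  + by move=> t _; have [] := is_derive_ramp n tau t.
  + apply: cvg_at_right_filter; apply: differentiable_continuous.
    by apply/derivable1_diffP; have [] := is_derive_ramp n tau tau.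
  + apply: cvg_at_left_filter; apply: differentiable_continuous.
    by apply/derivable1_diffP; have [] := is_derive_ramp n tau (tau + n.+1%:R^-1).
- by move=> t _; rewrite derive1E; have [_ ->] := is_derive_ramp n tau t.
Qed.

(** The bump has integral $1$, so the error is an integral of $g-g(\tau)$ against it. The bump is at
    most $3(n+1)$ and lives inside the ball of radius $2/(n+1)$, of measure $4/(n+1)$; hence the
    error is at most $12$ times the mean oscillation over that ball. *)
Lemma lebesgue_pt_bump g tau : mu.-integrable setT (EFin \o g) -> lebesgue_pt g tau ->
  (\int[mu]_t (g t * time_bump n tau t)%:E)%E @[n --> \oo] --> (g tau)%:E.
Proof.
move=> ig lg.
pose I n : set R := `[tau, tau + n.+1%:R^-1]%classic.
have mI n : measurable (I n) by exact: measurable_itv.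
have mg : measurable_fun setT g by apply/measurable_EFinP; exact: measurable_int ig.
have mIE n : mu (I n) = (n.+1%:R^-1)%:E.
  rewrite [LHS](lebesgue_measure_itv `[tau, (tau + n.+1%:R^-1)%R])/= lte_fin.
  by rewrite ltrDl invr_gt0 ltr0n/= -EFinB addrC addKr.
have igI n : mu.-integrable (I n) (EFin \o g) by exact: (@integrableS _ _ _ mu setT (I n) _ measurableT (mI n) (@subsetT _ _) ig).
have icst n (c : R) : mu.-integrable (I n) (EFin \o cst c).
  apply/integrableP; split; first exact/measurable_EFinP/measurable_cst.
  rewrite (eq_integral (cst `|c|%:E))//.
  rewrite integral_cst; last exact: mI.
  rewrite (_ : (_ * _)%E = (`|c| * n.+1%:R^-1)%:E) ?ltry//.
  by rewrite EFinM; congr (_ * _)%E; exact: mIE.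
have ib n (f : R -> R) : measurable_fun setT f -> mu.-integrable (I n) (EFin \o f) ->
    mu.-integrable (I n) (fun t => (f t * time_bump n tau t)%:E).
  move=> mf iff'; apply: (@le_integrable _ _ _ mu _ (mI n) _
      (fun t => (3 * n.+1%:R)%:E * (EFin \o f) t)%E); last exact: (@integrableZl _ _ _ mu _ (mI n) _ _ iff').
    apply/measurable_EFinP; apply: measurable_funTS; apply: measurable_funM => //.
    exact: measurable_bump.
  move=> t _; have /andP[b0 b1] := bump_bounds n tau t.
  rewrite /= lee_fin [leLHS]normrM [leRHS]normrM mulrC (ger0_norm b0).
  by rewrite (@ger0_norm _ (3 * _)) ?mulr_ge0// ler_wpM2r.
have E n : (\int[mu]_t (g t * time_bump n tau t)%:E - (g tau)%:E =
    \int[mu]_(t in I n) ((g t - g tau) * time_bump n tau t)%R%:E)%E.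
  have -> : (\int[mu]_t (g t * time_bump n tau t)%:E =
      \int[mu]_(t in I n) (g t * time_bump n tau t)%:E)%E.
    rewrite [RHS]integral_mkcond; apply: eq_integral => t _; rewrite /patch.
    case: ifPn => // /negP h; rewrite bump_outside ?mulr0// => tI.
    by apply: h; apply: mem_set; rewrite /I/= in_itv.
  rewrite -[X in (_ - X)%E]mule1 -(integral_bump n tau) -integralZl//; last first.
    have := ib n (cst 1) (measurable_cst _) (icst n 1).
    by under eq_fun do rewrite mul1r.
  rewrite -integralB//.
  - by apply: eq_integral => t _; rewrite mulrBl EFinB EFinM.
  - exact: mI.
  - exact: (ib n g mg (igI n)).
  - exact: (ib n (cst (g tau)) (measurable_cst _) (icst n _)).
have B n : (`|\int[mu]_t (g t * time_bump n tau t)%:E - (g tau)%:E| <=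
    12%:E * davg g tau (2 / n.+1%:R))%E.
  rewrite E.
  have igd : mu.-integrable (I n) (EFin \o (fun t => g t - g tau)).
    exact: (@integrableB _ _ _ mu _ (mI n) _ _ (igI n) (icst n (g tau))).
  have mgd : measurable_fun setT (fun t => g t - g tau) by exact: measurable_funB.
  apply: (le_trans (@le_abse_integral _ _ _ mu _ _ (mI n) (measurable_int _ (ib n _ mgd igd)))).
  have r0 : 0 < 2 / n.+1%:R :> R by rewrite divr_gt0.
  rewrite /davg /iavg lebesgue_measure_ball; last exact: ltW.
  rewrite inver ?mulrn_eq0 ?(gt_eqF r0)// muleA -EFinM.
  rewrite [X in (X%:E * _)%E](_ : _ = 3 * n.+1%:R); last first.
    by rewrite -mulr_natr; field.
  have mb : measurable (ball tau (2 / n.+1%:R : R)) by exact: measurable_ball.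
  rewrite -ge0_integralZl//; last first.
    by apply: measurable_funTS; apply: measurableT_comp => //; exact/measurable_EFinP.
  apply: (@le_trans _ _ (\int[mu]_(t in I n) ((3 * n.+1%:R)%:E * `|(g t - g tau)%:E|))%E).
    apply: ge0_le_integral => //.
    + exact: mI.
    + by apply: measurableT_comp => //; exact: measurable_int (ib n _ mgd igd).
    + apply: measurable_funeM; apply: measurable_funTS; apply: measurableT_comp => //.
      exact/measurable_EFinP.
    move=> t _; rewrite /= lee_fin normrM mulrC ler_wpM2r//.
    by have /andP[b0 b1] := bump_bounds n tau t; rewrite ger0_norm.
  apply: ge0_subset_integral => //.
  - exact: mI.
  - apply: measurable_funeM; apply: measurable_funTS; apply: measurableT_comp => //.
    exact/measurable_EFinP.
  - move=> t; rewrite /I/= in_itv/= /ball/= => /andP[t1 t2].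
    rewrite ltr_distlC; apply/andP; split.
      by apply: lt_le_trans t1; rewrite ltrBlDr ltrDl.
    apply: le_lt_trans t2 _; rewrite ltrD2l.
    by rewrite -[ltLHS]mul1r ltr_pM2r ?invr_gt0// ltr1n.
have D : (12%:E * davg g tau (2 / n.+1%:R))%E @[n --> \oo] --> 0%E.
  rewrite -(mule0 12%:E); apply: cvgeZl => //.
  apply: ((cvge_at_rightP (davg g tau) 0 0).1 lg); split; first by move=> n; rewrite divr_gt0.
  rewrite -[X in _ --> X](mulr0 2); apply: cvgM; first exact: cvg_cst.
  exact: cvg_harmonic.
apply/sube_cvg0 => //; apply/cvg_abse0P.
apply: (squeeze_cvge _ (cvg_cst 0%E) D).
by apply: nearW => n; rewrite /= abse_ge0/=; exact: B.
Qed.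

End approximate_identity.

(** * The weak form as a tail integral, and the passage from (P) to (E) *)

Section solutions.
Context {R : realType} {N : nat}.
Implicit Types (m p : R) (T : \bar R) (phi u : 'rV[R]_N -> R -> R) (x : 'rV[R]_N) (t : R).
Implicit Types psi : 'rV[R]_N -> R.
Local Notation mu := (@lebesgue_measure R).

Lemma weak_formE m p T u phi tau : 1 <= m -> m < p -> (0 < T)%E ->
  Lp_loc p T u -> C21c T phi -> 0 <= tau ->
  weak_form m p T u phi tau =
  (\int[lam R N]_(z in slab tau T) (weak_integrand m p u phi z.1 z.2)%:E)%E.
Proof.
move=> hm hmp T0 Lu Cphi tau0.
exact: (iterated_integral tau0 (weak_integrand_integrable hm hmp T0 Lu Cphi)).
Qed.

Lemma near_at_right0 T : (0 < T)%E -> \forall t \near (0 : R)^'+, 0 < t /\ (t%:E < T)%E.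
Proof.
case: T => [T||]//; rewrite ?lte_fin => T0.
  near=> t; split; first by near: t; exact: nbhs_right_gt.
  by rewrite lte_fin; near: t; exact: nbhs_right_lt.
near=> t; split; last by rewrite ltry.
by near: t; exact: nbhs_right_gt.
Unshelve. all: by end_near. Qed.

Lemma ess_cvg_at_right_eq (f g : R -> \bar R) T l : (0 < T)%E ->
  {ae mu, forall t : R, 0 < t -> (t%:E < T)%E -> f t = g t} ->
  f t @[t --> (0 : R)^'+] --> l -> ess_cvg_at_right g 0 l.
Proof.
move=> T0 fg fl; exists (~` [set t : R | 0 < t -> (t%:E < T)%E -> f t = g t]) => //.
rewrite setCK; set S := mkset _.
have sub (A : set R) : (0 : R)^'+ A -> within S (0 : R)^'+ A by exact: filterS.
have : f t @[t --> within S (0 : R)^'+] --> l by move=> A /fl; exact: sub.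
apply: cvg_trans; apply: near_eq_cvg.
have H := near_at_right0 T0; rewrite near_withinE.
by apply: (filterS _ H) => t [t0 tT] /(_ t0 tT).
Qed.

(** The equation identifies the pairing with the weak form at almost every time, and the weak form
    is a tail integral, continuous down to time $0$. *)
Lemma solution_E_trace m p T u phi : 1 <= m -> m < p -> (0 < T)%E ->
  solution_E m p T u -> C21c T phi ->
  ess_cvg_at_right (fun t => \int[lebesgue_rV R N]_x (u x t * phi x t)%:E)%E 0
    (weak_form m p T u phi 0).
Proof.
move=> hm hmp T0 [Lu nu E] Cphi.
have intF := weak_integrand_integrable hm hmp T0 Lu Cphi.
apply: (ess_cvg_at_right_eq T0 (E _ Cphi)).
rewrite weak_formE//.
apply: cvg_trans (slab_cvg intF); apply: near_eq_cvg; near=> t.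
by rewrite weak_formE.
Unshelve. all: by end_near. Qed.

Lemma integrable_pairing p T u phi : 1 <= p -> (0 < T)%E -> Lp_loc p T u -> C21c T phi ->
  (lam R N).-integrable (space_time T) (fun z => (u z.1 z.2 * phi z.1 z.2)%:E).
Proof.
move=> p1 T0 Lu /(C21cP _ T0)[Cphi [r [s [r0 s0 sT v]]]].
have J := C21_jet Cphi.
have [C C0 B] := ST_bounded r0 s0 sT (jet_c J) v.
apply: (@integrable_dominated _ _ p T r s u (fun x t => u x t * phi x t) C) => //.
- by apply: measurable_funM; [exact: Lu.1|exact: ST_continuous_measurable (jet_c J)].
- by move=> x t xtT nc; rewrite v// mulr0.
- move=> x t xtT; rewrite normrM mulrC ler_pM//; first exact: B.
  exact: norm_le1D.
Qed.

Lemma weak_integrandM_time m p T u phi (e e' : R -> R) x t :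
  C21 T phi -> (forall t, is_derive t 1 e (e' t)) -> continuous e' ->
  space_time T (x, t) ->
  weak_integrand m p u (fun x t => phi x t * e t) x t =
  weak_integrand m p u phi x t * e t - u x t * phi x t * e' t.
Proof.
move=> Cphi de ce' xtT; have J := C21_jet Cphi.
have JM := jetM J (jet_time T de ce').
rewrite /weak_integrand (jet_dt JM xtT) (jet_laplacian JM xtT).
under eq_bigr do rewrite !mulr0 !addr0.
by rewrite -mulr_suml -/(laplacian phi x t); ring.
Qed.

Lemma integrable_fubini_G (H : 'rV[R]_N * measurableTypeR R -> \bar R) :
  (lam R N).-integrable setT H -> mu.-integrable setT (fubini_G (lebesgue_rV R N) H).
Proof.
move=> iH; apply/integrableP; split; first exact: measurable_fubini_G iH.
have mH := measurable_int _ iH.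
apply: le_lt_trans ((integrable21ltyP _ _ mH).1 iH).
apply: ge0_le_integral => //.
- by apply: measurableT_comp => //; exact: measurable_fubini_G iH.
- apply: (measurable_fun_fubini_tonelli_G (fun z => `|H z|%E)) => //.
  exact: measurableT_comp.
- move=> t _; apply: le_abse_integral => //; exact: measurable_fun_pair1.
Qed.

(** The slice integrals of [h] may fail to exist on a null set of times. Replacing them by [fine] of
    the Fubini integral, extended by zero in time, gives an honest real function whose Lebesgue
    points can be used. *)
Lemma integral_pairing_time T (h : 'rV[R]_N -> R -> R) :
  (lam R N).-integrable (space_time T) (fun z => (h z.1 z.2)%:E) ->
  exists g : R -> R, [/\ mu.-integrable setT (EFin \o g),
    {ae mu, forall t : R, 0 < t -> (t%:E < T)%E ->
      (\int[lebesgue_rV R N]_x (h x t)%:E = (g t)%:E)%E} &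
    forall b : R -> R, continuous b -> (exists C, forall t, `|b t| <= C) ->
      (\int[lam R N]_(z in slab 0 T) (h z.1 z.2 * b z.2)%:E =
       \int[mu]_t (g t * b t)%:E)%E].
Proof.
move=> inth.
have mS := @measurable_slab R N 0 T.
have inth0 : (lam R N).-integrable (slab 0 T) (fun z => (h z.1 z.2)%:E).
  apply: integrableS inth; [exact: measurable_space_time|exact: mS|exact: slab_space_time].
pose H := (fun z : 'rV[R]_N * R => (h z.1 z.2)%:E) \_ (slab 0 T).
have iH : (lam R N).-integrable setT H.
  exact: (iffLR (@integrable_mkcond _ _ _ (lam R N) (slab 0 T) _ mS) inth0).
have iG := integrable_fubini_G iH; have aeH := ae_integrable2 iH.
pose G := fubini_G (lebesgue_rV R N) H; pose g t := fine (G t).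
have mg : measurable_fun setT g.
  by apply: measurableT_comp => //; exact: measurable_fubini_G iH.
have ig : mu.-integrable setT (EFin \o g).
  apply: le_integrable iG => //; first exact/measurable_EFinP.
  move=> t _; have fle y : (`|(fine y : R)%:E| <= `|y|)%E.
    by case: y => [r||] /=; rewrite ?lexx ?normr0 ?leey.
  exact: fle.
have Gfin : {ae mu, forall t : R, G t = (g t)%:E}.
  apply: negligibleS (integrable_ae measurableT iG) => t; apply: contra_not => /(_ I) fi.
  exact: esym (fineK fi).
exists g; split => //.
  apply: negligibleS Gfin => t; apply: contra_not => Gt t0 tT; rewrite -Gt /G /fubini_G.
  by apply: eq_integral => x _; rewrite /H /patch mem_set.
move=> b cb [C bC].
have mb : measurable_fun setT b by exact: continuous_measurable_fun.
pose Hb := (fun z : 'rV[R]_N * R => (h z.1 z.2 * b z.2)%:E) \_ (slab 0 T).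
have HbE z : Hb z = (H z * (b z.2)%:E)%E.
  by rewrite /Hb /H /patch; case: ifP => _; rewrite ?EFinM// mul0e.
have iHb : (lam R N).-integrable setT Hb.
  apply: (@le_integrable _ _ _ (lam R N) _ measurableT _ (fun z => C%:E * H z)%E).
  - rewrite (_ : Hb = fun z => (H z * (b z.2)%:E)%E); last by apply/funext => z; exact: HbE.
    apply: emeasurable_funM; first exact: measurable_int iH.
    by apply/measurable_EFinP; apply: measurableT_comp => //; exact: measurable_snd.
  - move=> z _; rewrite HbE !abseM muleC lee_wpmul2r// lee_fin.
    by rewrite (le_trans (bC _))// ler_norm.
  - exact: integrableZl.
rewrite integral_mkcond -[LHS]/(\int[lam R N]_z Hb z)%E -fubini2//.
apply: ae_eq_integral => //.
- exact: measurable_fubini_G iHb.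
- by apply/measurable_EFinP; apply: measurable_funM.
apply: negligibleS (negligibleU aeH Gfin) => t /= nt; apply: contrapT => /not_orP[/contrapT a1 /contrapT a2].
apply: nt => _; rewrite /fubini_G; under eq_integral do rewrite HbE/=.
by rewrite integralZr// -[X in (X * _)%E]/(G t) a2 EFinM.
Qed.

Lemma solution_PE m p T (nu : {measure set 'rV[R]_N -> \bar R}) u :
  1 <= m -> m < p -> (0 < T)%E -> solution_P m p T nu u -> solution_E m p T u.
Proof.
move=> hm hmp T0 [Lu nnu P]; split => // phi Cphi.
have p1 : 1 <= p by lra.
have inth := integrable_pairing p1 T0 Lu Cphi.
have intF := weak_integrand_integrable hm hmp T0 Lu Cphi.
have [g [ig gE gb]] := integral_pairing_time (h := fun x t => u x t * phi x t) inth.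
have lg : {ae mu, forall t : R, lebesgue_pt g t}.
  apply: lebesgue_differentiation; exact: (open_integrable_locally openT ig).
apply: ae_times2 gE lg => tau gE lg tau0 tauT; rewrite (gE tau0 tauT) (weak_formE hm hmp T0 Lu Cphi (ltW tau0)).
have [Cphi2 [r [s [r0 s0 sT v]]]] := iffLR (C21cP phi T0) Cphi.
have Cn n : C21c T (fun x t => phi x t * ramp n tau t).
  apply: (iffRL (C21cP _ T0)); split; last first.
    by exists r, s; split => // x t xtT nc; rewrite v// mul0r.
  exact: (C21M Cphi2 (jet_C21 (jet_time T (is_derive_ramp n tau) (@continuous_bump R n tau)))).
have mS := @measurable_slab R N 0 T.
have S : slab 0 T `<=` @space_time R N T by exact: slab_space_time.
have intF0 : (lam R N).-integrable (slab 0 T) (fun z => (weak_integrand m p u phi z.1 z.2)%:E).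
  by apply: integrableS intF => //; exact: measurable_space_time.
pose A n (z : 'rV[R]_N * R) := (weak_integrand m p u phi z.1 z.2 * ramp n tau z.2)%:E.
pose B n (z : 'rV[R]_N * R) := (u z.1 z.2 * phi z.1 z.2 * time_bump n tau z.2)%:E.
have ramp01 n t : 0 <= ramp n tau t <= 1 by rewrite step_ge0 step_le1.
have mramp n : measurable_fun setT (fun z : 'rV[R]_N * measurableTypeR R => ramp n tau z.2).
  apply: (measurableT_comp _ measurable_snd); apply: continuous_measurable_fun => t.
  apply: differentiable_continuous.
  by apply/derivable1_diffP; have [] := is_derive_ramp n tau t.
have iA n : (lam R N).-integrable (slab 0 T) (A n).
  apply: (@le_integrable _ _ _ (lam R N) _ mS _ _ _ _ intF0).
    apply/measurable_EFinP; apply: measurable_funM; last exact: measurable_funTS (mramp n).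
    by apply/measurable_EFinP; exact: measurable_int intF0.
  move=> z _; rewrite /A /= lee_fin normrM ler_piMr//.
  by have /andP[a0 a1] := ramp01 n z.2; rewrite ger0_norm.
have iFn n : (lam R N).-integrable (slab 0 T)
    (fun z => (weak_integrand m p u (fun x t => phi x t * ramp n tau t) z.1 z.2)%:E).
  have := weak_integrand_integrable hm hmp T0 Lu (Cn n).
  by apply: integrableS => //; exact: measurable_space_time.
have FnE n z : slab 0 T z ->
    (weak_integrand m p u (fun x t => phi x t * ramp n tau t) z.1 z.2)%:E = (A n z - B n z)%E.
  case: z => x t xtT; rewrite -EFinB.
  rewrite (weak_integrandM_time (T := T) m p u Cphi2 (is_derive_ramp n tau))//.
    exact: continuous_bump.
  exact: S.
have iB n : (lam R N).-integrable (slab 0 T) (B n).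
  have := @integrableB _ _ _ (lam R N) _ mS _ _ (iA n) (iFn n).
  apply: eq_integrable => // z; rewrite inE => zT.
  by rewrite FnE// /A /B -!EFinB; congr EFin; ring.
have AB n : (\int[lam R N]_(z in slab 0 T) A n z = \int[lam R N]_(z in slab 0 T) B n z)%E.
  have fA : (\int[lam R N]_(z in slab 0 T) A n z)%E \is a fin_num.
    exact: (@integrable_fin_num _ _ _ (lam R N) _ mS _ (iA n)).
  have fB : (\int[lam R N]_(z in slab 0 T) B n z)%E \is a fin_num.
    exact: (@integrable_fin_num _ _ _ (lam R N) _ mS _ (iB n)).
  have : (\int[lam R N]_(z in slab 0 T) A n z - \int[lam R N]_(z in slab 0 T) B n z = 0)%E.
    rewrite -(@integralB _ _ _ (lam R N) _ mS _ _ (iA n) (iB n)).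
    transitivity (\int[lam R N]_(z in slab 0 T)
        (weak_integrand m p u (fun x t => phi x t * ramp n tau t) z.1 z.2)%:E)%E.
      by apply: eq_integral => z /set_mem zT; rewrite FnE.
    (* The initial term of (P) vanishes because the ramp is still zero at time $0\le\tau$. *)
    rewrite -(weak_formE hm hmp T0 Lu (Cn n) (lexx 0)) (P _ (Cn n)) integral0_eq// => x _.
    by rewrite ramp_before ?mulr0// ltW.
  rewrite -(fineK fA) -(fineK fB) -EFinB => -[] /eqP.
  by rewrite subr_eq0 => /eqP ->.
have limA : (\int[lam R N]_(z in slab 0 T) A n z)%E @[n --> \oo] -->
    (\int[lam R N]_(z in slab tau T) (weak_integrand m p u phi z.1 z.2)%:E)%E.
  have -> : (\int[lam R N]_(z in slab tau T) (weak_integrand m p u phi z.1 z.2)%:E =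
    \int[lam R N]_(z in slab 0 T) (weak_integrand m p u phi z.1 z.2 *
      (if tau < z.2 then 1 else 0))%:E)%E.
    have -> : slab tau T = slab 0 T `&` @slab R N tau T.
      by rewrite setIidr// => -[x t] [/= h1 h2]; split => //=; exact: lt_trans h1.
    rewrite integral_mkcondr; apply: eq_integral => -[x t] /set_mem[/= t0 tT].
    rewrite /patch; case: ifPn => [/set_mem[/= -> _]|]; first by rewrite mulr1.
    move/negP => h; case: ifPn => tt; last by rewrite mulr0.
    by exfalso; apply: h; apply: mem_set.
  apply: (@dominated_cvg _ _ _ (lam R N) _ mS A _ _ _ _ _ (integrable_abse intF0)).
  - by move=> n; exact: measurable_int (iA n).
  - move=> [x t] _; rewrite /A/=; apply: cvg_EFin; first exact: nearW.
    by apply: cvgM; [exact: cvg_cst|exact: ramp_cvg].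
  - by [].
  - move=> n z _; rewrite /A /= lee_fin normrM ler_piMr//.
    by have /andP[a0 a1] := ramp01 n z.2; rewrite ger0_norm.
have limB : (\int[lam R N]_(z in slab 0 T) B n z)%E @[n --> \oo] --> (g tau)%:E.
  rewrite (_ : (fun n => _) = fun n => (\int[mu]_t (g t * time_bump n tau t)%:E)%E).
    exact: lebesgue_pt_bump.
  apply/funext => n; apply: gb; first exact: continuous_bump.
  by exists (3 * n.+1%:R) => t; have /andP[b0 b1] := bump_bounds n tau t; rewrite ger0_norm.
apply: cvg_unique limA _ => //.
by rewrite (_ : (fun n => _) = fun n => (\int[lam R N]_(z in slab 0 T) B n z)%E)//; apply/funext.
Qed.

End solutions.

(** * Spatial test functions and cutoffs *)

Section compactly_supported_functions.
Context {R : realType} {N : nat}.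
Implicit Types (f g psi : 'rV[R]_N -> R) (x : 'rV[R]_N).

Lemma C2cD f g : C2c f -> C2c g -> C2c (fun x => f x + g x).
Proof.
move=> [Cf [r r0 f0]] [Cg [s s0 g0]]; split; first exact: C21D Cf Cg.
exists (Num.max r s); first by rewrite le_max r0.
by move=> x; rewrite gt_max => /andP[xr xs]; rewrite f0// g0// addr0.
Qed.

Lemma C2cZ c f : C2c f -> C2c (fun x => c * f x).
Proof.
move=> [Cf [r r0 f0]]; split; first exact: C21Z Cf.
by exists r => // x xr; rewrite f0// mulr0.
Qed.

Lemma C2cM f g : C2c f -> C21 +oo%E (fun x (_ : R) => g x) -> C2c (fun x => f x * g x).
Proof.
move=> [Cf [r r0 f0]] Cg; split; first exact: C21M Cf Cg.
by exists r => // x xr; rewrite f0// mul0r.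
Qed.

Lemma C2c0 : C2c (fun _ : 'rV[R]_N => 0).
Proof. by split; [exact: C21_cst|exists 0]. Qed.

Lemma C2c_sum (I : Type) (s : seq I) (F : I -> 'rV[R]_N -> R) :
  (forall i, C2c (F i)) -> C2c (fun x => \sum_(i <- s) F i x).
Proof.
move=> CF; elim: s => [|i s IH].
  by under eq_fun do rewrite big_nil; exact: C2c0.
by under eq_fun do rewrite big_cons; exact: C2cD.
Qed.

Lemma C21_coord_affine T (a c : R) (i : 'I_N) :
  C21 T (fun (x : 'rV[R]_N) _ => a * x 0 i + c).
Proof.
exact: (C21D (C21Z a (jet_C21 (jet_coord T i))) (C21_cst T c)).
Qed.

Lemma C21_prod T (I : Type) (s : seq I) (F : I -> 'rV[R]_N -> R -> R) :
  (forall i, C21 T (F i)) -> C21 T (fun x t => \prod_(i <- s) F i x t).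
Proof.
move=> CF; elim: s => [|i s IH].
  by apply: C21_ext (C21_cst T 1) => x t; rewrite big_nil.
by apply: C21_ext (C21M (CF i) IH) => x t; rewrite big_cons.
Qed.

(** A tensor product adapted to the sup norm. The coefficients [- 1] and [1] keep each argument in
    the affine shape covered by [C21_coord_affine]. *)
Definition cube_cutoff (r : R) x : R :=
  \prod_(i < N) (step (- 1 * x 0 i + (r + 1)) * step (1 * x 0 i + (r + 1))).

Lemma cube_cutoff1 r x : `|x| <= r -> cube_cutoff r x = 1.
Proof.
move=> xr; rewrite /cube_cutoff big1// => i _.
have := le_trans (coord_le_norm x i) xr; rewrite ler_norml => /andP[x1 x2].
by rewrite !step_ge1 ?mulr1//; lra.
Qed.

Lemma cube_cutoff0 r x : 0 <= r + 1 -> r + 1 < `|x| -> cube_cutoff r x = 0.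
Proof.
move=> r0 xr; have [i xi] : exists i, r + 1 < `|x 0 i|.
  apply: contrapT => /forallNP h; move: xr; apply/negP; rewrite -leNgt.
  by apply/normrV_leP => // i; rewrite leNgt; exact/negP/h.
rewrite /cube_cutoff (bigD1 i)//=.
have [x0|x0] := leP 0 (x 0 i).
  by rewrite (@step_le0 _ (- 1 * _ + _)) ?mul0r//; move: xi; rewrite ger0_norm//; lra.
by rewrite (@step_le0 _ (1 * _ + _)) ?mulr0 ?mul0r//; move: xi; rewrite ltr0_norm//; lra.
Qed.

Lemma cube_cutoff_ge0 r x : 0 <= cube_cutoff r x.
Proof. by apply: prodr_ge0 => i _; rewrite mulr_ge0// step_ge0. Qed.

Lemma C2c_cube_cutoff r : 0 <= r -> C2c (cube_cutoff r).
Proof.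
move=> r0; split; last first.
  by exists (r + 1); [exact: addr_ge0|move=> x; apply: cube_cutoff0; exact: addr_ge0].
apply: (@C21_prod _ _ _
  (fun i x (_ : R) => step (- 1 * x 0 i + (r + 1)) * step (1 * x 0 i + (r + 1)))) => i.
by apply: C21M; apply: C21_step; exact: C21_coord_affine.
Qed.

Lemma C2c_continuous f : C2c f -> continuous f.
Proof.
move=> [Cf _] x; have := jet_c (C21_jet Cf).
have xT : space_time +oo%E (x, 0 : R) by split => //=; rewrite ltry.
move=> /(_ _ xT) /= c A /c /nbhs_ballP[e /= e0 eA].
have H : nbhs x (f @^-1` A); last exact: H.
apply/nbhs_ballP; exists e => //= y xy.
by apply: (eA (y, 0)); split => //=; [exact: ballxx|rewrite ltry].
Qed.

Definition bounded_support f := measurable_fun setT f /\ exists r C,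
  [/\ 0 <= r, 0 <= C, forall x, `|f x| <= C & forall x, r < `|x| -> f x = 0].

Lemma continuous_measurable_rV f : continuous f -> measurable_fun setT f.
Proof.
move=> cf; apply: (@measurability _ _ _ R _ _ _ (RGenOpens.measurableE R)).
move=> _ [_ [a [b ->]] <-]; rewrite setTI; apply: open_measurable_mx.
by apply: open_comp; [move=> x _; exact: cf|exact: interval_open].
Qed.

Lemma continuous_bounded_support f r : 0 <= r -> continuous f ->
  (forall x, r < `|x| -> f x = 0) -> bounded_support f.
Proof.
move=> r0 cf f0; split; first exact: continuous_measurable_rV.
have [z _ H] : exists2 z, z \in [set x : 'rV[R]_N | `|x| <= r] &
    forall y, y \in [set x : 'rV[R]_N | `|x| <= r] -> `|f y| <= `|f z|.
  apply: compact_EVT_max; last 1 first.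
  - apply: continuous_subspaceT => x.
    by apply: (@cvg_comp _ _ _ f (fun a => `|a|)); [exact: cf|exact: norm_continuous].
  - by exists 0; rewrite /= normr0.
  - exact: compact_norm_ball.
exists r, `|f z|; split => // x; have [xr|xr] := leP `|x| r; first by apply: H; rewrite inE.
by rewrite f0// normr0.
Qed.

Lemma C2c_bounded_support f : C2c f -> bounded_support f.
Proof.
move=> Cf; have [_ [r r0 f0]] := Cf.
exact: continuous_bounded_support r0 (C2c_continuous Cf) f0.
Qed.

Lemma bounded_support_integrable (mu : {measure set 'rV[R]_N -> \bar R}) f :
  radon mu -> bounded_support f -> mu.-integrable setT (EFin \o f).
Proof.
move=> rmu [mf [r [C [r0 C0 fC f0]]]].
pose B := [set x : 'rV[R]_N | `|x| <= r].
have mB : measurable B by exact: measurable_norm_ball.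
have iC : mu.-integrable setT ((EFin \o cst C) \_ B).
  apply: (iffLR (integrable_mkcond _ mB)); apply/integrableP; split.
    exact/measurable_EFinP/measurable_cst.
  rewrite (eq_integral (cst C%:E)) => [|x _]; last by rewrite /= ger0_norm.
  rewrite integral_cst//.
  by apply: lte_mul_pinfty => //; apply: rmu; exact: compact_norm_ball.
apply: le_integrable iC => //; first exact/measurable_EFinP.
move=> x _; rewrite /patch; case: ifPn => [_|/negP xB] /=.
  by rewrite lee_fin (ger0_norm C0).
rewrite f0 ?normr0//; rewrite ltNge; apply/negP => xr.
by apply: xB; exact: mem_set.
Qed.

End compactly_supported_functions.

(** * Nonnegative double series *)

Section nonnegative_series.
Context {R : realType}.

Lemma nneseries_le_bound (a : nat -> \bar R) c : (forall k, 0 <= a k)%E ->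
  (forall n, (\sum_(0 <= k < n) a k <= c)%E) -> (\sum_(k <oo) a k <= c)%E.
Proof.
move=> a0 ac; apply: lime_le; first by apply: is_cvg_nneseries.
exact: nearW.
Qed.

(** Merges a sequence of sequences of test functions into one sequence without changing the total
    sum. The bijection does not depend on the terms, so it serves the functions and their [L]-values
    alike. *)
Lemma nneseries_pairing : exists f : nat -> nat * nat, bijective f /\
  forall a : nat -> nat -> \bar R, (forall n k, 0 <= a n k)%E ->
  (\sum_(n <oo) \sum_(k <oo) a n k = \sum_(j <oo) a (f j).1 (f j).2)%E.
Proof.
have /card_esym/ppcard_eqP[f] := card_nat2.
have fbij : set_bij [set: nat] [set: nat * nat] f by exact: bij.
exists f; split.
  exists (f^-1%FUN); first by move=> x; rewrite funK ?inE.
  by move=> x; rewrite invK ?inE.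
move=> a a0.
rewrite [RHS]nneseries_esumT//.
rewrite -(reindex_esum [set: nat] [set: nat * nat] f (fun p => a p.1 p.2))//.
rewrite nneseries_esumT; last by move=> n; exact: nneseries_ge0.
rewrite (eq_esum (b := fun n => \esum_(k in [set: nat]) a n k)); last first.
  by move=> n _; rewrite nneseries_esumT.
rewrite esum_esum//; congr esum.
by apply/seteqP; split.
Qed.

End nonnegative_series.

(** * The Daniell outer measure of a positive functional *)

Section daniell.
Context {R : realType} {N : nat} (L : ('rV[R]_N -> R) -> R).
Hypothesis LD : forall f g, C2c f -> C2c g -> L (fun x => f x + g x) = L f + L g.
Hypothesis LZ : forall c f, C2c f -> L (fun x => c * f x) = c * L f.
Hypothesis L_ge0 : forall f, C2c f -> (forall x, 0 <= f x) -> 0 <= L f.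
Implicit Types (f g : 'rV[R]_N -> R) (A : set 'rV[R]_N) (x : 'rV[R]_N).

Lemma LB f g : C2c f -> C2c g -> L (fun x => f x - g x) = L f - L g.
Proof.
move=> Cf Cg; rewrite -mulN1r -LZ// -LD//; last exact: C2cZ.
by congr L; apply/funext => x; rewrite mulN1r.
Qed.

Lemma C2cB f g : C2c f -> C2c g -> C2c (fun x => f x - g x).
Proof.
move=> Cf Cg; have := C2cD Cf (C2cZ (-1) Cg); congr C2c.
by apply/funext => x; rewrite mulN1r.
Qed.

Lemma L_le f g : C2c f -> C2c g -> (forall x, f x <= g x) -> L f <= L g.
Proof.
move=> Cf Cg fg; rewrite -subr_ge0 -LB//; apply: L_ge0; first exact: C2cB.
by move=> x; rewrite subr_ge0.
Qed.

Lemma L0 : L (fun=> 0) = 0.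
Proof.
have H := LZ 0 C2c0; rewrite [RHS]mul0r in H; rewrite -[RHS]H.
by congr L; apply/funext => x; rewrite mul0r.
Qed.

Lemma L_sum n (F : nat -> 'rV[R]_N -> R) : (forall i, C2c (F i)) ->
  L (fun x => \sum_(0 <= i < n) F i x) = \sum_(0 <= i < n) L (F i).
Proof.
move=> CF; elim: n => [|n IH].
  by under eq_fun do rewrite big_geq//; rewrite big_geq// L0.
under eq_fun do rewrite big_nat_recr//=.
by rewrite LD ?big_nat_recr ?IH//; exact: C2c_sum.
Qed.

(* Dini's argument: on the compact support of [g] finitely many [f k] already
   dominate [g - e]. *)
Lemma L_le_series g (f : nat -> 'rV[R]_N -> R) : C2c g -> (forall k, C2c (f k)) ->
  (forall k x, 0 <= f k x) -> (forall x, ((g x)%:E <= \sum_(k <oo) (f k x)%:E)%E) ->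
  ((L g)%:E <= \sum_(k <oo) (L (f k))%:E)%E.
Proof.
move=> Cg Cf f0 gf; have [_ [r r0 g0]] := Cg.
have Cchi := @C2c_cube_cutoff R N r r0.
pose S n x := \sum_(0 <= k < n) f k x.
have S_mono n n' x : (n <= n')%N -> S n x <= S n' x.
  by move=> nn'; rewrite /S (big_cat_nat (leq0n n) nn')/= lerDl sumr_ge0.
have S0 n x : 0 <= S n x by exact: sumr_ge0.
have CS n : C2c (S n) by exact: C2c_sum.
have key e : 0 < e -> exists n, forall x, g x <= S n x + e * cube_cutoff r x.
  move=> e0.
  have : \forall n \near \oo, [set x : 'rV[R]_N | `|x| <= r] `<=` (fun x => g x < S n x + e).
    apply: ((compact_near_coveringP _).1 (@compact_norm_ball R N r) _ _ (fun n x => g x < S n x + e)).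
    move=> x _.
    have [m gm] : exists m, g x < S m x + e.
      apply: contrapT => /forallNP h; have := gf x; apply/negP; rewrite -ltNge.
      apply: (@le_lt_trans _ _ (g x - e)%:E); last by rewrite lte_fin; lra.
      apply: nneseries_le_bound => [k|n]; first by rewrite lee_fin.
      rewrite sumEFin lee_fin; have /negP := h n; rewrite -leNgt /S; lra.
    have c := C2c_continuous (C2cB (CS m) Cg).
    have nx : nbhs x [set y | - e < S m y - g y].
      have H : - e < S m x - g x by lra.
      exact: (c x [set y | - e < y] (lt_nbhsr H)).
    exists ([set y | - e < S m y - g y], [set n | (m <= n)%N]).
      by split => //; exists m.
    move=> [y n] [/= gy mn]; have := S_mono _ _ y mn; lra.
  move=> [n _ /(_ n (leqnn n)) Hn]; exists n => x.
  have [xr|xr] := leP `|x| r.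
    by rewrite cube_cutoff1// mulr1 ltW//; exact: Hn.
  by rewrite g0// addr_ge0// mulr_ge0 ?cube_cutoff_ge0// ltW.
apply/lee_addgt0Pr => e e0.
have chi0 : 0 <= L (cube_cutoff r) by apply: L_ge0 => // x; exact: cube_cutoff_ge0.
(* The summand $1$ guards against a cutoff on which [L] vanishes. *)
have d0 : 0 < e / (L (cube_cutoff r) + 1) by rewrite divr_gt0// ltr_wpDl.
have [n Hn] := key _ d0.
apply: (@le_trans _ _ (L (S n) + e)%:E).
  rewrite lee_fin; apply: le_trans (L_le Cg (C2cD (CS n) (C2cZ _ Cchi)) Hn) _.
  rewrite LD//; last exact: C2cZ.
  rewrite LZ// lerD2l mulrAC ler_pdivrMr ?ltr_wpDl//.
  by rewrite ler_pM2l// lerDl.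
rewrite EFinD leeD2r// L_sum// -sumEFin; apply: nneseries_lim_ge => k _ _.
by rewrite lee_fin L_ge0.
Qed.

Definition cover A (f : nat -> 'rV[R]_N -> R) := [/\ forall k, C2c (f k),
  forall k x, 0 <= f k x & forall x, A x -> (1 <= \sum_(k <oo) (f k x)%:E)%E].

(** The infimum runs over countable sums of test functions instead of open covers; this links the
    outer measure directly to [L], without indicators of sets. *)
Definition daniell A : \bar R :=
  ereal_inf [set (\sum_(k <oo) (L (f k))%:E)%E | f in cover A].

Lemma cover_ge0 A (f : nat -> 'rV[R]_N -> R) k : cover A f -> (0 <= (L (f k))%:E)%E.
Proof. by move=> [Cf f0 _]; rewrite lee_fin L_ge0. Qed.

Lemma daniell_ge0 A : (0 <= daniell A)%E.
Proof.
apply: le_ereal_inf_tmp => _ [f fA <-]; apply: nneseries_ge0 => k _ _.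
exact: cover_ge0 fA.
Qed.

Lemma daniell_le A (f : nat -> 'rV[R]_N -> R) : cover A f -> (daniell A <= \sum_(k <oo) (L (f k))%:E)%E.
Proof. by move=> fA; apply: ereal_inf_lbound; exists f. Qed.

Lemma le_daniell A B : A `<=` B -> (daniell A <= daniell B)%E.
Proof.
move=> AB; apply: le_ereal_inf_tmp => _ [f [Cf f0 fB] <-]; apply: daniell_le; split => //.
by move=> x /AB; exact: fB.
Qed.

Lemma daniell0 : daniell set0 = 0%E.
Proof.
apply/eqP; rewrite eq_le daniell_ge0 andbT.
apply: (le_trans (@daniell_le _ (fun _ _ => 0) _)).
  by split => // k; exact: C2c0.
by rewrite eseries0// => k _ _; rewrite L0.
Qed.

Lemma daniell_le1 A g : C2c g -> (forall x, 0 <= g x) -> (forall x, A x -> 1 <= g x) ->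
  (daniell A <= (L g)%:E)%E.
Proof.
move=> Cg g0 gA; pose f (k : nat) : 'rV[R]_N -> R := if k is 0%N then g else fun=> 0.
have -> : ((L g)%:E = \sum_(k <oo) (L (f k))%:E)%E.
  rewrite (nneseries_split 0 1) => [|[|k] _]/=; rewrite ?lee_fin ?L0 ?L_ge0//.
  by rewrite add0n big_nat1/= eseries0 ?addr0//= => -[|k] //= _ _; rewrite L0.
apply: daniell_le; split.
- by case=> //= k; exact: C2c0.
- by case.
- move=> x Ax; apply: (@le_trans _ _ (\sum_(0 <= k < 1) (f k x)%:E)%E).
    by rewrite big_nat1 lee_fin; exact: gA.
  by apply: nneseries_lim_ge => -[|k] _ _; rewrite lee_fin.
Qed.

(** Every cover of [A] dominates [g] pointwise, so [L_le_series] applies. Together with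
    [daniell_le1] this encloses the values of [L] between outer measures of level sets. *)
Lemma le_daniell1 A g : C2c g -> (forall x, A x -> g x <= 1) -> (forall x, ~ A x -> g x <= 0) ->
  ((L g)%:E <= daniell A)%E.
Proof.
move=> Cg g1 g0; apply: le_ereal_inf_tmp => _ [f [Cf f0 fA] <-].
apply: L_le_series => // x; have [Ax|nAx] := pselect (A x).
  by apply: le_trans (fA _ Ax); rewrite lee_fin; exact: g1.
by apply: (@le_trans _ _ 0%E); [rewrite lee_fin; exact: g0|
  apply: nneseries_ge0 => k _ _; rewrite lee_fin].
Qed.

Lemma cover_approx A e : 0 < e -> (daniell A < +oo)%E ->
  exists2 f, cover A f & (\sum_(k <oo) (L (f k))%:E <= daniell A + e%:E)%E.
Proof.
move=> e0 Aoo.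
have fin : daniell A \is a fin_num by rewrite ge0_fin_numE// daniell_ge0.
have [_ [f fA <-] lt] := lb_ereal_inf_adherent e0 fin.
by exists f => //; exact: ltW.
Qed.

(** Covers that are optimal up to $e/2^{n+1}$ for the $n$-th set are merged by [nneseries_pairing]
    into one cover of the union. *)
Lemma daniell_sigma_subadditive : sigma_subadditive daniell.
Proof.
move=> A; have [[i ioo]|] := pselect (exists i, daniell (A i) = +oo%E).
  rewrite (eseries_pinfty _ _ ioo) ?leey// => n _.
  by rewrite -ltNye (lt_le_trans _ (daniell_ge0 _)).
move=> /forallNP Aoo; apply/lee_addgt0Pr => e e0.
have /choice[F HF] : forall n, exists f : nat -> 'rV[R]_N -> R, cover (A n) f /\
    (\sum_(k <oo) (L (f k))%:E <= daniell (A n) + (e / (2 ^ n.+1)%:R)%:E)%E.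
  move=> n; have en0 : 0 < e / (2 ^ n.+1)%:R by rewrite divr_gt0// ltr0n expn_gt0.
  have Anoo : (daniell (A n) < +oo)%E by rewrite ltey; apply/eqP; exact: Aoo.
  by have [f fA fe] := cover_approx en0 Anoo; exists f.
apply: le_trans (epsilon_trick _ (fun n => daniell_ge0 (A n)) (ltW e0)).
have [h [[h' hK h'K] hE]] := @nneseries_pairing R.
have LF0 n k : (0 <= (L (F n k))%:E)%E by exact: cover_ge0 (HF n).1.
apply: (@le_trans _ _ (\sum_(n <oo) \sum_(k <oo) (L (F n k))%:E)%E); last first.
  apply: lee_nneseries => n *; last exact: (HF n).2.
  exact: nneseries_ge0.
rewrite (hE (fun n k => (L (F n k))%:E))//; apply: (daniell_le (f := fun j => F (h j).1 (h j).2)).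
split.
- by move=> j; have [[CF _ _] _] := HF (h j).1; exact: CF.
- by move=> j x; have [[_ F0 _] _] := HF (h j).1; exact: F0.
- move=> x [n _ Anx].
  have F0 i k : (0 <= (F i k x)%:E)%E by rewrite lee_fin; have [[_ F0 _] _] := HF i; exact: F0.
  rewrite -(hE (fun n k => (F n k x)%:E))//.
  have [[_ _ /(_ x Anx) H] _] := HF n; apply: le_trans H _.
  apply: (@le_trans _ _ (\sum_(0 <= i < n.+1) \sum_(k <oo) (F i k x)%:E)%E).
    rewrite big_nat_recr//= leeDr// sume_ge0// => i _; exact: nneseries_ge0.
  by apply: nneseries_lim_ge => i _ _; exact: nneseries_ge0.
Qed.


Definition halfspace_step (i : 'I_N) (c : R) (n : nat) (x : 'rV[R]_N) : R :=
  step (n%:R * x 0 i + - (n%:R * c)).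

Lemma C21_halfspace_step i c n : C21 +oo%E (fun x (_ : R) => halfspace_step i c n x).
Proof. by apply: C21_step; exact: C21_coord_affine. Qed.

Lemma halfspace_step0 i c x : halfspace_step i c 0 x = 0.
Proof. by rewrite /halfspace_step !mul0r oppr0 addr0 step_le0. Qed.

Lemma halfspace_step_out i c n x : x 0 i <= c -> halfspace_step i c n x = 0.
Proof. by move=> xc; rewrite /halfspace_step -mulrBr step_le0// mulr_ge0_le0// subr_le0. Qed.

Lemma halfspace_step_mono i c n x : halfspace_step i c n x <= halfspace_step i c n.+1 x.
Proof.
have [xc|xc] := leP (x 0 i) c; first by rewrite !halfspace_step_out.
by rewrite /halfspace_step -!mulrBr le_step// ler_wpM2r ?ler_nat// subr_ge0 ltW.
Qed.

Lemma halfspace_step1 i c x : c < x 0 i -> exists n, halfspace_step i c n x = 1.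
Proof.
move=> cx; exists (Num.truncn (x 0 i - c)^-1).+1.
rewrite /halfspace_step -mulrBr step_ge1//.
by rewrite -ler_pdivrMr ?subr_gt0// mul1r ltW// truncnS_gt.
Qed.

Lemma halfspace_step_ge0 i c n x : 0 <= halfspace_step i c n x.
Proof. exact: step_ge0. Qed.

Lemma halfspace_step_le1 i c n x : halfspace_step i c n x <= 1.
Proof. exact: step_le1. Qed.

Definition halfspace (i : 'I_N) (c : R) : set 'rV[R]_N := [set x | c < x 0 i].

(** This is Caratheodory's condition for half-spaces. Smooth steps increase to the indicator of the
    half-space; multiplying a cover of [A] by such a step and by its complement splits the cost
    exactly. *)
Lemma daniell_halfspace A i c :
  (daniell (A `&` halfspace i c) + daniell (A `&` ~` halfspace i c) <= daniell A)%E.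
Proof.
apply: le_ereal_inf_tmp => _ [f fA <-]; have [Cf f0 f1] := fA.
set X := daniell _; set Y := daniell _; set S := (\sum_(k <oo) _)%E.
have [->|Soo] := eqVneq S +oo%E; first exact: leey.
pose s := halfspace_step i c.
pose F n k x := f k x * s n x.
have CF n k : C2c (F n k) by apply: C2cM => //; exact: C21_halfspace_step.
have F0 n k x : 0 <= F n k x by rewrite mulr_ge0// halfspace_step_ge0.
have FS n k x : F n k x <= F n.+1 k x by rewrite ler_wpM2l// halfspace_step_mono.
have CG n k : C2c (fun x => f k x - F n k x) by exact: C2cB.
have G0 n k x : 0 <= f k x - F n k x.
  by rewrite subr_ge0 ler_piMr// halfspace_step_le1.
(* For every [n], the complementary parts still cover the points outside the half-space, where the
   step is zero. *)
have H n : (\sum_(k <oo) (L (F n k))%:E + Y <= S)%E.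
  have -> : S = (\sum_(k <oo) ((L (F n k))%:E + (L (fun x => f k x - F n k x))%:E))%E.
    by apply: eq_eseriesr => k _; rewrite LB// -EFinD addrC subrK.
  rewrite nneseriesD; last 2 first.
  - by move=> k _ _; rewrite lee_fin L_ge0.
  - by move=> k _ _; rewrite lee_fin L_ge0.
  apply: leeD2l; apply: daniell_le; split => // x [Ax /= /negP]; rewrite -leNgt => xc.
  rewrite (eq_eseriesr (g := fun k => (f k x)%:E)); first exact: f1.
  by move=> k _; rewrite /F /s halfspace_step_out// mulr0 subr0.
have Y0 : (0 <= Y)%E by exact: daniell_ge0.
have Yfin : Y \is a fin_num.
  rewrite ge0_fin_numE//; apply: le_lt_trans (_ : S < +oo)%E; last by rewrite ltey.
  apply: le_trans (H 0%N); rewrite leeDr// nneseries_ge0// => k _ _.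
  by rewrite lee_fin L_ge0.
rewrite -leeBrDr//.
have [h [[h' hK h'K] hE]] := @nneseries_pairing R.
(* At each point of the half-space some step reaches the value $1$, so the increments in [n] of the
   multiplied functions telescope to the original cover there. Their total cost is the supremum over
   [n] of the cost of [F n]. *)
pose D n k x := F n.+1 k x - F n k x.
have CD n k : C2c (D n k) by exact: C2cB.
have D0 n k x : 0 <= D n k x by rewrite subr_ge0.
have LD0 n k : (0 <= (L (D n k))%:E)%E by rewrite lee_fin L_ge0.
apply: (@le_trans _ _ (\sum_(n <oo) \sum_(k <oo) (L (D n k))%:E)%E).
  rewrite (hE (fun n k => (L (D n k))%:E))//.
  apply: (daniell_le (f := fun j => D (h j).1 (h j).2)); split => // x [Ax /= cx].
  have De n k : (0 <= (D n k x)%:E)%E by rewrite lee_fin.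
  rewrite -(hE (fun n k => (D n k x)%:E))//.
  have [M sM] := halfspace_step1 cx.
  apply: (@le_trans _ _ (\sum_(0 <= n < M) \sum_(k <oo) (D n k x)%:E)%E); last first.
    by apply: nneseries_lim_ge => n _ _; exact: nneseries_ge0.
  rewrite -nneseries_sum_nat//; apply: le_trans (f1 _ Ax) _.
  apply: lee_nneseries => k *; first by rewrite lee_fin.
  rewrite sumEFin lee_fin telescope_sumr//.
  by rewrite /F {1}/s sM /s halfspace_step0 mulr0 mulr1 subr0.
apply: nneseries_le_bound => [n|M]; first exact: nneseries_ge0.
rewrite -nneseries_sum_nat// leeBrDr//; apply: le_trans (H M); apply: leeD2r.
apply: lee_nneseries => k *; first by rewrite sume_ge0.
rewrite sumEFin lee_fin (eq_bigr (fun n => L (F n.+1 k) - L (F n k))); last first.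
  by move=> n _; rewrite LB.
rewrite telescope_sumr// lerBlDr lerDl.
by rewrite (_ : F 0%N k = fun=> 0) ?L0//; apply/funext => x; rewrite /F /s halfspace_step0 mulr0.
Qed.

(** Measurability of half-spaces makes every coordinate measurable for the Caratheodory
    sigma-algebra; by [measurable_fun_mx] that algebra then contains all Borel sets. *)
Lemma riesz_measure : exists nu : {measure set 'rV[R]_N -> \bar R},
  forall A, nu A = daniell A.
Proof.
pose om : {outer_measure set 'rV[R]_N -> \bar R} := HB.pack daniell
  (isOuterMeasure.Build R 'rV[R]_N daniell daniell0 daniell_ge0 (@le_daniell) daniell_sigma_subadditive).
have half i c : om.-caratheodory (halfspace i c).
  by apply: le_caratheodory_measurable => A; exact: daniell_halfspace.
have mid : measurable_fun setT (id : caratheodory_type om -> 'rV[R]_N).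
  apply: measurable_fun_mx => i j; rewrite (ord1 i).
  apply: (@measurability _ _ _ R _ _ _ (RGenOInfty.measurableE R)).
  move=> _ [_ [c ->] <-]; rewrite setTI.
  by have := half j c; congr (om.-caratheodory _); apply/seteqP; split => x /=; rewrite in_itv/= andbT.
have sub A : measurable A -> om.-caratheodory A.
  by move=> mA; have := mid measurableT A mA; rewrite setTI preimage_id.
have sa : semi_sigma_additive (daniell : set 'rV[R]_N -> \bar R).
  move=> F mF tF mUF.
  apply: (@caratheodory_measure_sigma_additive R _ om F) => //; first by move=> k; exact: sub.
  exact: sub.
pose nu : {measure set 'rV[R]_N -> \bar R} := HB.pack daniell
  (isMeasure.Build _ _ _ daniell daniell0 daniell_ge0 sa).
by exists nu.
Qed.

End daniell.

(** * Layer-cake approximation by smooth steps *)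

Section layers.
Context {R : realType} {N : nat}.
Implicit Types (f g : 'rV[R]_N -> R) (x : 'rV[R]_N).

(** At most one step is only partly risen; all earlier ones equal $1$ and all later ones equal
    $0$. *)
Lemma staircase (M : nat) (y : R) : 0 <= y <= M%:R ->
  `|y - \sum_(0 <= j < M) step (y - j%:R)| <= 1.
Proof.
elim: M => [|M IH] /andP[y0 yM].
  by rewrite big_geq// subr0 (_ : y = 0) ?normr0//; apply/eqP; rewrite eq_le yM y0.
rewrite big_nat_recr//=; have [yM'|yM'] := leP y M%:R.
  by rewrite step_le0 ?subr_le0// addr0 IH// y0.
have -> : \sum_(0 <= j < M) step (y - j%:R) = M%:R.
  rewrite (eq_big_nat _ _ (F2 := fun=> 1)) => [|j /andP[_ jM]].
    by rewrite sumr_const_nat subn0.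
  by rewrite step_ge1// lerBrDr nat1r; apply: le_trans (ltW yM'); rewrite ler_nat.
have := step_ge0 (y - M%:R); have := step_le1 (y - M%:R).
by move: yM; rewrite -natr1 ler_norml => *; apply/andP; split; lra.
Qed.

Definition layer f (d : R) (j : nat) x : R := step (d^-1 * f x - j%:R).

Lemma layer_le0 f d j x : 0 < d -> f x <= d * j%:R -> layer f d j x = 0.
Proof. by move=> d0 fx; rewrite /layer step_le0// subr_le0 ler_pdivrMl. Qed.

Lemma layer_ge1 f d j x : 0 < d -> d * j.+1%:R <= f x -> layer f d j x = 1.
Proof. by move=> d0 fx; rewrite /layer step_ge1// lerBrDr nat1r ler_pdivlMl. Qed.

Lemma C2c_layer f d j : 0 < d -> C2c f -> C2c (layer f d j).
Proof.
move=> d0 [Cf [r r0 f0]]; split; last first.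
  by exists r => // x xr; rewrite layer_le0// f0// mulr_ge0// ltW.
exact: (C21_step (C21D (C21Z d^-1 Cf) (C21_cst _ (- j%:R)))).
Qed.

(** The sum on the left depends on the numbers [b] alone. Two positive functionals whose values on
    the layers are enclosed by the same [b] therefore agree on [f] up to a multiple of [d]. One
    error term comes from replacing [f] by its layers, the other from a telescoping shift of [b]. *)
Lemma layer_approximation (P : ('rV[R]_N -> R) -> R) f d (M : nat) r (b : nat -> R) :
  (forall f g, C2c f -> C2c g -> P (fun x => f x + g x) = P f + P g) ->
  (forall c f, C2c f -> P (fun x => c * f x) = c * P f) ->
  (forall f, C2c f -> (forall x, 0 <= f x) -> 0 <= P f) ->
  C2c f -> 0 < d -> 0 <= r -> (forall x, 0 <= f x <= d * M%:R) ->
  (forall x, r < `|x| -> f x = 0) -> 0 <= b M ->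
  (forall j, b j.+1 <= P (layer f d j) <= b j) ->
  `|P f - d * \sum_(0 <= j < M) b j| <= d * (P (cube_cutoff r) + b 0%N).
Proof.
move=> PD PZ P0 Cf d0 r0 fM f0 bM bP.
have Cchi := @C2c_cube_cutoff R N r r0.
pose h x := \sum_(0 <= j < M) layer f d j x.
have Ch : C2c h by apply: C2c_sum => j; exact: C2c_layer.
have Ph : P h = \sum_(0 <= j < M) P (layer f d j).
  by apply: (L_sum PD PZ) => j; exact: C2c_layer.
have fh x : `|f x - d * h x| <= d * cube_cutoff r x.
  have [xr|xr] := leP `|x| r; last first.
    rewrite f0// /h big1 ?mulr0 ?subr0 ?normr0; last first.
      by move=> j _; rewrite layer_le0// f0// mulr_ge0// ltW.
    by rewrite mulr_ge0 ?cube_cutoff_ge0// ltW.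
  rewrite cube_cutoff1// mulr1.
  have -> : f x - d * h x = d * (d^-1 * f x - h x) by field; rewrite gt_eqF.
  rewrite normrM gtr0_norm// -[leRHS]mulr1 ler_pM2l//.
  apply: staircase; have /andP[f1 f2] := fM x.
  by apply/andP; split; [rewrite mulr_ge0// invr_ge0 ltW|rewrite ler_pdivrMl].
have Cdh := C2cZ d Ch; have Cdchi := C2cZ d Cchi.
have up : P f <= d * P h + d * P (cube_cutoff r).
  rewrite -!PZ// -PD//; apply: (L_le PD PZ P0) => //; first exact: C2cD.
  by move=> x; have := fh x; rewrite ler_norml => /andP[]; lra.
have lo : d * P h - d * P (cube_cutoff r) <= P f.
  rewrite lerBlDr -!PZ// -PD//; apply: (L_le PD PZ P0) => //; first exact: C2cD.
  by move=> x; have := fh x; rewrite ler_norml => /andP[]; lra.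
have h1 : P h <= \sum_(0 <= j < M) b j.
  by rewrite Ph; apply: ler_sum => j _; have /andP[] := bP j.
have h2 : \sum_(0 <= j < M) b j - b 0%N <= P h.
  apply: (@le_trans _ _ (\sum_(0 <= j < M) b j.+1)); last first.
    by rewrite Ph; apply: ler_sum => j _; have /andP[] := bP j.
  have := telescope_sumr b (leq0n M); rewrite sumrB => e; lra.
have := ler_pM2l d0 (P h) (\sum_(0 <= j < M) b j); rewrite h1 => dh1.
have := ler_pM2l d0 (\sum_(0 <= j < M) b j - b 0%N) (P h); rewrite h2 => dh2.
by rewrite ler_norml; apply/andP; split; nra.
Qed.

End layers.

(** * Representation of positive functionals on $C^2_c$ *)

Section riesz.
Context {R : realType} {N : nat}.
Implicit Types (f g : 'rV[R]_N -> R) (x : 'rV[R]_N).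

Section positive_functional.
Variable nu : {measure set 'rV[R]_N -> \bar R}.
Hypothesis rnu : radon nu.

Let I f := fine (\int[nu]_x (f x)%:E)%E.

Lemma C2c_integrable f : C2c f -> nu.-integrable setT (EFin \o f).
Proof. by move=> /C2c_bounded_support; exact: bounded_support_integrable. Qed.

Lemma C2c_integralE f : C2c f -> (\int[nu]_x (f x)%:E = (I f)%:E)%E.
Proof.
move=> Cf; rewrite fineK//; apply: (integrable_fin_num measurableT).
exact: C2c_integrable.
Qed.

Lemma C2c_integralD f g : C2c f -> C2c g -> I (fun x => f x + g x) = I f + I g.
Proof.
move=> Cf Cg; apply: EFin_inj; rewrite EFinD -!C2c_integralE//; last exact: C2cD.
by rewrite -integralD//; exact: C2c_integrable.
Qed.

Lemma C2c_integralZ c f : C2c f -> I (fun x => c * f x) = c * I f.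
Proof.
move=> Cf; apply: EFin_inj; rewrite EFinM -!C2c_integralE//; last exact: C2cZ.
by rewrite -integralZl//; exact: C2c_integrable.
Qed.

Lemma C2c_integral_ge0 f : C2c f -> (forall x, 0 <= f x) -> 0 <= I f.
Proof. by move=> _ f0; apply: fine_ge0; apply: integral_ge0 => x _; rewrite lee_fin. Qed.

End positive_functional.

(** The measures of the level sets $\{f>dj\}$ enclose both [L] and the integral of the $j$-th layer
    of [f]; [layer_approximation] then compares the two functionals, and [d] tends to $0$. *)
Lemma riesz (L : ('rV[R]_N -> R) -> R) :
  (forall f g, C2c f -> C2c g -> L (fun x => f x + g x) = L f + L g) ->
  (forall c f, C2c f -> L (fun x => c * f x) = c * L f) ->
  (forall f, C2c f -> (forall x, 0 <= f x) -> 0 <= L f) ->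
  exists nu : {measure set 'rV[R]_N -> \bar R}, radon nu /\
    forall f, C2c f -> (\int[nu]_x (f x)%:E = (L f)%:E)%E.
Proof.
move=> LD LZ L0; have [nu nuE] := riesz_measure LD LZ L0.
have nuoo r : 0 <= r -> (nu [set x | (`|x| <= r)%R] < +oo)%E.
  move=> r0; rewrite nuE; apply: le_lt_trans (ltry (L (cube_cutoff r))).
  apply: (daniell_le1 LZ L0); first exact: C2c_cube_cutoff.
    by move=> x; exact: cube_cutoff_ge0.
  by move=> x /= xr; rewrite cube_cutoff1.
have rnu : radon nu.
  move=> K cK; have [M [Mr HM]] := compact_bounded cK.
  apply: le_lt_trans (nuoo (`|M| + 1) _); last by rewrite addr_ge0.
  apply: le_measure; rewrite ?inE.
  - rewrite -(setCK K); apply: measurableC; apply: open_measurable_mx; apply: closed_openC.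
    by apply: compact_closed => //; exact: norm_hausdorff.
  - exact: measurable_norm_ball.
  - move=> x Kx /=; apply: (HM (`|M| + 1)) => //.
    by rewrite (le_lt_trans (ler_norm _))// ltrDl.
exists nu; split => //.
pose I f := fine (\int[nu]_x (f x)%:E)%E.
(* A signed function becomes nonnegative after adding a multiple of a cutoff, to which the
   nonnegative case applies as well. *)
suff E f : C2c f -> (forall x, 0 <= f x) -> L f = I f.
  move=> f Cf; rewrite C2c_integralE//; congr EFin.
  have [_ [r r0 f0]] := Cf; have [_ [_ [C [_ C0 fC _]]]] := C2c_bounded_support Cf.
  have Cchi := @C2c_cube_cutoff R N r r0; have CCchi := C2cZ C Cchi.
  have chi0 x : 0 <= C * cube_cutoff r x by rewrite mulr_ge0// cube_cutoff_ge0.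
  have E1 := E _ CCchi chi0.
  have := E _ (C2cD Cf CCchi) _; rewrite LD// E1 /I C2c_integralD// => /(_ _)/addIr ->//.
  move=> x; have [xr|xr] := leP `|x| r; last by rewrite f0// add0r.
  rewrite cube_cutoff1// mulr1.
  by have := fC x; rewrite ler_norml => /andP[]; lra.
move=> Cf fge0.
have [_ [r r0 f0]] := Cf; have [_ [_ [C [_ C0 fC _]]]] := C2c_bounded_support Cf.
pose K := L (cube_cutoff r) + fine (nu [set x | 0 < f x]) +
  (I (cube_cutoff r) + fine (nu [set x | 0 < f x])).
(* The constant [K] does not involve [d]. *)
suff H d : 0 < d -> `|L f - I f| <= d * K.
  apply/eqP; rewrite -subr_eq0 -normr_le0; apply/ler_addgt0Pr => e e0; rewrite add0r.
  have K1 : 0 < `|K| + 1 by rewrite ltr_wpDl.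
  apply: le_trans (H (e / (`|K| + 1)) _) _; first by rewrite divr_gt0.
  rewrite mulrAC ler_pdivrMr// ler_pM2l//; apply: le_trans (ler_norm _) _.
  by rewrite lerDl.
move=> d0.
pose A j := [set x | d * j%:R < f x]; pose b j := fine (nu (A j)).
have mA j : measurable (A j).
  rewrite (_ : A j = f @^-1` `]d * j%:R, +oo[); last first.
    by apply/seteqP; split => x /=; rewrite in_itv/= andbT.
  rewrite -[X in measurable X]setTI; apply: (C2c_bounded_support Cf).1 => //.
have bE j : ((b j)%:E = nu (A j))%E.
  rewrite fineK// ge0_fin_numE//; apply: le_lt_trans (nuoo _ r0).
  apply: le_measure; rewrite ?inE//; first exact: measurable_norm_ball.
  move=> x Ax /=; rewrite leNgt; apply/negP => xr.
  by move: Ax; rewrite /A/= f0//; apply/negP; rewrite -leNgt mulr_ge0// ltW.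
have b0 j : 0 <= b j by apply: fine_ge0.
pose M := (Num.truncn (C / d)).+1.
have fM x : 0 <= f x <= d * M%:R.
  rewrite fge0/=; apply: le_trans (ler_norm _) _; apply: le_trans (fC x) _.
  by rewrite -ler_pdivrMl// mulrC ltW// truncnS_gt.
have Cl j := C2c_layer j d0 Cf.
have l01 j x : 0 <= layer f d j x <= 1 by rewrite step_ge0 step_le1.
have bL j : b j.+1 <= L (layer f d j) <= b j.
  rewrite -!lee_fin !bE !nuE; apply/andP; split.
    apply: (daniell_le1 LZ L0) => // x; first by have /andP[] := l01 j x.
    by move=> /ltW H; rewrite layer_ge1.
  apply: (le_daniell1 LD LZ L0) => // x; first by have /andP[] := l01 j x.
  by move=> /negP; rewrite -leNgt => H; rewrite layer_le0.
have bI j : b j.+1 <= I (layer f d j) <= b j.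
  have iA k : nu.-integrable setT (EFin \o \1_(A k)).
    apply/integrableP; split; first exact/measurable_EFinP/measurable_indic.
    under eq_integral do rewrite /= ger0_norm//.
    by rewrite integral_indic// setIT -bE ltry.
  rewrite -!lee_fin !bE -C2c_integralE//.
  rewrite -[A j.+1]setIT -[A j]setIT -!integral_indic//.
  apply/andP; split.
    apply: (le_integral measurableT (iA j.+1) (C2c_integrable rnu (Cl j))) => x _.
    rewrite /= lee_fin indicE; case: (boolP (x \in A j.+1)) => [/set_mem/ltW xA|_].
      by rewrite layer_ge1.
    by have /andP[] := l01 j x.
  apply: (le_integral measurableT (C2c_integrable rnu (Cl j)) (iA j)) => x _.
  rewrite /= lee_fin indicE; case: (boolP (x \in A j)) => [_|/negP xA].
    by have /andP[] := l01 j x.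
  rewrite layer_le0// leNgt; apply/negP => h; apply: xA; exact: mem_set.
have HL := layer_approximation LD LZ L0 Cf d0 r0 fM f0 (b0 M) bL.
have HI := layer_approximation (C2c_integralD rnu) (C2c_integralZ rnu)
  (@C2c_integral_ge0 nu) Cf d0 r0 fM f0 (b0 M) bI.
have e0 : b 0%N = fine (nu [set x | 0 < f x]) by rewrite /b /A mulr0.
rewrite /K -e0 mulrDr -(subrKA (d * \sum_(0 <= j < M) b j)).
by apply: le_trans (ler_normD _ _) _; rewrite lerD// distrC.
Qed.

End riesz.

(** * Radon measures are determined by $C^2_c$ *)

Section uniqueness.
Context {R : realType} {N : nat}.
Implicit Types (f g : 'rV[R]_N -> R) (x a b : 'rV[R]_N).

Definition box a b : set 'rV[R]_N := [set x | forall i, a 0 i <= x 0 i <= b 0 i].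

Definition box_step a b (n : nat) x : R :=
  \prod_(i < N) (step (n.+1%:R * x 0 i + (1 - n.+1%:R * a 0 i)) *
                 step (- n.+1%:R * x 0 i + (1 + n.+1%:R * b 0 i))).

Lemma C21_box_step a b n : C21 +oo%E (fun x (_ : R) => box_step a b n x).
Proof.
apply: (@C21_prod _ _ _ _ _ (fun i x (_ : R) => step (n.+1%:R * x 0 i + (1 - n.+1%:R * a 0 i)) *
                 step (- n.+1%:R * x 0 i + (1 + n.+1%:R * b 0 i)))) => i.
by apply: C21M; apply: C21_step; exact: C21_coord_affine.
Qed.

Lemma box_step_in a b n x : box a b x -> box_step a b n x = 1.
Proof.
move=> xab; rewrite /box_step big1// => i _; have /andP[x1 x2] := xab i.
have n0 : 0 <= n.+1%:R :> R by [].
have h1 : 0 <= n.+1%:R * (x 0 i - a 0 i) by rewrite mulr_ge0// subr_ge0.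
have h2 : 0 <= n.+1%:R * (b 0 i - x 0 i) by rewrite mulr_ge0// subr_ge0.
by rewrite !step_ge1 ?mulr1//; lra.
Qed.

Lemma box_step_out a b n x i :
  n.+1%:R * (x 0 i - a 0 i) <= - 1 \/ n.+1%:R * (b 0 i - x 0 i) <= - 1 ->
  box_step a b n x = 0.
Proof.
move=> h; rewrite /box_step (bigD1 i)//=; case: h => h.
  by rewrite (@step_le0 _ (n.+1%:R * _ + _)) ?mul0r//; lra.
by rewrite (@step_le0 _ (- n.+1%:R * _ + _)) ?mulr0 ?mul0r//; lra.
Qed.

Lemma box_step_ge0 a b n x : 0 <= box_step a b n x.
Proof. by apply: prodr_ge0 => i _; rewrite mulr_ge0// step_ge0. Qed.

Lemma box_step_le1 a b n x : box_step a b n x <= 1.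
Proof.
apply: prodr_ile1 => i _; rewrite mulr_ge0 ?step_ge0//=.
by rewrite -[leRHS]mulr1 ler_pM ?step_ge0 ?step_le1.
Qed.

Lemma box_step_support a b n x : `|a| + `|b| + 1 < `|x| -> box_step a b n x = 0.
Proof.
move=> xr; have [i xi] : exists i, `|a| + `|b| + 1 < `|x 0 i|.
  apply: contrapT => /forallNP h; move: xr; apply/negP; rewrite -leNgt.
  by apply/normrV_leP => [|i]; [rewrite !addr_ge0|rewrite leNgt; exact/negP/h].
have := coord_le_norm a i; have := coord_le_norm b i; rewrite !ler_norml => /andP[b1 b2] /andP[a1 a2].
have na := normr_ge0 a; have nb := normr_ge0 b.
have n1 : 1 <= n.+1%:R :> R by rewrite ler1n.
apply: (@box_step_out _ _ _ _ i).
have [x0|x0] := leP 0 (x 0 i).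
  by right; move: xi; rewrite ger0_norm// => xi; nra.
by left; move: xi; rewrite ltr0_norm// => xi; nra.
Qed.

Lemma C2c_box_step a b n : C2c (box_step a b n).
Proof.
split; first exact: C21_box_step.
by exists (`|a| + `|b| + 1); [rewrite !addr_ge0|move=> x; exact: box_step_support].
Qed.

Lemma box_step_cvg a b x : box_step a b n x @[n --> \oo] --> (\1_(box a b) x : R).
Proof.
rewrite indicE; case: (boolP (x \in box a b)) => [/set_mem xab|/negP xab].
  by apply: cvg_near_cst; apply: nearW => n; exact: box_step_in.
have [i xi] : exists i, ~~ (a 0 i <= x 0 i <= b 0 i).
  apply: contrapT => /forallNP h; apply: xab; apply: mem_set => i.
  by apply/negPn/negP; exact: h.
have far (d : R) : 0 < d -> \forall n \near \oo, n.+1%:R * - d <= - 1.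
  move=> d0; near=> n; rewrite mulrN lerN2 -ler_pdivrMr// mul1r -[leLHS]invrK.
  rewrite -[leRHS]invrK lef_pV2 ?posrE ?invr_gt0// ?invrK; apply: ltW.
  near: n; exact: (near_infty_natSinv_lt (PosNum d0)).
apply: cvg_near_cst; move: xi; rewrite negb_and -!ltNge => /orP[xa|bx].
  have d0 : 0 < a 0 i - x 0 i by rewrite subr_gt0.
  apply: filterS (far _ d0) => n h; apply: (@box_step_out _ _ _ _ i); left.
  by rewrite opprB in h.
have d0 : 0 < x 0 i - b 0 i by rewrite subr_gt0.
apply: filterS (far _ d0) => n h; apply: (@box_step_out _ _ _ _ i); right.
by rewrite opprB in h.
Unshelve. all: by end_near. Qed.

Lemma measurable_box a b : measurable (box a b).
Proof. exact: measurable_box_rV. Qed.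

Lemma radon_box (nu : {measure set 'rV[R]_N -> \bar R}) a b : radon nu ->
  (\int[nu]_x (box_step a b n x)%:E)%E @[n --> \oo] --> nu (box a b).
Proof.
move=> rnu.
have r0 : 0 <= `|a| + `|b| + 1 by rewrite !addr_ge0.
have Cchi := @C2c_cube_cutoff R N _ r0.
have -> : nu (box a b) = (\int[nu]_x (\1_(box a b) x)%:E)%E.
  by rewrite integral_indic ?setIT//; exact: measurable_box.
apply: (@dominated_cvg _ _ _ nu _ measurableT (fun n x => (box_step a b n x)%:E) _
   (EFin \o cube_cutoff (`|a| + `|b| + 1))).
- by move=> n; apply: measurable_int (C2c_integrable rnu (C2c_box_step a b n)).
- by move=> x _; apply: cvg_EFin; [exact: nearW|exact: box_step_cvg].
- by [].
- exact: C2c_integrable.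
- move=> n x _; rewrite lee_fin ger0_norm ?box_step_ge0//.
  have [xr|xr] := leP `|x| (`|a| + `|b| + 1).
    by rewrite cube_cutoff1// box_step_le1.
  by rewrite box_step_support// cube_cutoff_ge0.
Qed.

Definition boxes : set (set 'rV[R]_N) := [set A | exists a b, A = box a b].

Lemma measurable_boxesE : @measurable _ 'rV[R]_N = <<s boxes >>.
Proof.
apply/seteqP; split=> A mA; last first.
  by apply: smallest_sub mA => [|_ [a [b ->]]]; [exact: sigma_algebra_measurable|exact: measurable_box].
have mid : measurable_fun setT (id : g_sigma_algebraType boxes -> 'rV[R]_N).
  apply: measurable_fun_mx => i j; rewrite (ord1 i).
  apply: (@measurability _ _ _ R _ _ _ (RGenCInfty.measurableE R)).
  move=> _ [_ [c ->] <-]; rewrite setTI.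
  have -> : (fun x : 'rV[R]_N => x 0 j) @^-1` `[c, +oo[ =
      \bigcup_(k : nat) box (\row_l if l == j then c else - k%:R) (\row_l k%:R).
    apply/seteqP; split => x /=; rewrite in_itv/= andbT.
      move=> cx; exists (Num.truncn `|x|).+1 => // l; rewrite !mxE.
      have := le_lt_trans (coord_le_norm x l) (truncnS_gt _) => /ltW.
      by rewrite ler_norml => /andP[x1 x2]; rewrite x2 andbT; case: eqP => [->|].
    by move=> [k _ /(_ j)]; rewrite !mxE eqxx => /andP[].
  by apply: bigcup_measurable => k _; apply: sub_sigma_algebra; eexists; eexists.
by have := mid measurableT A mA; rewrite setTI preimage_id.
Qed.

(** Indicators of closed boxes are dominated limits of $C^2_c$ functions, so both measures agree on
    boxes. Boxes are stable under intersection, generate the Borel sets, and include cubes of finite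
    measure exhausting the space. *)
Lemma radon_unique (nu nu' : {measure set 'rV[R]_N -> \bar R}) : radon nu -> radon nu' ->
  (forall f, C2c f -> (\int[nu]_x (f x)%:E = \int[nu']_x (f x)%:E)%E) ->
  same_measure nu nu'.
Proof.
move=> rnu rnu' E.
pose g (k : nat) := box (- const_mx k%:R) (const_mx k%:R).
have boxE a b : nu (box a b) = nu' (box a b).
  have h := @radon_box nu a b rnu; apply: (cvg_unique _ h) => //.
  rewrite (_ : (fun n => _) = fun n => (\int[nu']_x (box_step a b n x)%:E)%E).
    exact: radon_box.
  by apply/funext => n; apply: E; exact: C2c_box_step.
apply: (measure_unique boxes g).
- exact: measurable_boxesE.
- move=> _ _ [a [b ->]] [a' [b' ->]].
  exists (\row_i Num.max (a 0 i) (a' 0 i)), (\row_i Num.min (b 0 i) (b' 0 i)).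
  apply/seteqP; split => x /=.
    move=> [h h'] i; rewrite !mxE ge_max le_min.
    have /andP[h1 h2] := h i; have /andP[h3 h4] := h' i.
    by apply/andP; split; apply/andP; split.
  by move=> h; split => i; have := h i; rewrite !mxE ge_max le_min => /andP[/andP[h1 h2] /andP[h3 h4]]; apply/andP.
- by move=> i; eexists; eexists.
- apply/seteqP; split => // x _; exists (Num.truncn `|x|).+1 => // l; rewrite !mxE.
  have := le_lt_trans (coord_le_norm x l) (truncnS_gt _) => /ltW.
  by rewrite ler_norml.
- by move=> _ [a [b ->]]; exact: boxE.
- move=> k; apply: (@le_lt_trans _ _ (nu [set x | `|x| <= k%:R])); last first.
    by apply: rnu; exact: compact_norm_ball.
  apply: le_measure; rewrite ?inE; [exact: measurable_box|exact: measurable_norm_ball|].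
  move=> x h /=; apply/normrV_leP => // i; rewrite ler_norml.
  by have := h i; rewrite !mxE.
Qed.

End uniqueness.

(** * Uniform approximation by spline quasi-interpolants *)

Section density.
Context {R : realType} {N : nat}.
Implicit Types (f psi : 'rV[R]_N -> R) (x : 'rV[R]_N).

Lemma uniformly_continuous_support psi r e : continuous psi ->
  (forall x, r < `|x| -> psi x = 0) -> 0 < e ->
  exists2 d, 0 < d & forall x y, `|x - y| < d -> `|psi x - psi y| < e.
Proof.
move=> cpsi psi0 e0.
have : \forall d \near (0 : R)^'+, [set x : 'rV[R]_N | `|x| <= r + 1] `<=`
    (fun x => forall y, `|x - y| < d -> `|psi x - psi y| < e).
  apply: ((compact_near_coveringP _).1 (@compact_norm_ball R N (r + 1)) _ _
    (fun d x => forall y, `|x - y| < d -> `|psi x - psi y| < e)) => x _.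
  have e2 : 0 < e / 2 by rewrite divr_gt0.
  have /nbhs_ballP[c /= c0 cP] : nbhs x (psi @^-1` ball (psi x) (e / 2)).
    by apply: cpsi; exact: nbhsx_ballx.
  have c2 : 0 < c / 2 by rewrite divr_gt0.
  exists (ball x (c / 2), [set d | d < c / 2]).
    split; first exact: nbhsx_ballx.
    exact: nbhs_right_lt.
  move=> [z d] [/= xz dc] y zy.
  have xy : ball x c y.
    rewrite [c]splitr; apply: ball_triangle xz _.
    by rewrite -ball_normE/=; exact: lt_trans dc.
  have xz' : ball x c z by apply: le_ball xz; rewrite ler_pdivrMr// ler_pMr// ler1n.
  have := cP _ xy; have := cP _ xz'; rewrite /= /ball/= => h1 h2.
  rewrite [e]splitr (le_lt_trans (ler_distD (psi x) _ _))// ltrD// distrC//.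
rewrite nearE => -[d /= d0 Hd].
have m0 : 0 < Num.min (d / 2) 1 by rewrite lt_min divr_gt0/=.
exists (Num.min (d / 2) 1) => // x y; rewrite lt_min => /andP[xyd xy1].
have [xr|xr] := leP `|x| (r + 1).
  apply: (Hd (d / 2)) => //=.
  - by rewrite sub0r normrN gtr0_norm ?divr_gt0// ltr_pdivrMr// ltr_pMr// ltr1n.
  - by rewrite divr_gt0.
have yr : r < `|y|.
  by have := ler_normD (x - y) y; rewrite subrK; lra.
by rewrite !psi0 ?subrr ?normr0//; lra.
Qed.

(** A difference of two translated steps, so that sums of integer translates telescope: this is the
    source of the partition of unity. *)
Definition hat (y : R) : R := step (y + 1) - step y.

Lemma hat_ge0 y : 0 <= hat y.
Proof. by rewrite subr_ge0 le_step// lerDl. Qed.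

Lemma hat0 y : 1 < `|y| -> hat y = 0.
Proof.
rewrite /hat; have [y0|y0] := leP 0 y.
  by rewrite ger0_norm// => y1; rewrite !step_ge1 ?subrr//; lra.
by rewrite ltr0_norm// => y1; rewrite !step_le0 ?subrr//; lra.
Qed.

Lemma hat_sum (M : nat) y :
  \sum_(k < M) hat (y - k%:R) = step (y + 1) - step (y + 1 - M%:R).
Proof.
elim: M => [|M IH]; first by rewrite big_ord0 subr0 subrr.
rewrite big_ord_recr/= IH /hat -natr1.
have -> : y - M%:R + 1 = y + 1 - M%:R by ring.
have -> : y + 1 - (M%:R + 1) = y - M%:R by ring.
by rewrite subrKA.
Qed.

Section quasi_interpolant.
Variables (psi : 'rV[R]_N -> R) (r : R) (n M : nat).

Definition node (k : {ffun 'I_N -> 'I_M}) : 'rV[R]_N := \row_i ((k i)%:R / n.+1%:R - r).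

Definition spline (k : {ffun 'I_N -> 'I_M}) x : R :=
  \prod_(i < N) hat (n.+1%:R * x 0 i + n.+1%:R * r - (k i)%:R).

Definition interpolant x : R := \sum_(k : {ffun 'I_N -> 'I_M}) psi (node k) * spline k x.

Lemma spline_ge0 k x : 0 <= spline k x.
Proof. by apply: prodr_ge0 => i _; exact: hat_ge0. Qed.

Lemma spline_neq0 k x : spline k x != 0 -> `|x - node k| <= n.+1%:R^-1.
Proof.
move=> s0; apply/normrV_leP => // i; rewrite leNgt; apply/negP => h.
move/negP : s0; apply; rewrite /spline (bigD1 i)//= hat0 ?mul0r//.
have -> : n.+1%:R * x 0 i + n.+1%:R * r - (k i)%:R = n.+1%:R * ((x - node k) 0 i).
  by rewrite !mxE; field.
by rewrite normrM ger0_norm// -ltr_pdivrMl// mulr1.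
Qed.

Lemma spline_sumE x : \sum_k spline k x =
  \prod_(i < N) (step (n.+1%:R * x 0 i + n.+1%:R * r + 1) -
                 step (n.+1%:R * x 0 i + n.+1%:R * r + 1 - M%:R)).
Proof.
under [RHS]eq_bigr do rewrite -hat_sum.
by rewrite bigA_distr_bigA.
Qed.

Lemma spline_sum_le1 x : \sum_k spline k x <= 1.
Proof.
rewrite spline_sumE; apply: prodr_ile1 => i _; apply/andP; split.
  by rewrite subr_ge0 le_step// lerBlDr lerDl.
by rewrite lerBlDr (le_trans (step_le1 _))// lerDl step_ge0.
Qed.

Lemma spline_sum1 x : n.+1%:R * (2 * r) + 1 <= M%:R -> `|x| <= r -> \sum_k spline k x = 1.
Proof.
move=> hM xr; rewrite spline_sumE big1// => i _.
have := le_trans (coord_le_norm x i) xr; rewrite ler_norml => /andP[x1 x2].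
have n0 : 0 <= n.+1%:R :> R by [].
have h1 : 0 <= n.+1%:R * (x 0 i + r) by rewrite mulr_ge0//; lra.
have h2 : 0 <= n.+1%:R * (r - x 0 i) by rewrite mulr_ge0//; lra.
rewrite step_ge1; last lra.
by rewrite step_le0 ?subr0//; lra.
Qed.

Lemma C2c_interpolant : C2c interpolant.
Proof.
rewrite /interpolant; apply: C2c_sum => k; apply: C2cZ; split; last first.
  exists (`|node k| + n.+1%:R^-1) => [|x xr]; first by rewrite addr_ge0.
  apply/eqP; apply: contraTT xr => /spline_neq0 h; rewrite -leNgt.
  have := ler_normD (x - node k) (node k); rewrite subrK => /le_trans; apply.
  by rewrite addrC lerD2l.
apply: (@C21_prod _ _ _ _ _ (fun i x (_ : R) =>
  hat (n.+1%:R * x 0 i + n.+1%:R * r - (k i)%:R))) => i.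
have h (c : R) := C21_step (C21_coord_affine +oo%E n.+1%:R c i).
have H := C21D (h (n.+1%:R * r - (k i)%:R + 1)) (C21Z (-1) (h (n.+1%:R * r - (k i)%:R))).
apply: (C21_ext _ H) => x t.
by rewrite /hat mulN1r !addrA.
Qed.

End quasi_interpolant.

(** Splines that are nonzero at [x] belong to nodes within $1/(n+1)<d$ of [x], where [psi] varies by
    less than [e]; the splines are nonnegative with sum at most $1$, so the weighted errors add up
    to at most [e]. *)
Lemma C2c_dense psi r e : 0 <= r -> continuous psi -> (forall x, r < `|x| -> psi x = 0) ->
  0 < e -> exists f, [/\ C2c f, forall x, `|f x - psi x| <= e &
    forall x, r + 1 < `|x| -> f x = 0].
Proof.
move=> r0 cpsi psi0 e0.
have [d d0 Hd] := uniformly_continuous_support cpsi psi0 e0.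
pose n := Num.truncn d^-1.
have nd : n.+1%:R^-1 < d by rewrite invf_plt ?posrE// truncnS_gt.
have n1 : n.+1%:R^-1 <= 1 :> R by rewrite invf_le1// ler1n.
pose M := (Num.truncn (n.+1%:R * (2 * r) + 1)).+1.
have hM : n.+1%:R * (2 * r) + 1 <= M%:R by rewrite ltW// truncnS_gt.
exists (interpolant psi r n M); split; first exact: C2c_interpolant.
  move=> x; pose S := \sum_(k : {ffun 'I_N -> 'I_M}) spline r n k x.
  (* The splines need not sum to $1$ beyond radius [r], but [psi] vanishes there. *)
  have eS : psi x * S = psi x.
    have [xr|xr] := leP `|x| r; first by rewrite /S spline_sum1// mulr1.
    by rewrite psi0// mul0r.
  rewrite -[X in _ - X]eS /interpolant /S mulr_sumr -sumrB.
  apply: le_trans (ler_norm_sum _ _ _) _.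
  apply: (@le_trans _ _ (\sum_(k : {ffun 'I_N -> 'I_M}) e * spline r n k x)).
    apply: ler_sum => k _; rewrite -mulrBl normrM (ger0_norm (spline_ge0 _ _ _ _)).
    have [->|s0] := eqVneq (spline r n k x) 0; first by rewrite !mulr0.
    rewrite ler_wpM2r ?spline_ge0// ltW//; apply: Hd; rewrite distrC.
    exact: le_lt_trans (spline_neq0 s0) nd.
  by rewrite -mulr_sumr -[leRHS]mulr1 ler_wpM2l ?spline_sum_le1// ltW.
move=> x xr; rewrite /interpolant big1// => k _.
have [->|s0] := eqVneq (spline r n k x) 0; first by rewrite mulr0.
rewrite psi0 ?mul0r//; have h := le_trans (spline_neq0 s0) n1.
by have := ler_normD (x - node r n k) (node r n k); rewrite subrK; lra.
Qed.

End density.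

(** * Pairings with a locally integrable weight *)

Section weighted_integrals.
Context {R : realType} {N : nat}.
Implicit Types (f g psi w : 'rV[R]_N -> R) (x : 'rV[R]_N).
Variables (mu : {measure set 'rV[R]_N -> \bar R}) (w : 'rV[R]_N -> R).
Hypothesis mw : measurable_fun setT w.
Hypothesis w0 : {ae mu, forall x, 0 <= w x}.
Hypothesis iw : forall r, mu.-integrable [set x | `|x| <= r] (EFin \o w).

(** Used both for slices, with weight $u(\cdot,t)$ and Lebesgue measure, and for [nu] with weight
    $1$, so that one set of estimates serves both sides of the trace limit. *)
Definition pairing f : R := fine (\int[mu]_x (w x * f x)%:E)%E.

Lemma bounded_supportD f g : bounded_support f -> bounded_support g ->
  bounded_support (fun x => f x + g x).
Proof.
move=> [mf [r [C [r0 C0 fC f0]]]] [mg [s [D [s0 D0 gD g0]]]]; split.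
  exact: measurable_funD.
exists (Num.max r s), (C + D); split => //.
- by rewrite le_max r0.
- exact: addr_ge0.
- by move=> x; rewrite (le_trans (ler_normD _ _))// lerD.
- by move=> x; rewrite gt_max => /andP[xr xs]; rewrite f0// g0// addr0.
Qed.

Lemma bounded_supportZ c f : bounded_support f -> bounded_support (fun x => c * f x).
Proof.
move=> [mf [r [C [r0 C0 fC f0]]]]; split; first exact: measurable_funM.
exists r, (`|c| * C); split => //; first exact: mulr_ge0.
- by move=> x; rewrite normrM ler_wpM2l.
- by move=> x xr; rewrite f0// mulr0.
Qed.

Lemma weighted_integrable f : bounded_support f ->
  mu.-integrable setT (fun x => (w x * f x)%:E).
Proof.
move=> [mf [r [C [r0 C0 fC f0]]]].
have mB := @measurable_norm_ball R N r.
have iB : mu.-integrable setT (fun x => C%:E * ((EFin \o w) \_ [set x | (`|x| <= r)%R]) x)%E.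
  by apply: integrableZl => //; exact: (iffLR (integrable_mkcond _ mB) (iw r)).
apply: le_integrable iB => //; first by apply/measurable_EFinP; exact: measurable_funM.
move=> x _; rewrite /patch; case: ifPn => [_|/negP xB].
  by rewrite /= lee_fin !normrM mulrC (ger0_norm C0) ler_wpM2r.
have fx : f x = 0.
  by rewrite f0// ltNge; apply/negP => xr; apply: xB; exact: mem_set.
by rewrite fx mulr0 mule0.
Qed.

Lemma pairingE f : bounded_support f -> (\int[mu]_x (w x * f x)%:E = (pairing f)%:E)%E.
Proof.
by move=> bf; rewrite fineK//; apply: (integrable_fin_num measurableT); exact: weighted_integrable.
Qed.

Lemma pairingDZ f c g : bounded_support f -> bounded_support g ->
  pairing (fun x => f x + c * g x) = pairing f + c * pairing g.
Proof.
move=> bf bg; have bcg := bounded_supportZ c bg.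
apply: EFin_inj; rewrite EFinD EFinM -!pairingE//; last exact: bounded_supportD.
rewrite -integralZl//; last exact: weighted_integrable.
rewrite -integralD//; [|exact: weighted_integrable|].
  by apply: eq_integral => x _; rewrite -EFinM -EFinD; congr EFin; ring.
by apply: integrableZl => //; exact: weighted_integrable.
Qed.

Lemma pairing_le f g : bounded_support f -> bounded_support g -> (forall x, f x <= g x) ->
  pairing f <= pairing g.
Proof.
move=> bf bg fg; rewrite -lee_fin -!pairingE//.
(* The weight is nonnegative only almost everywhere; replacing it by its absolute value turns the
   comparison into a pointwise one. *)
have abs h : bounded_support h ->
    (\int[mu]_x (w x * h x)%:E = \int[mu]_x (`|w x| * h x)%:E)%E /\
    mu.-integrable setT (fun x => (`|w x| * h x)%:E).
  move=> bh; have mh := bh.1.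
  have ma : measurable_fun setT (fun x => (`|w x| * h x)%:E).
    apply/measurable_EFinP; apply: measurable_funM => //.
    exact: measurableT_comp.
  split; last first.
    apply: le_integrable (weighted_integrable bh) => // x _.
    by rewrite /= lee_fin !normrM normr_id.
  apply: ae_eq_integral => //.
    by apply/measurable_EFinP; exact: measurable_funM.
  by move: w0; apply: filterS => x wx _; rewrite ger0_norm.
have [-> if_] := abs _ bf; have [-> ig_] := abs _ bg.
by apply: le_integral => // x _; rewrite lee_fin ler_wpM2l.
Qed.

Lemma pairing_approx f g h c : bounded_support f -> bounded_support g -> bounded_support h ->
  (forall x, `|f x - g x| <= c * h x) -> `|pairing f - pairing g| <= c * pairing h.
Proof.
move=> bf bg bh H; rewrite ler_distl -mulNr.
rewrite -!pairingDZ//; apply/andP; split; apply: pairing_le => //.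
- exact/bounded_supportD/bounded_supportZ.
- by move=> x; have := H x; rewrite ler_norml => /andP[]; rewrite mulNr; lra.
- exact/bounded_supportD/bounded_supportZ.
- by move=> x; have := H x; rewrite ler_norml => /andP[]; lra.
Qed.

End weighted_integrals.

(** * Essential limits at time zero *)

Section essential_limits.
Context {R : realType}.
Local Notation leb := (@lebesgue_measure R).
Implicit Types (Z : set R) (f g : R -> \bar R).

(** An interval $]0,e[$ has positive measure and cannot lie in a null set. Properness of the filter
    is what makes essential limits unique. *)
Lemma negligible_proper Z : leb.-negligible Z -> ProperFilter (within (~` Z) (0 : R)^'+).
Proof.
move=> [B [mB B0 ZB]]; split.
  move=> /nbhs_ballP[e /= e0 He].
  have sub : `]0, e[ `<=` B.
    move=> t /=; rewrite in_itv/= => /andP[t0 te]; apply: ZB; apply: contrapT => nZ.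
    by apply: (He t) => //; rewrite /ball/= sub0r normrN gtr0_norm.
  have : (leb `]0%R, e[ <= leb B)%E by apply: le_measure; rewrite ?inE.
  rewrite B0 (lebesgue_measure_itv `]0%R, e[)/= lte_fin e0 -EFinB subr0 lee_fin.
  by rewrite leNgt e0.
exact: within_filter.
Qed.

Lemma within_sub Z Z' (A : set R) : Z `<=` Z' -> within (~` Z) (0 : R)^'+ A ->
  within (~` Z') (0 : R)^'+ A.
Proof.
move=> ZZ' H; have H' : (0 : R)^'+ (fun t => ~ Z t -> A t) := H.
suff : (0 : R)^'+ (fun t => ~ Z' t -> A t) by [].
by apply: filterS H' => t + nZ'; apply => /ZZ'.
Qed.

Lemma ess_cvg_enlarge Z Z' f (l : \bar R) : Z `<=` Z' -> f t @[t --> within (~` Z) (0 : R)^'+] --> l ->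
  f t @[t --> within (~` Z') (0 : R)^'+] --> l.
Proof. by move=> ZZ' fl A /fl; exact: within_sub. Qed.

Lemma ess_cvg_unique f (l l' : \bar R) : ess_cvg_at_right f 0 l -> ess_cvg_at_right f 0 l' -> l = l'.
Proof.
move=> [Z nZ fl] [Z' nZ' fl']; have nU := negligibleU nZ nZ'.
have P := negligible_proper nU.
apply: (cvg_unique _ (ess_cvg_enlarge (@subsetUl _ Z Z') fl)
  (ess_cvg_enlarge (@subsetUr _ Z Z') fl')) => //.
Qed.

End essential_limits.

(** * Initial traces tested on $C^2_c$ and on $C_c$ *)

Section traces.
Context {R : realType} {N : nat}.
Local Notation leb := (@lebesgue_measure R).
Implicit Types (f g psi : 'rV[R]_N -> R) (x : 'rV[R]_N) (u : 'rV[R]_N -> R -> R).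

Lemma near_good_time (T : \bar R) (P : R -> Prop) Z : (0 < T)%E ->
  [set t | ~ (0 < t -> (t%:E < T)%E -> P t)] `<=` Z ->
  \forall t \near within (~` Z) (0 : R)^'+, P t.
Proof.
move=> T0 sZ; have H := near_at_right0 T0; rewrite near_withinE.
apply: (filterS _ H) => t [t0 tT] nZ.
by apply: contrapT => nP; apply: nZ; apply: sZ => /= h; apply: nP; exact: h.
Qed.

Lemma compactly_supported_vanishes psi : compactly_supported psi ->
  exists2 r, 0 <= r & forall x, r < `|x| -> psi x = 0.
Proof.
move=> /compact_bounded[M [Mr HM]]; exists (`|M| + 1); first by rewrite addr_ge0.
move=> x xr; apply/eqP; apply: contraTT xr => px; rewrite -leNgt.
apply: (HM (`|M| + 1)); first by rewrite (le_lt_trans (ler_norm _))// ltrDl.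
exact: subset_closure.
Qed.

Lemma vanishes_compactly_supported psi r : (forall x, r < `|x| -> psi x = 0) ->
  compactly_supported psi.
Proof.
move=> psi0; have cB := @closed_norm_ball R N r.
have sub : closure [set x | psi x != 0] `<=` [set x : 'rV[R]_N | `|x| <= r].
  have -> := (closure_id _).1 cB.
  apply: closure_subset => x /= px; rewrite leNgt; apply/negP => /psi0 e.
  by rewrite e eqxx in px.
by apply: (subclosed_compact _ (@compact_norm_ball R N r)) => //; exact: closed_closure.
Qed.

Lemma C2c_compactly_supported f : C2c f -> compactly_supported f.
Proof. by move=> [_ [r _ f0]]; exact: vanishes_compactly_supported f0. Qed.

(** A function in $C_c$ is approximated uniformly by $C^2_c$ functions with a common bounded
    support. The error in the pairing at time $t$ is at most $1/(n+1)$ times the pairing with a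
    cutoff, and this pairing stays bounded as $t\to0$ because it converges. *)
Lemma trace_of_C2c (T : \bar R) u (nu : {measure set 'rV[R]_N -> \bar R}) :
  (0 < T)%E -> radon nu ->
  {ae leb, forall t : R, 0 < t -> (t%:E < T)%E -> good_time u t} ->
  (forall f, C2c f -> ess_cvg_at_right
    (fun t => \int[lebesgue_rV R N]_x (u x t * f x)%:E)%E 0 (\int[nu]_x (f x)%:E)%E) ->
  initial_trace u nu.
Proof.
move=> T0 rnu gt H; split => // psi cpsi /compactly_supported_vanishes[r r0 psi0].
have bpsi := continuous_bounded_support r0 cpsi psi0.
have r1 : 0 <= r + 1 by rewrite addr_ge0.
have Cchi := @C2c_cube_cutoff R N _ r1; have bchi := C2c_bounded_support Cchi.
have /choice[f Hf] : forall n : nat, exists f, [/\ C2c f,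
    forall x, `|f x - psi x| <= n.+1%:R^-1 & forall x, r + 1 < `|x| -> f x = 0].
  by move=> n; apply: C2c_dense psi0 _.
have Cf n : C2c (f n) by have [] := Hf n.
have bf n := C2c_bounded_support (Cf n).
have fpsi n x : `|f n x - psi x| <= n.+1%:R^-1 * cube_cutoff (r + 1) x.
  have [_ h1 h2] := Hf n; have [xr|xr] := leP `|x| (r + 1).
    by rewrite cube_cutoff1// mulr1.
  rewrite h2// psi0 ?subrr ?normr0 ?mulr_ge0 ?cube_cutoff_ge0//; lra.
have /choice[Z HZ] : forall n : nat, exists Z : set R, leb.-negligible Z /\
    (\int[lebesgue_rV R N]_x (u x t * f n x)%:E)%E @[t --> within (~` Z) (0 : R)^'+] -->
    (\int[nu]_x (f n x)%:E)%E.
  by move=> n; have [Z nZ cZ] := H _ (Cf n); exists Z.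
have [Y nY cY] := H _ Cchi.
pose G := [set t : R | ~ (0 < t -> (t%:E < T)%E -> good_time u t)].
(* One null set for all tests: the bad times and the exceptional sets of the cutoff and of the
   countably many approximants. *)
pose W := G `|` (Y `|` \bigcup_n Z n).
have nW : leb.-negligible W.
  apply: negligibleU => //; apply: negligibleU => //; apply: negligible_bigcup => n.
  exact: (HZ n).1.
exists W => //.
have PW := negligible_proper nW.
have good : \forall t \near within (~` W) (0 : R)^'+, good_time u t.
  by apply: near_good_time T0 _; exact: subsetUl.
have subZ n : Z n `<=` W by move=> t Znt; right; right; exists n.
have subY : Y `<=` W by move=> t Yt; right; left.
have cf n := ess_cvg_enlarge (subZ n) (HZ n).2.
have {}cY := ess_cvg_enlarge subY cY.
pose J t g := pairing (lebesgue_rV R N) (u ^~ t) g.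
pose one : 'rV[R]_N -> R := fun=> 1.
have m1 : measurable_fun setT one by exact: measurable_cst.
have one0 : {ae nu, forall x, 0 <= one x} by exact: aeW.
have i1 s : nu.-integrable [set x | `|x| <= s] (EFin \o one).
  apply/integrableP; split; first exact/measurable_EFinP/measurable_cst.
  rewrite (eq_integral (cst 1%E)) => [|x _]; last by rewrite /= normr1.
  rewrite integral_cst ?mul1e; last exact: measurable_norm_ball.
  by apply: rnu; exact: compact_norm_ball.
pose I g := pairing nu one g.
have IE g : bounded_support g -> (\int[nu]_x (g x)%:E = (I g)%:E)%E.
  move=> bg; rewrite -(pairingE m1 i1 bg).
  by apply: eq_integral => x _; rewrite mul1r.
have cJ g : bounded_support g -> (\int[lebesgue_rV R N]_x (u x t * g x)%:E)%E
    @[t --> within (~` W) (0 : R)^'+] --> (I g)%:E ->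
    J t g @[t --> within (~` W) (0 : R)^'+] --> I g.
  by move=> bg /fine_cvg.
rewrite IE//; apply: cvg_EFin.
  apply: filterS good => t [mt t0 it].
  by rewrite (pairingE mt it bpsi).
have cfJ n : J t (f n) @[t --> within (~` W) (0 : R)^'+] --> I (f n).
  by apply: cJ => //; rewrite -IE//; exact: cf.
have cchiJ : J t (cube_cutoff (r + 1)) @[t --> within (~` W) (0 : R)^'+] --> I (cube_cutoff (r + 1)).
  by apply: cJ => //; rewrite -IE.
pose C := I (cube_cutoff (r + 1)).
have C0 : 0 <= C by apply: fine_ge0; apply: integral_ge0 => x _; rewrite mul1r lee_fin cube_cutoff_ge0.
apply/cvgrPdist_le => e e0.
(* Approximation costs at most $(C+1)/(n+1)$ on the slice and $C/(n+1)$ on the measure, where $C+1$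
   bounds the pairing with the cutoff near time $0$. The choice makes the sum at most $e/2$. *)
pose n := Num.truncn ((2 * C + 1) / (e / 2)).
have en : n.+1%:R^-1 * (2 * C + 1) <= e / 2.
  rewrite ler_pdivrMl// -ler_pdivrMr ?divr_gt0//.
  by apply: ltW; rewrite truncnS_gt.
have e2 : 0 < e / 2 by rewrite divr_gt0.
have near1 := (cvgrPdist_le _ _).1 (cfJ n) _ e2.
have near2 := (cvgrPdist_le _ _).1 cchiJ _ (ltr01 : 0 < 1 :> R).
near=> t.
have [mt t0 it] : good_time u t by near: t.
have h1 : `|I (f n) - J t (f n)| <= e / 2 by near: t; exact: near1.
have h2 : `|C - J t (cube_cutoff (r + 1))| <= 1 by near: t; exact: near2.
have h3 : `|J t (f n) - J t psi| <= n.+1%:R^-1 * J t (cube_cutoff (r + 1)).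
  exact: (pairing_approx mt t0 it).
have h4 : `|I (f n) - I psi| <= n.+1%:R^-1 * C.
  exact: (pairing_approx m1 one0 i1).
have h5 : n.+1%:R^-1 * J t (cube_cutoff (r + 1)) <= n.+1%:R^-1 * (C + 1).
  by rewrite ler_wpM2l//; move: h2; rewrite ler_norml => /andP[]; lra.
have -> : I psi - J t psi = - (I (f n) - I psi) + (I (f n) - J t (f n)) + (J t (f n) - J t psi).
  by ring.
apply: le_trans (ler_normD _ _) _; apply: le_trans (lerD (ler_normD _ _) (lexx _)) _.
rewrite normrN; move: (le_trans h3 h5) h4 en; move: (n.+1%:R^-1) => k h3' h4 en; lra.
Unshelve. all: by end_near. Qed.

Lemma trace_unique u (nu nu' : {measure set 'rV[R]_N -> \bar R}) :
  initial_trace u nu -> initial_trace u nu' -> same_measure nu nu'.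
Proof.
move=> [rnu H] [rnu' H']; apply: radon_unique => // f Cf.
have cf := C2c_continuous Cf; have sf := C2c_compactly_supported Cf.
exact: (ess_cvg_unique (H f cf sf) (H' f cf sf)).
Qed.

End traces.

(** * Existence of the trace for (E) and its identification for (P) *)

Section existence.
Context {R : realType} {N : nat}.
Local Notation leb := (@lebesgue_measure R).
Implicit Types (f g psi : 'rV[R]_N -> R) (x : 'rV[R]_N) (u : 'rV[R]_N -> R -> R) (T : \bar R).

Lemma cvg_near_lin (S : Type) (F : set_system S) (c a b : R) (f g h : S -> R) :
  ProperFilter F -> f t @[t --> F] --> a -> g t @[t --> F] --> b ->
  (\forall t \near F, h t = f t + c * g t) -> h t @[t --> F] --> a + c * b.
Proof.
move=> PF fa gb hfg; have h' : (f t + c * g t) @[t --> F] --> a + c * b.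
  by apply: cvgD => //; apply: cvgM => //; exact: cvg_cst.
apply: cvg_trans h'; apply: near_eq_cvg.
by apply: filterS hfg => t ->.
Qed.

Lemma solution_E_trace_C2c (m p b : R) T u f : 1 <= m -> m < p -> 0 < b -> (b%:E < T)%E ->
  solution_E m p T u -> C2c f ->
  ess_cvg_at_right (fun t => \int[lebesgue_rV R N]_x (u x t * f x)%:E)%E 0
    (weak_form m p T u (fun x t => f x * time_cutoff b t) 0).
Proof.
move=> hm hmp b0 bT E Cf.
have T0 : (0 < T)%E by apply: lt_trans bT; rewrite lte_fin.
have [Z nZ cZ] := solution_E_trace hm hmp T0 E (C2c_C21c b0 bT Cf).
exists Z => //; apply: cvg_trans cZ; apply: near_eq_cvg.
have b20 : 0 < b / 2 by rewrite divr_gt0.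
have H : \forall t \near (0 : R)^'+, t < b / 2 by exact: nbhs_right_lt.
rewrite near_withinE; apply: (filterS _ H) => t tb _.
by apply: eq_integral => x _; rewrite time_cutoff1 ?mulr1// ltW.
Qed.

Lemma solution_E_good_times (m p : R) T u : 1 <= m -> m < p -> (0 < T)%E ->
  solution_E m p T u ->
  {ae leb, forall t : R, 0 < t -> (t%:E < T)%E -> good_time u t}.
Proof. by move=> hm hmp T0 [Lu nu _]; apply: good_times T0 Lu nu; lra. Qed.

(** The functional [L] is the weak form at time $0$, which shows that the limit is finite; its
    linearity and positivity are instead inherited from the slice pairings by uniqueness of
    essential limits. *)
Lemma solution_E_has_trace (m p T : R) u : 1 <= m -> m < p -> 0 < T ->
  solution_E m p T%:E u ->
  exists nu : {measure set 'rV[R]_N -> \bar R}, initial_trace u nu.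
Proof.
move=> hm hmp T0 E.
have T0' : (0 < T%:E)%E by rewrite lte_fin.
have b0 : 0 < T / 2 by rewrite divr_gt0.
have bT : ((T / 2)%:E < T%:E)%E by rewrite lte_fin ltr_pdivrMr// ltr_pMr// ltr1n.
have gt := solution_E_good_times hm hmp T0' E.
pose L f := fine (weak_form m p T%:E u (fun x t => f x * time_cutoff (T / 2) t) 0).
have cL f : C2c f -> ess_cvg_at_right
    (fun t => \int[lebesgue_rV R N]_x (u x t * f x)%:E)%E 0 (L f)%:E.
  move=> Cf; rewrite fineK; first exact: (solution_E_trace_C2c hm hmp b0 bT E Cf).
  have [Lu _ _] := E; have Cphi := C2c_C21c b0 bT Cf.
  rewrite (weak_formE hm hmp T0' Lu Cphi (lexx 0)).
  apply: (@integrable_fin_num _ _ _ (lam R N) _ (@measurable_slab R N 0 T%:E)).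
  apply: integrableS (weak_integrand_integrable hm hmp T0' Lu Cphi).
  - exact: measurable_space_time.
  - exact: measurable_slab.
  - exact: slab_space_time.
pose G := [set t : R | ~ (0 < t -> (t%:E < T%:E)%E -> good_time u t)].
pose J t g := pairing (lebesgue_rV R N) (u ^~ t) g.
have cJ f : C2c f -> exists2 Z, leb.-negligible Z &
    J t f @[t --> within (~` Z) (0 : R)^'+] --> L f.
  by move=> Cf; have [Z nZ /fine_cvg cZ] := cL _ Cf; exists Z.
have cJW f Z W : Z `<=` W -> J t f @[t --> within (~` Z) (0 : R)^'+] --> L f ->
    J t f @[t --> within (~` W) (0 : R)^'+] --> L f.
  by move=> ZW c A /c; exact: within_sub.
have nG : leb.-negligible G by exact: gt.
have good W : G `<=` W -> \forall t \near within (~` W) (0 : R)^'+, good_time u t.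
  by move=> GW; apply: near_good_time T0' _.
have Llin f c g : C2c f -> C2c g -> L (fun x => f x + c * g x) = L f + c * L g.
  move=> Cf Cg; have Ch := C2cD Cf (C2cZ c Cg).
  have [Z1 n1 c1] := cJ _ Cf; have [Z2 n2 c2] := cJ _ Cg; have [Z3 n3 c3] := cJ _ Ch.
  pose W := G `|` (Z1 `|` (Z2 `|` Z3)).
  have nW : leb.-negligible W by do 3 apply: negligibleU => //.
  have PW := negligible_proper nW.
  have {}c1 := cJW _ _ W (fun t Zt => or_intror (or_introl Zt)) c1.
  have {}c2 := cJW _ _ W (fun t Zt => or_intror (or_intror (or_introl Zt))) c2.
  have {}c3 := cJW _ _ W (fun t Zt => or_intror (or_intror (or_intror Zt))) c3.
  apply: (cvg_unique _ c3) => //.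
  apply: (cvg_near_lin PW c1 c2).
  have gW := good W (@subsetUl _ _ _).
  apply: (filterS _ gW) => t [mt t0 it] /=.
  by rewrite /J (pairingDZ mt it)//; exact: C2c_bounded_support.
have L0 : L (fun=> 0) = 0.
  have := Llin _ (-1) _ C2c0 C2c0.
  rewrite (_ : (fun x => _) = (fun=> 0)); first by lra.
  by apply/funext => x; rewrite mulr0 addr0.
have LD f g : C2c f -> C2c g -> L (fun x => f x + g x) = L f + L g.
  move=> Cf Cg; have := Llin f 1 g Cf Cg.
  rewrite mul1r (_ : (fun x => f x + 1 * g x) = (fun x => f x + g x))//.
  by apply/funext => x; rewrite mul1r.
have LZ c f : C2c f -> L (fun x => c * f x) = c * L f.
  move=> Cf; have := Llin _ c f C2c0 Cf.
  rewrite L0 add0r (_ : (fun x => 0 + c * f x) = (fun x => c * f x))//.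
  by apply/funext => x; rewrite add0r.
have Lpos f : C2c f -> (forall x, 0 <= f x) -> 0 <= L f.
  move=> Cf f0; have [Z1 n1 c1] := cJ _ Cf.
  have nW : leb.-negligible (G `|` Z1) by exact: negligibleU.
  have PW := negligible_proper nW.
  have {}c1 := cJW _ _ _ (@subsetUr _ G Z1) c1.
  have bf := C2c_bounded_support Cf.
  have b0' := C2c_bounded_support (@C2c0 R N).
  have : \forall t \near within (~` (G `|` Z1)) (0 : R)^'+, 0 <= J t f.
    have gW := good _ (@subsetUl _ G Z1).
    apply: (filterS _ gW) => t [mt t0 it] /=.
    have <- : J t (fun=> 0) = 0.
      by rewrite /J /pairing integral0_eq// => x _; rewrite mulr0.
    exact: (pairing_le mt t0 it).
  exact: (cvgr_to_ge c1).
have [nu [rnu nuL]] := riesz LD LZ Lpos.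
exists nu; apply: (trace_of_C2c T0' rnu gt) => f Cf.
by rewrite nuL//; exact: cL.
Qed.

(** The limit furnished by (E) is the weak form at time $0$, and (P) evaluates it as an integral
    against [mu] of a function whose time cutoff equals $1$ at time $0$. *)
Lemma solution_P_initial_trace (m p : R) T u (mu : {measure set 'rV[R]_N -> \bar R}) :
  1 <= m -> m < p -> radon mu -> (0 < T)%E -> solution_P m p T mu u -> initial_trace u mu.
Proof.
move=> hm hmp rmu T0 P; have E := solution_PE hm hmp T0 P.
have [b b0 bT] : exists2 b, 0 < b & (b%:E < T)%E.
  case: T T0 {P E} => [T||]// T0; last by exists 1; rewrite ?ltry.
  rewrite lte_fin in T0; exists (T / 2); first by rewrite divr_gt0.
  by rewrite lte_fin ltr_pdivrMr// ltr_pMr// ltr1n.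
apply: (trace_of_C2c T0 rmu (solution_E_good_times hm hmp T0 E)) => f Cf.
have := solution_E_trace_C2c hm hmp b0 bT E Cf.
have [_ _ ->] := P; last exact: C2c_C21c.
rewrite (eq_integral (fun x => (f x)%:E))// => x _.
by rewrite time_cutoff1 ?mulr1// divr_ge0// ltW.
Qed.

End existence.

(** * The multiscale cutoff and its derivatives *)

Section barrier.
Context {R : realType} {N : nat}.
Implicit Types (T : \bar R) (x z : 'rV[R]_N) (t r s : R).

Definition sqr_dist z x : R := \sum_k (x 0 k - z 0 k) ^+ 2.

Lemma sqr_dist_ge0 z x : 0 <= sqr_dist z x.
Proof. by apply: sumr_ge0 => k _; exact: sqr_ge0. Qed.

Lemma coord_le_sqr_dist z x k : (x 0 k - z 0 k) ^+ 2 <= sqr_dist z x.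
Proof.
rewrite /sqr_dist (bigD1 k)//= lerDl; apply: sumr_ge0 => i _; exact: sqr_ge0.
Qed.

Lemma is_derive_exprn (k : nat) (y : R) : is_derive y 1 (fun y => y ^+ k.+1) (k.+1%:R * y ^+ k).
Proof.
rewrite (_ : (fun y : R => _) = id ^+ k.+1); last by rewrite exprfctE.
by apply: is_derive_eq; rewrite /GRing.scale/= mulr1.
Qed.

Lemma jet_sqr_dist T z : jet T (fun x _ => sqr_dist z x) (fun _ _ => 0)
  (fun i x _ => 2 * (x 0 i - z 0 i)) (fun i j _ _ => 2 * (i == j)%:R).
Proof.
have D1 k (y : R) : is_derive y 1 (fun y => (y - z 0 k) ^+ 2) (2 * (y - z 0 k)).
  apply: (@is_derive_quadratic _ _ _ _ 1) => h _.
  by rewrite le_eqVlt; apply/orP; left; rewrite -[X in _ == X]ger0_norm ?mul1r ?sqr_ge0//; apply/eqP; congr `|_|; ring.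
have D2 k (y : R) : is_derive y 1 (fun y => 2 * (y - z 0 k)) 2.
  rewrite (_ : (fun y => _) = (fun y => 2 * y + - (2 * z 0 k))); first exact: is_derive_affine.
  by apply/funext => v; ring.
have C2 : continuous (fun _ : R => 2 : R) by exact: cst_continuous.
have J := jet_sum (index_enum 'I_N) (fun k => jet_comp (D1 k) (D2 k) C2 (jet_coord T k)).
apply: jet_ext J => //=.
- by move=> x t; rewrite big1// => k _; rewrite mulr0.
- move=> i x t; rewrite (bigD1 i)//= eqxx mulr1 big1 ?addr0// => k ki.
  by rewrite eq_sym (negbTE ki) mulr0.
- move=> i j x t; rewrite (bigD1 i)//= eqxx mulr1 mulr0 addr0 big1 ?addr0; last first.
    by move=> k ki; rewrite (eq_sym i) (negbTE ki) !mulr0 mul0r add0r.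
  by rewrite eq_sym.
Qed.

Definition parabola z r s x t : R := 1 - sqr_dist z x / (4 * r ^+ 2) - t / s.

Lemma jet_parabola T z r s : jet T (parabola z r s) (fun _ _ => - s^-1)
  (fun i x _ => - ((x 0 i - z 0 i) / (2 * r ^+ 2)))
  (fun i j _ _ => - ((i == j)%:R / (2 * r ^+ 2))).
Proof.
have D (t : R) : is_derive t 1 (fun t => - s^-1 * t + 1) (- s^-1) by exact: is_derive_affine.
have J := jetD (jetZ (- (4 * r ^+ 2)^-1) (jet_sqr_dist T z)) (jet_time T D (@cst_continuous _ _ _)).
have r4 : (2 * r ^+ 2)^-1 = (4 * r ^+ 2)^-1 * 2.
  rewrite !invfM -[X in X * _ = _]mul1r [RHS]mulrAC; congr (_ * _).
  by rewrite mulrC; apply: (mulfI (_ : (4 : R) != 0)) => //; lra.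
apply: jet_ext J => //=.
- by move=> x t; rewrite /parabola; ring.
- by move=> x t; rewrite mulr0 add0r.
- by move=> i x t; rewrite addr0 r4; ring.
- by move=> i j x t; rewrite addr0 r4; ring.
Qed.


Lemma continuous_mulr_pos (c : R) : continuous (fun y : R => c * pos y).
Proof.
by move=> y; apply: cvgM; [exact: cvg_cst|exact: continuous_pos].
Qed.

(** An average of [n] cutoffs with sizes [rho j] and durations [s j]; the cube makes each of them
    $C^2$. When the scales at least double, the factor $1/n$ survives in all derivative bounds,
    which is what produces the logarithm in the critical case. *)
Definition profile n (rho s : nat -> R) z x t : R :=
  n%:R^-1 * \sum_(j <- iota 0 n) pos (parabola z (rho j) (s j) x t) ^+ 3.

Section profile.
Variables (n : nat) (rho s : nat -> R) (z : 'rV[R]_N).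
Let w j x t : R := pos (parabola z (rho j) (s j) x t).

Definition profile_dt x t : R :=
  n%:R^-1 * \sum_(j <- iota 0 n) 3 * w j x t ^+ 2 * - (s j)^-1.

Definition profile_dx (i : 'I_N) x t : R :=
  n%:R^-1 * \sum_(j <- iota 0 n)
    3 * w j x t ^+ 2 * - ((x 0 i - z 0 i) / (2 * rho j ^+ 2)).

Definition profile_dxdx (i l : 'I_N) x t : R :=
  n%:R^-1 * \sum_(j <- iota 0 n)
    (6 * w j x t * - ((x 0 i - z 0 i) / (2 * rho j ^+ 2)) *
       - ((x 0 l - z 0 l) / (2 * rho j ^+ 2)) +
     3 * w j x t ^+ 2 * - ((i == l)%:R / (2 * rho j ^+ 2))).

Lemma jet_profile T : jet T (profile n rho s z) profile_dt profile_dx profile_dxdx.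
Proof.
have D2 (y : R) : is_derive y 1 (fun y => 3 * pos y ^+ 2) (6 * pos y).
  apply: is_derive_eq (is_deriveZ 3 (is_derive_pos2 y)) _.
  by rewrite /GRing.scale/=; ring.
exact: (jetZ n%:R^-1 (jet_sum (iota 0 n) (fun j =>
  jet_comp (@is_derive_pos3 R) D2 (@continuous_mulr_pos 6)
    (jet_parabola T z (rho j) (s j))))).
Qed.

Hypothesis n0 : (0 < n)%N.
Hypothesis rho0 : forall j, 0 < rho j.
Hypothesis s0 : forall j, 0 < s j.
Hypothesis rho2 : forall j, 2 * rho j <= rho j.+1.
Hypothesis s2 : forall j, 2 * s j <= s j.+1.

Let n0R : 0 < n%:R :> R. Proof. by rewrite ltr0n. Qed.

Lemma profile_ge0 x t : 0 <= profile n rho s z x t.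
Proof.
apply: mulr_ge0; first by rewrite invr_ge0 ltW.
by apply: sumr_ge0 => j _; rewrite exprn_ge0// pos_ge0.
Qed.

Lemma parabola_le1 j x t : 0 <= t -> parabola z (rho j) (s j) x t <= 1.
Proof.
move=> t0; rewrite /parabola -addrA gerDl -opprD oppr_le0.
apply: addr_ge0; apply: divr_ge0 => //; [exact: sqr_dist_ge0| |exact: ltW].
by rewrite mulr_ge0// sqr_ge0.
Qed.

Lemma pos_parabola_le1 j x t : 0 <= t -> w j x t <= 1.
Proof. by move=> t0; rewrite /w /pos ge_max parabola_le1/=. Qed.

Lemma profile_le1 x t : 0 <= t -> profile n rho s z x t <= 1.
Proof.
move=> t0; rewrite /profile ler_pdivrMl// mulr1.
apply: le_trans (_ : \sum_(j <- iota 0 n) 1 <= _); last first.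
  by rewrite big_const_seq count_predT size_iota iter_addr_0.
by apply: ler_sum => j _; apply: exprn_ile1; [exact: pos_ge0|exact: pos_parabola_le1].
Qed.

Lemma parabola_gt0 j x t : 0 <= t -> 0 < parabola z (rho j) (s j) x t ->
  (forall l, `|x 0 l - z 0 l| <= 2 * rho j) /\ t <= s j.
Proof.
move=> t0; rewrite /parabola => h.
have r4 : 0 < 4 * rho j ^+ 2 by rewrite mulr_gt0// exprn_gt0.
have q0 : 0 <= sqr_dist z x / (4 * rho j ^+ 2) by rewrite divr_ge0 ?sqr_dist_ge0// ltW.
have t0' : 0 <= t / s j by rewrite divr_ge0// ltW.
split => [l|]; last by rewrite -[s j]mul1r -ler_pdivrMr//; lra.
have : sqr_dist z x <= 4 * rho j ^+ 2 by rewrite -[leRHS]mul1r -ler_pdivrMr//; lra.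
move=> /(le_trans (coord_le_sqr_dist z x l)) H.
rewrite -(@ler_pXn2r _ 2)// ?nnegrE ?mulr_ge0 ?(ltW (rho0 j))//.
by rewrite real_normK ?num_real// exprMn; apply: le_trans H _; lra.
Qed.

End profile.

(** With ratios at most $1/2$, the first admissible term controls the whole sum. The induction
    carries the deficit [2 * a (i + k)], which pays for the next term. *)
Lemma geometric_tail (a : nat -> R) (c : pred nat) i n :
  (forall j, 0 <= a j) -> (forall j, 2 * a j.+1 <= a j) ->
  (forall j, c j -> (i <= j)%N) ->
  \sum_(j <- iota 0 n) (if c j then a j else 0) <= 2 * a i.
Proof.
move=> a0 a2 ci.
suff H k : \sum_(j <- iota 0 (i + k)) (if c j then a j else 0) <= 2 * a i - 2 * a (i + k)%N.
  have [ni|/ltnW ni] := leqP i n.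
    by rewrite -(subnKC ni); apply: le_trans (H _) _; rewrite gerBl mulr_ge0.
  rewrite big1_seq ?mulr_ge0// => j /=; rewrite mem_iota add0n => /= jn.
  by case: ifP => // /ci ij; have := leq_trans jn (leq_trans ni ij); rewrite ltnn.
elim: k => [|k IH].
  rewrite addn0 subrr big1_seq// => j /=; rewrite mem_iota add0n => /= jn.
  by case: ifP => // /ci ij; have := leq_trans jn ij; rewrite ltnn.
rewrite addnS -addn1 iotaD big_cat/= big_seq1 add0n.
apply: le_trans (lerD IH (_ : _ <= a (i + k)%N)) _; first by case: ifP.
by rewrite addn1; have := a2 (i + k)%N; lra.
Qed.


Section profile_bounds.
Variables (n : nat) (rho s : nat -> R) (z : 'rV[R]_N).
Hypothesis n0 : (0 < n)%N.
Hypothesis rho0 : forall j, 0 < rho j.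
Hypothesis s0 : forall j, 0 < s j.
Hypothesis rho2 : forall j, 2 * rho j <= rho j.+1.
Hypothesis s2 : forall j, 2 * s j <= s j.+1.

Let n0R : 0 < n%:R :> R. Proof. by rewrite ltr0n. Qed.

Let mean_bound (f a : nat -> R) (c : pred nat) i :
  (forall j, 0 <= a j) -> (forall j, 2 * a j.+1 <= a j) ->
  (forall j, c j -> (i <= j)%N) ->
  (forall j, ~~ c j -> f j = 0) -> (forall j, c j -> `|f j| <= a j) ->
  `|n%:R^-1 * \sum_(j <- iota 0 n) f j| <= 2 * a i / n%:R.
Proof.
move=> a0 a2 ci f0 fa; rewrite normrM ger0_norm ?invr_ge0 ?(ltW n0R)//.
rewrite [leLHS]mulrC; apply: ler_wpM2r; first by rewrite invr_ge0 ltW.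
apply: le_trans (geometric_tail n a0 a2 ci).
apply: le_trans (ler_norm_sum _ _ _) _; apply: ler_sum => j _.
by case: ifPn => [/fa//|/f0 ->]; rewrite normr0.
Qed.

Let inv_doubling (b : nat -> R) : (forall j, 0 < b j) -> (forall j, 2 * b j <= b j.+1) ->
  forall j, 2 * (b j.+1)^-1 <= (b j)^-1.
Proof.
move=> b0 b2 j; rewrite ler_pdivrMr// -ler_pdivrMl ?invr_gt0// invrK mulrC.
exact: b2.
Qed.

Section at_point.
Variables (x : 'rV[R]_N) (t : R).
Hypothesis t0 : 0 <= t.
Let c : pred nat := fun j => 0 < parabola z (rho j) (s j) x t.
Let w j := pos (parabola z (rho j) (s j) x t).

Let w0 j : ~~ c j -> w j = 0.
Proof. by rewrite /c -leNgt => /pos_le0. Qed.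

Let w_ge0 j : 0 <= w j. Proof. exact: pos_ge0. Qed.

Let w_le1 j : w j <= 1. Proof. exact: pos_parabola_le1. Qed.

Let w_bound (a : R) (k j : nat) : 0 <= a -> `|a * w j ^+ k| <= a.
Proof.
move=> a0; rewrite ger0_norm ?mulr_ge0 ?exprn_ge0 ?w_ge0//.
by rewrite ler_piMr// exprn_ile1 ?w_ge0 ?w_le1.
Qed.

Let drift j l : c j -> `|- ((x 0 l - z 0 l) / (2 * rho j ^+ 2))| <= (rho j)^-1.
Proof.
move=> /(parabola_gt0 rho0 s0 t0)[/(_ l) h _].
rewrite normrN normrM (ger0_norm (_ : 0 <= (2 * rho j ^+ 2)^-1)); last first.
  by rewrite invr_ge0 mulr_ge0// sqr_ge0.
rewrite ler_pdivrMr ?mulr_gt0 ?exprn_gt0//.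
apply: le_trans h _; rewrite expr2 [leRHS](_ : _ = 2 * rho j)//.
by field; rewrite gt_eqF.
Qed.

Lemma profile_dt_bound i : (forall j, c j -> (i <= j)%N) ->
  `|profile_dt n rho s z x t| <= 6 / (n%:R * s i).
Proof.
move=> ci.
apply: le_trans (@mean_bound _ (fun j => 3 * (s j)^-1) c i _ _ ci _ _) _.
- by move=> j; rewrite mulr_ge0// invr_ge0 ltW.
- by move=> j; have := inv_doubling s0 s2 j; lra.
- by move=> j /w0; rewrite /w => ->; rewrite expr0n/= !mulr0 mul0r.
- move=> j _; rewrite normrM normrN (ger0_norm (_ : 0 <= (s j)^-1)) ?invr_ge0 ?(ltW (s0 j))//.
  by apply: ler_wpM2r; [rewrite invr_ge0 ltW|exact: w_bound].
- by rewrite invfM [leLHS](_ : _ = 6 * ((n%:R)^-1 * (s i)^-1))//; ring.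
Qed.

Lemma profile_dx_bound i l : (forall j, c j -> (i <= j)%N) ->
  `|profile_dx n rho s z l x t| <= 6 / (n%:R * rho i).
Proof.
move=> ci.
apply: le_trans (@mean_bound _ (fun j => 3 * (rho j)^-1) c i _ _ ci _ _) _.
- by move=> j; rewrite mulr_ge0// invr_ge0 ltW.
- by move=> j; have := inv_doubling rho0 rho2 j; lra.
- by move=> j /w0; rewrite /w => ->; rewrite expr0n/= !mulr0 mul0r.
- move=> j cj; rewrite normrM; apply: ler_pM => //; last exact: drift.
  exact: w_bound.
- by rewrite invfM [leLHS](_ : _ = 6 * ((n%:R)^-1 * (rho i)^-1))//; ring.
Qed.

Lemma profile_dxdx_bound i l : (forall j, c j -> (i <= j)%N) ->
  `|profile_dxdx n rho s z l l x t| <= 18 / (n%:R * rho i ^+ 2).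
Proof.
move=> ci.
(* The two terms of the second derivative contribute $6$ and $3$ times $\rho_j^{-2}$; the geometric
   sum doubles the total. *)
apply: le_trans (@mean_bound _ (fun j => 9 * ((rho j)^-1 ^+ 2)) c i _ _ ci _ _) _.
- by move=> j; rewrite mulr_ge0// sqr_ge0.
- move=> j; have := inv_doubling rho0 rho2 j.
  have : 0 <= (rho j.+1)^-1 by rewrite invr_ge0 ltW.
  by move: (rho j.+1)^-1 (rho j)^-1 => v v' v0 h; nra.
- by move=> j /w0; rewrite /w => ->; rewrite expr0n/= !mulr0 !mul0r addr0.
- move=> j cj; have ri : 0 <= (rho j)^-1 by rewrite invr_ge0 ltW.
  have h1 : `|6 * w j * - ((x 0 l - z 0 l) / (2 * rho j ^+ 2)) *
      - ((x 0 l - z 0 l) / (2 * rho j ^+ 2))| <= 6 * (rho j)^-1 * (rho j)^-1.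
    rewrite normrM; apply: ler_pM => //; last exact: drift.
    rewrite normrM; apply: ler_pM => //; last exact: drift.
    exact: (@w_bound 6 1).
  have h2 : `|3 * w j ^+ 2 * - ((l == l)%:R / (2 * rho j ^+ 2))| <= 3 * (rho j)^-1 ^+ 2.
    rewrite normrM; apply: ler_pM => //.
      exact: w_bound.
    rewrite normrN eqxx mul1r ger0_norm; last first.
      by rewrite invr_ge0 mulr_ge0// sqr_ge0.
    rewrite exprVn lef_pV2 ?posrE ?mulr_gt0 ?exprn_gt0// ler_peMl ?sqr_ge0//.
    by lra.
  apply: le_trans (ler_normD _ _) _.
  by apply: le_trans (lerD h1 h2) _; rewrite expr2; lra.
- by rewrite invfM exprVn [leLHS](_ : _ = 18 * ((n%:R)^-1 * (rho i ^+ 2)^-1))//; ring.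
Qed.

End at_point.

Lemma profile_eq0 x t : (forall j, (j < n)%N -> parabola z (rho j) (s j) x t <= 0) ->
  profile n rho s z x t = 0.
Proof.
move=> h; rewrite /profile big1_seq ?mulr0// => j /=; rewrite mem_iota add0n => /= jn.
by rewrite pos_le0 ?expr0n//; exact: h.
Qed.

(** The index [i] is the smallest scale whose parabola is positive at the point. Every contributing
    scale is at least [i], so the sums over scales are of the size of their [i]-th term. Since
    $\Phi\le1$, surplus powers are dropped to leave $\Phi^{k+1}$ everywhere; $54$ is $36$ from the
    squared gradient plus $18$ from the Hessian. *)
Lemma profile_exprn_bounds T k x t : space_time T (x, t) ->
  let Phi := profile n rho s z in
  let phi := fun x t => Phi x t ^+ k.+3 in
  [/\ phi x t = 0, dt phi x t = 0 & laplacian phi x t = 0] \/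
  exists i, [/\ (i < n)%N, forall l, `|x 0 l - z 0 l| <= 2 * rho i, t <= s i,
    `|dt phi x t| <= k.+3%:R * Phi x t ^+ k.+1 * (6 / (n%:R * s i)) &
    `|laplacian phi x t| <= N%:R * (k.+3%:R ^+ 2 * Phi x t ^+ k.+1 *
       (54 / (n%:R * rho i ^+ 2)))].
Proof.
move=> xt Phi phi; have [/= t0 _] := xt.
have D1 (y : R) : is_derive y 1 (fun y => y ^+ k.+3) (k.+3%:R * y ^+ k.+2) by exact: is_derive_exprn.
have D2 (y : R) : is_derive y 1 (fun y => k.+3%:R * y ^+ k.+2) (k.+3%:R * (k.+2%:R * y ^+ k.+1)).
  exact: is_derive_eq (is_deriveZ _ (is_derive_exprn k.+1 y)) _.
have C2 : continuous (fun y : R => k.+3%:R * (k.+2%:R * y ^+ k.+1)).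
  by move=> y; do 2 (apply: cvgM; first exact: cvg_cst); exact: exprn_continuous.
have J := jet_comp D1 D2 C2 (jet_profile n rho s z T).
rewrite (jet_dt J xt) (jet_laplacian J xt) /phi -/Phi => {D1 D2 C2 J phi}.
have Phi0 : 0 <= Phi x t by exact: profile_ge0.
have Phi1 : Phi x t <= 1 by exact: profile_le1.
have [c|h] := pselect (exists j, (j < n)%N && (0 < parabola z (rho j) (s j) x t)); last first.
  left; have -> : Phi x t = 0.
    apply: profile_eq0 => j jn; rewrite leNgt; apply/negP => wj.
    by apply: h; exists j; rewrite jn.
  rewrite !exprS !mul0r mulr0 mul0r; split => //.
  by rewrite big1// => i _; rewrite !mulr0 !mul0r addr0.
right; have [i /andP[ni ci] mini] := ex_minnP c.
have {}mini j : 0 < parabola z (rho j) (s j) x t -> (i <= j)%N.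
  by move=> wj; have [jn|/(leq_trans ni)/ltnW//] := ltnP j n; apply: mini; rewrite jn.
have [xi ti] := parabola_gt0 rho0 s0 t0 ci.
have r0 : 0 < n%:R * rho i ^+ 2 by rewrite mulr_gt0 ?exprn_gt0.
have Pk e : 0 <= Phi x t ^+ e by rewrite exprn_ge0.
have k3 : 0 <= k.+3%:R * Phi x t ^+ k.+1 by exact: mulr_ge0.
have Phi2 : `|k.+3%:R * Phi x t ^+ k.+2| <= k.+3%:R * Phi x t ^+ k.+1.
  rewrite (ger0_norm (mulr_ge0 (ler0n _ _) (Pk _))); apply: ler_wpM2l => //.
  by rewrite exprS ler_piMl.
exists i; split => //.
  by rewrite normrM; apply: ler_pM => //; exact: profile_dt_bound.
apply: le_trans (ler_norm_sum _ _ _) _.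
rewrite (_ : N%:R * ?[X] = \sum_(l < N) ?X); last by rewrite big_const_ord iter_addr_0 mulr_natl.
apply: ler_sum => l _.
have h1 : `|k.+3%:R * (k.+2%:R * Phi x t ^+ k.+1) * profile_dx n rho s z l x t *
    profile_dx n rho s z l x t| <= k.+3%:R ^+ 2 * Phi x t ^+ k.+1 * (36 / (n%:R * rho i ^+ 2)).
  rewrite -mulrA normrM; apply: ler_pM => //.
    rewrite mulrA (ger0_norm (mulr_ge0 (mulr_ge0 (ler0n _ _) (ler0n _ _)) (Pk _))).
    apply: ler_wpM2r => //.
    by rewrite expr2; apply: ler_wpM2l => //; rewrite ler_nat.
  rewrite normrM.
  have b := profile_dx_bound t0 l mini.
  apply: le_trans (ler_pM _ _ b b) _ => //.
  rewrite [leLHS](_ : _ = 36 / (n%:R ^+ 2 * rho i ^+ 2)); last first.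
    by field; rewrite !gt_eqF.
  rewrite ler_pM2l// lef_pV2 ?posrE ?mulr_gt0 ?exprn_gt0// ler_pM2r ?exprn_gt0//.
  by rewrite -natrX ler_nat -[leqLHS]expn1 leq_pexp2l.
have h2 : `|k.+3%:R * Phi x t ^+ k.+2 * profile_dxdx n rho s z l l x t| <=
    k.+3%:R ^+ 2 * Phi x t ^+ k.+1 * (18 / (n%:R * rho i ^+ 2)).
  rewrite normrM; apply: ler_pM => //; last exact: profile_dxdx_bound.
  apply: le_trans Phi2 _; rewrite expr2 -mulrA ler_peMl//.
  by rewrite -[1]/(1%:R) ler_nat.
apply: le_trans (ler_normD _ _) _; apply: le_trans (lerD h1 h2) _.
by rewrite -mulrDr -mulrDl; apply: ler_wpM2l; [rewrite mulr_ge0 ?exprn_ge0|lra].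
Qed.

End profile_bounds.

End barrier.

(** * Absorption into $u^p\varphi$ and the energy bound *)

Section energy.
Context {R : realType} {N : nat}.
Local Notation leb := (@lebesgue_measure R).
Implicit Types (T : \bar R) (x z : 'rV[R]_N) (t r s : R) (u : 'rV[R]_N -> R -> R).

(** A form of Young's inequality, by comparing $s$ with the threshold $(4a)^{p/(p-q)}$: below it the
    last term dominates, above it $4a\le s^{(p-q)/p}$ and the first term dominates. *)
Lemma young_absorption (a s q p : R) : 0 < q -> q < p -> 0 <= s -> 0 <= a ->
  s `^ (q / p) * a <= s / 4 + (4 * a) `^ (p / (p - q)).
Proof.
move=> q0 qp s0 a0; have p0 : 0 < p by exact: lt_trans qp.
have pq : 0 < p - q by rewrite subr_gt0.
have b0 : 0 <= 4 * a by rewrite mulr_ge0.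
have [h|h] := leP s ((4 * a) `^ (p / (p - q))).
  have : s `^ (q / p) <= ((4 * a) `^ (p / (p - q))) `^ (q / p).
    by apply: ge0_ler_powR => //; rewrite ?nnegrE ?powR_ge0// divr_ge0 ?ltW.
  rewrite -powRrM (_ : p / (p - q) * (q / p) = p / (p - q) - 1); last first.
    by field; rewrite !gt_eqF.
  move=> /(ler_wpM2r a0) /le_trans; apply.
  have : 4 * a * (4 * a) `^ (p / (p - q) - 1) = (4 * a) `^ (p / (p - q)).
    by apply: mulr_powRB1 => //; rewrite divr_gt0.
  move: ((4 * a) `^ (p / (p - q) - 1)) (powR_ge0 (4 * a) (p / (p - q) - 1)) => v v0 <-.
  by nra.
have : 4 * a <= s `^ ((p - q) / p).
  have : ((4 * a) `^ (p / (p - q))) `^ ((p - q) / p) <= s `^ ((p - q) / p).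
    by apply: ge0_ler_powR; rewrite ?nnegrE ?powR_ge0 ?divr_ge0 ?(ltW h)// ?ltW.
  rewrite -powRrM (_ : p / (p - q) * ((p - q) / p) = 1) ?powRr1//.
  by field; rewrite !gt_eqF.
move=> /(ler_wpM2l (powR_ge0 s (q / p))).
rewrite -powRD; last first.
  by apply/implyP => _; apply: contraTneq h => ->; rewrite -leNgt powR_ge0.
rewrite (_ : q / p + (p - q) / p = 1); last by field; rewrite gt_eqF.
rewrite powRr1// => h'; have := powR_ge0 (4 * a) (p / (p - q)); lra.
Qed.

(** Differentiation lowers the power of the cutoff from $k+3$ to $k+1$. The condition on [k] says
    $(k+3)q/p\le k+1$, so what is left still dominates the power needed for absorption. *)
Lemma powR_times_cutoff (y v q p : R) k : 0 <= y -> 0 <= v <= 1 -> 0 < q -> q < p ->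
  2 * p / (p - q) <= k.+3%:R ->
  y `^ q * v ^+ k.+1 <= (y `^ p * v ^+ k.+3) `^ (q / p).
Proof.
move=> y0 /andP[v0 v1] q0 qp kp; have p0 : 0 < p by exact: lt_trans qp.
rewrite powRM ?powR_ge0 ?exprn_ge0// -powRrM (_ : p * (q / p) = q); last first.
  by field; rewrite gt_eqF.
apply: ler_wpM2l; first exact: powR_ge0.
move: v0; rewrite le_eqVlt => /predU1P[<-|v0]; first by rewrite expr0n powR_ge0.
rewrite -!powR_mulrn ?(ltW v0)// -powRrM; apply: ger_powR; first by rewrite v0.
rewrite mulrA ler_pdivrMr//.
rewrite ler_pdivrMr ?subr_gt0// in kp.
move: kp; rewrite -[k.+3%:R]/((2 + k.+1)%:R) natrD => kp; lra.
Qed.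

Section barrier_energy.
Variables (n k : nat) (rho s : nat -> R) (z : 'rV[R]_N).
Hypothesis n0 : (0 < n)%N.
Hypothesis rho0 : forall j, 0 < rho j.
Hypothesis s0 : forall j, 0 < s j.
Hypothesis rho2 : forall j, 2 * rho j <= rho j.+1.
Hypothesis s2 : forall j, 2 * s j <= s j.+1.

Definition barrier (x : 'rV[R]_N) (t : R) : R := profile n rho s z x t ^+ k.+3.

Definition shell_box i : set ('rV[R]_N * R) :=
  [set y : 'rV[R]_N * R | (forall l, z 0 l - 2 * rho i <= y.1 0 l <= z 0 l + 2 * rho i)
     /\ 0 <= y.2 <= s i].

Let a i : 'rV[R]_N := \row_l (z 0 l - 2 * rho i).
Let b i : 'rV[R]_N := \row_l (z 0 l + 2 * rho i).

Let shell_boxE i : shell_box i =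
  [set x : 'rV[R]_N | forall l, a i 0 l <= x 0 l <= b i 0 l] `*` `[0, s i]%classic.
Proof.
apply/seteqP; split => -[x t] /= [h1 h2]; split.
- by move=> l; rewrite !mxE.
- by rewrite in_itv.
- by move=> l; have := h1 l; rewrite !mxE.
- by move: h2; rewrite in_itv.
Qed.

Lemma lam_shell_box i : lam R N (shell_box i) = ((4 * rho i) ^+ N * s i)%:E.
Proof.
rewrite shell_boxE product_measure1E//; last exact: measurable_box_rV.
rewrite EFinM; congr (_ * _)%E.
  apply: etrans (lebesgue_rV_box _) _; first by move=> l; rewrite !mxE; have := rho0 i; lra.
  rewrite (eq_bigr (fun=> 4 * rho i)); last by move=> l _; rewrite !mxE; ring.
  by rewrite prodr_const card_ord.
by rewrite [LHS](lebesgue_measure_itv `[0, s i])/= lte_fin s0 -EFinB subr0.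
Qed.

Lemma measurable_shell_box i : measurable (shell_box i).
Proof. by rewrite shell_boxE; apply: measurableX => //; exact: measurable_box_rV. Qed.

(** The residues of [young_absorption] for the time derivative ($q=1$) and for the Laplacian
    ($q=m$): $24=4\cdot6$ and $216=4\cdot54$, where $4$ comes from the inequality and the other
    factors from [profile_exprn_bounds]. *)
Definition shell_cost (m p : R) i : R :=
  (24 * k.+3%:R / (n%:R * s i)) `^ (p / (p - 1)) +
  (216 * N%:R * k.+3%:R ^+ 2 / (n%:R * rho i ^+ 2)) `^ (p / (p - m)).

Lemma shell_cost_ge0 m p i : 0 <= shell_cost m p i.
Proof. by rewrite addr_ge0 ?powR_ge0. Qed.

(** Each of the two derivative terms is at most a quarter of $u^p\varphi$ plus its residue, and the
    term $-u^p\varphi$ pays for both quarters. Summing over all shells spares a measurable choice of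
    the active one. *)
Lemma barrier_integrand_le (m p : R) T u x t : 1 <= m -> m < p ->
  2 * p / (p - m) <= k.+3%:R -> space_time T (x, t) -> 0 <= u x t ->
  weak_integrand m p u barrier x t <=
    \sum_(i < n) shell_cost m p i * \1_(shell_box i) (x, t).
Proof.
move=> hm hmp kp xt u0; have [/= t0 _] := xt.
have p1 : 1 < p by exact: le_lt_trans hmp.
have p1' : 0 < p - 1 by rewrite subr_gt0.
have pm : 0 < p - m by rewrite subr_gt0.
rewrite /weak_integrand.
have [[b0 d0 l0]|[i [ni xi ti]]] := profile_exprn_bounds z n0 rho0 s0 rho2 s2 k xt.
  rewrite (b0 : barrier x t = 0) (d0 : dt barrier x t = 0) (l0 : laplacian barrier x t = 0).
  rewrite !mulr0 !subr0; apply: sumr_ge0 => i _.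
  by rewrite mulr_ge0 ?shell_cost_ge0// indicE.
rewrite -/barrier.
set v := profile n rho s z x t; set d := dt _ x t; set l := laplacian _ x t => hd hl.
have v0 : 0 <= v by exact: profile_ge0.
have v1 : v <= 1 by exact: profile_le1.
have v01 : 0 <= v <= 1 by rewrite v0.
have w0 : 0 <= u x t `^ p * v ^+ k.+3 by rewrite mulr_ge0 ?powR_ge0 ?exprn_ge0.
have a10 : 0 <= k.+3%:R * (6 / (n%:R * s i)) by rewrite mulr_ge0// divr_ge0 ?mulr_ge0// ltW.
have a20 : 0 <= N%:R * (k.+3%:R ^+ 2 * (54 / (n%:R * rho i ^+ 2))).
  by rewrite mulr_ge0// mulr_ge0 ?exprn_ge0// divr_ge0 ?mulr_ge0 ?exprn_ge0// ltW.
have kp1 : 2 * p / (p - 1) <= k.+3%:R.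
  apply: le_trans kp; apply: ler_wpM2l; first by lra.
  by rewrite lef_pV2 ?posrE//; lra.
have b1 := ler_wpM2r a10 (powR_times_cutoff u0 v01 ltr01 p1 kp1).
have b2 := ler_wpM2r a20 (powR_times_cutoff u0 v01 (lt_le_trans ltr01 hm) hmp kp).
have y1 := le_trans b1 (young_absorption ltr01 p1 w0 a10).
have y2 := le_trans b2 (young_absorption (lt_le_trans ltr01 hm) hmp w0 a20).
rewrite powRr1// in y1.
have in_i : \1_(shell_box i) (x, t) = 1 :> R.
  rewrite indicE mem_set//; split => /=; last by rewrite t0.
  by move=> j; have := xi j; rewrite ler_norml => /andP[]; lra.
apply: le_trans (_ : shell_cost m p i <= _); last first.
  rewrite (bigD1 (Ordinal ni))//= in_i mulr1 lerDl; apply: sumr_ge0 => j _.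
  by rewrite mulr_ge0 ?shell_cost_ge0// indicE.
have -> : shell_cost m p i = (4 * (k.+3%:R * (6 / (n%:R * s i)))) `^ (p / (p - 1)) +
  (4 * (N%:R * (k.+3%:R ^+ 2 * (54 / (n%:R * rho i ^+ 2))))) `^ (p / (p - m)).
  by rewrite /shell_cost; congr (_ `^ _ + _ `^ _); ring.
have c1 : - u x t * d <= u x t * v ^+ k.+1 * (k.+3%:R * (6 / (n%:R * s i))).
  rewrite mulNr -mulrN -mulrA; apply: ler_wpM2l => //.
  apply: le_trans (ler_norm _) _; rewrite normrN; apply: le_trans hd _.
  by rewrite le_eqVlt; apply/orP; left; apply/eqP; ring.
have c2 : - (u x t `^ m * l) <= u x t `^ m * v ^+ k.+1 *
    (N%:R * (k.+3%:R ^+ 2 * (54 / (n%:R * rho i ^+ 2)))).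
  rewrite -mulrN -mulrA; apply: ler_wpM2l; first exact: powR_ge0.
  apply: le_trans (ler_norm _) _; rewrite normrN; apply: le_trans hl _.
  by rewrite le_eqVlt; apply/orP; left; apply/eqP; ring.
rewrite -/v; move: y1 y2 c1 c2 w0; rewrite /barrier -/v.
by move: (_ `^ (p / (p - 1))) (_ `^ (p / (p - m))) => *; lra.
Qed.

Let rho_mono i j : (i <= j)%N -> rho i <= rho j.
Proof.
apply: (homo_leq (@lexx _ R) (@le_trans _ R)) => l.
by apply: le_trans (rho2 l); have := rho0 l; lra.
Qed.

Let s_mono i j : (i <= j)%N -> s i <= s j.
Proof.
apply: (homo_leq (@lexx _ R) (@le_trans _ R)) => l.
by apply: le_trans (s2 l); have := s0 l; lra.
Qed.

Lemma barrier_C21c T : (0 < T)%E -> ((s n.-1)%:E < T)%E -> C21c T barrier.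
Proof.
move=> T0 sT; apply: (iffRL (C21cP _ T0)); split.
  have D1 (y : R) : is_derive y 1 (fun y => y ^+ k.+3) (k.+3%:R * y ^+ k.+2) by exact: is_derive_exprn.
  have D2 (y : R) : is_derive y 1 (fun y => k.+3%:R * y ^+ k.+2) (k.+3%:R * (k.+2%:R * y ^+ k.+1)).
    exact: is_derive_eq (is_deriveZ _ (is_derive_exprn k.+1 y)) _.
  have C2 : continuous (fun y : R => k.+3%:R * (k.+2%:R * y ^+ k.+1)).
    by move=> y; do 2 (apply: cvgM; first exact: cvg_cst); exact: exprn_continuous.
  exact: (jet_C21 (jet_comp D1 D2 C2 (jet_profile n rho s z T))).
have r0 : 0 <= `|z| + 2 * rho n.-1 by rewrite addr_ge0// mulr_ge0// ltW.
exists (`|z| + 2 * rho n.-1), (s n.-1); split => //; first exact: ltW.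
move=> x t [/= t0 tT] nK; rewrite /barrier profile_eq0 ?expr0n// => j jn.
rewrite leNgt; apply/negP => wj; apply: nK.
have jn' : (j <= n.-1)%N by rewrite -ltnS prednK.
have [xj tj] := parabola_gt0 rho0 s0 t0 wj.
split => /=; last by rewrite t0 (le_trans tj)// s_mono.
apply/(normrV_leP _ r0) => l.
rewrite -[x 0 l](subrK (z 0 l)) addrC; apply: le_trans (ler_normD _ _) _.
apply: lerD; first exact: coord_le_norm.
by apply: le_trans (xj l) _; rewrite ler_pM2l// rho_mono.
Qed.

(** Integrating the pointwise bound gives an estimate that involves neither [u] nor [tau]. *)
Lemma barrier_energy (m p tau : R) T u : 1 <= m -> m < p ->
  2 * p / (p - m) <= k.+3%:R -> (0 < T)%E -> ((s n.-1)%:E < T)%E ->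
  Lp_loc p T u -> ae_nonneg T u -> 0 <= tau ->
  (weak_form m p T u barrier tau <=
   (\sum_(i < n) shell_cost m p i * ((4 * rho i) ^+ N * s i))%:E)%E.
Proof.
move=> hm hmp kp T0 sT Lu u0 tau0.
have Cb := barrier_C21c T0 sT.
have mS := @measurable_slab R N tau T.
pose G y := (\sum_(i < n) shell_cost m p i * \1_(shell_box i) y : R)%:E.
have cost0 i y : 0 <= shell_cost m p i * \1_(shell_box i) y.
  by rewrite mulr_ge0 ?shell_cost_ge0// indicE.
have G0 y : (0 <= G y)%E by rewrite lee_fin sumr_ge0.
have m1 (i : 'I_n) : measurable_fun (slab tau T) (fun y : 'rV[R]_N * R =>
    (shell_cost m p i * \1_(shell_box i) y)%:E).
  apply/measurable_EFinP; apply: measurable_funM => //.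
  exact: measurable_indic (measurable_shell_box i).
have mG : measurable_fun (slab tau T) G.
  rewrite /G; under eq_fun do rewrite -sumEFin.
  exact: emeasurable_sum.
rewrite weak_formE//.
set F := fun y => _.
have iF : (lam R N).-integrable (slab tau T) F.
  apply: integrableS (weak_integrand_integrable hm hmp T0 Lu Cb).
  - exact: measurable_space_time.
  - exact: mS.
  - exact: slab_space_time.
have mF := measurable_int _ iF.
(* The comparison that holds only almost everywhere is applied to nonnegative functions, so the
   integrand is first replaced by its positive part. *)
apply: le_trans (_ : \int[lam R N]_(y in slab tau T) F^\+ y <= _)%E.
  rewrite integralE; rewrite -[leRHS]adde0; apply: leeD => //.
  by rewrite oppe_le0; exact: integral_ge0.
apply: le_trans (_ : \int[lam R N]_(y in slab tau T) G y <= _)%E.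
  apply: (@ae_ge0_le_integral _ _ _ (lam R N) _ mS) => //.
    exact: measurable_funepos.
  apply: negligibleS u0 => y; apply: contra_not => uy yS.
  have yT := slab_space_time tau0 yS.
  rewrite funeposE ge_max G0 andbT lee_fin; case: y yT yS uy => x t xt [/= t0 tT] uy.
  apply: (barrier_integrand_le hm hmp kp xt).
  by apply: uy => //=; exact: le_lt_trans t0.
rewrite /G; under eq_integral do rewrite -sumEFin.
rewrite (@ge0_integral_sum _ _ _ (lam R N) _ mS _ _ m1)//; last first.
  by move=> i y _; rewrite lee_fin.
rewrite -sumEFin; apply: lee_sum => i _.
under eq_integral do rewrite EFinM.
rewrite (@ge0_integralZl _ _ _ (lam R N) _ mS)//.
- rewrite (@integral_indic _ _ _ (lam R N) _ mS); last exact: measurable_shell_box.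
  rewrite EFinM -lam_shell_box.
  apply: lee_wpmul2l; first by rewrite lee_fin shell_cost_ge0.
  apply: le_measure; rewrite ?inE; last exact: subIsetl.
    by apply: measurableI => //; exact: measurable_shell_box.
  exact: measurable_shell_box.
- by apply/measurable_EFinP; exact: measurable_indic (measurable_shell_box i).
- by rewrite lee_fin shell_cost_ge0.
Qed.

End barrier_energy.

End energy.

(** * From the energy bound to the measure of balls *)

Section trace_bound.
Context {R : realType} {N : nat}.
Local Notation leb := (@lebesgue_measure R).
Implicit Types (T : \bar R) (x z : 'rV[R]_N) (t r s : R) (u : 'rV[R]_N -> R -> R).

Lemma measurable_sqr_dist z : measurable_fun setT (fun x : 'rV[R]_N => sqr_dist z x).
Proof.
apply: measurable_sum => l; apply: measurable_funX; apply: measurable_funB => //.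
exact: measurable_coord_mx.
Qed.

Lemma measurable_barrier n k (rho s : nat -> R) z t :
  measurable_fun setT (fun x : 'rV[R]_N => barrier n k rho s z x t).
Proof.
apply: measurable_funX; apply: measurable_funM => //; apply: measurable_sum => j.
apply: measurable_funX.
apply: (@measurableT_comp _ _ _ _ _ _ (@pos R)).
  by apply: continuous_measurable_fun; exact: continuous_pos.
apply: measurable_funB => //; apply: measurable_funB => //.
by apply: measurable_funM => //; exact: measurable_sqr_dist.
Qed.

Lemma euclidean_ballE z r : 0 < r -> euclidean_ball z r = [set x | sqr_dist z x < r ^+ 2].
Proof.
move=> r0; apply/seteqP; split => x; rewrite /euclidean_ball /euclidean_norm /=.
  rewrite -{1}[r]gtr0_norm// -sqrtr_sqr ltr_sqrt ?exprn_gt0// /sqr_dist.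
  by under eq_bigr do rewrite !mxE.
rewrite -{2}[r]gtr0_norm// -sqrtr_sqr ltr_sqrt ?exprn_gt0// /sqr_dist.
by under [in X in _ -> X]eq_bigr do rewrite !mxE.
Qed.

(** The factor $4$ makes the bump at least $1$ on the ball: there the positive part is at least
    $3/4$, and $4\cdot(3/4)^3=27/16$. *)
Definition ball_bump z r x : R := 4 * pos (1 - sqr_dist z x / (4 * r ^+ 2)) ^+ 3.

Lemma C2c_ball_bump z r : 0 < r -> C2c (ball_bump z r).
Proof.
move=> r0; have r4 : 0 < 4 * r ^+ 2 by rewrite mulr_gt0// exprn_gt0.
have D2 (y : R) : is_derive y 1 (fun y => 3 * pos y ^+ 2) (6 * pos y).
  apply: is_derive_eq (is_deriveZ 3 (is_derive_pos2 y)) _.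
  by rewrite /GRing.scale/=; ring.
split.
  have J := jetZ 4 (jet_comp (@is_derive_pos3 R) D2 (@continuous_mulr_pos R 6)
    (jetD (jet_cst +oo%E 1) (jetZ (- (4 * r ^+ 2)^-1) (jet_sqr_dist +oo%E z)))).
  apply: C21_ext (jet_C21 J) => x t; rewrite /ball_bump.
  by congr (_ * pos _ ^+ _); ring.
exists (`|z| + 2 * r) => [|x xr]; first by rewrite addr_ge0// mulr_ge0// ltW.
have q0 : 0 <= `|z| + 2 * r by rewrite addr_ge0// mulr_ge0// ltW.
rewrite /ball_bump pos_le0 ?expr0n ?mulr0//= subr_le0 ler_pdivlMr// mul1r.
rewrite leNgt; apply/negP => h; move: xr; rewrite ltNge => /negP; apply.
apply/(normrV_leP _ q0) => l.
rewrite -[x 0 l](subrK (z 0 l)) addrC; apply: le_trans (ler_normD _ _) _.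
apply: lerD; first exact: coord_le_norm.
rewrite -(@ler_pXn2r _ 2)// ?nnegrE ?mulr_ge0 ?(ltW r0)//.
rewrite real_normK ?num_real// exprMn.
by apply: le_trans (coord_le_sqr_dist z x l) _; lra.
Qed.

Lemma ball_bump_ge0 z r x : 0 <= ball_bump z r x.
Proof. by rewrite mulr_ge0// exprn_ge0// pos_ge0. Qed.

Lemma ball_bump_ge1 z r x : 0 < r -> sqr_dist z x < r ^+ 2 -> 1 <= ball_bump z r x.
Proof.
move=> r0 h; rewrite /ball_bump.
have r4 : 0 < 4 * r ^+ 2 by rewrite mulr_gt0// exprn_gt0.
have q : sqr_dist z x / (4 * r ^+ 2) <= 1 / 4 by rewrite ler_pdivrMr//; lra.
have h' : 3 / 4 <= pos (1 - sqr_dist z x / (4 * r ^+ 2)).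
  by rewrite /pos le_max; apply/orP; left; lra.
have : (3 / 4) ^+ 3 <= pos (1 - sqr_dist z x / (4 * r ^+ 2)) ^+ 3.
  by apply: lerXn2r => //; rewrite nnegrE ?pos_ge0.
rewrite (_ : (3 / 4 : R) ^+ 3 = 27 / 64); last by field.
lra.
Qed.

Section ball_bound.
Variables (n k : nat) (rho s : nat -> R) (z : 'rV[R]_N).
Hypothesis n0 : (0 < n)%N.
Hypothesis rho0 : forall j, 0 < rho j.
Hypothesis s0 : forall j, 0 < s j.
Hypothesis rho2 : forall j, 2 * rho j <= rho j.+1.
Hypothesis s2 : forall j, 2 * s j <= s j.+1.

Let nondecreasing_of_doubling (b : nat -> R) : (forall j, 0 < b j) ->
  (forall j, 2 * b j <= b j.+1) -> forall j, b 0%N <= b j.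
Proof.
move=> b0 b2 j; apply: (homo_leq (@lexx _ R) (@le_trans _ R)) (leq0n j) => l.
by apply: le_trans (b2 l); have := b0 l; lra.
Qed.

(** Where the bump is positive, $|x-z|\le2r\le\rho_j$ for all $j$; with $4t\le s_j$ every parabola
    is at least $1-1/4-1/4$. Hence the profile is at least $1/8$, while the bump is at most $4$. *)
Lemma ball_bump_le_barrier r t x : 0 < r -> 2 * r <= rho 0%N -> 0 <= t -> 4 * t <= s 0%N ->
  ball_bump z r x <= 4 * 8 ^+ k.+3 * barrier n k rho s z x t.
Proof.
move=> r0 rr t0 ts.
have r4 : 0 < 4 * r ^+ 2 by rewrite mulr_gt0// exprn_gt0.
have P0 : 0 <= profile n rho s z x t by exact: profile_ge0.
have [d|d] := leP (1 - sqr_dist z x / (4 * r ^+ 2)) 0.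
  rewrite /ball_bump pos_le0// expr0n/= mulr0; apply: mulr_ge0; last exact: exprn_ge0.
  by apply: mulr_ge0 => //; exact: exprn_ge0.
have {d}d : sqr_dist z x <= 4 * r ^+ 2.
  by move: d; rewrite subr_gt0 ltr_pdivrMr// mul1r => /ltW.
have wj j : 1 / 2 <= parabola z (rho j) (s j) x t.
  have rj := nondecreasing_of_doubling rho0 rho2 j.
  have sj := nondecreasing_of_doubling s0 s2 j.
  have rj2 : (2 * r) ^+ 2 <= rho j ^+ 2.
    by apply: lerXn2r; rewrite ?nnegrE ?(ltW (rho0 j)) ?mulr_ge0 ?(ltW r0)//; exact: le_trans rj.
  have q1 : sqr_dist z x / (4 * rho j ^+ 2) <= 1 / 4.
    rewrite ler_pdivrMr; last by rewrite mulr_gt0// exprn_gt0.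
    by rewrite exprMn in rj2; lra.
  have q2 : t / s j <= 1 / 4 by rewrite ler_pdivrMr//; lra.
  by rewrite /parabola; lra.
have P8 : 8^-1 <= profile n rho s z x t.
  rewrite /profile mulrC ler_pdivlMr ?ltr0n// mulrC.
  apply: le_trans (_ : \sum_(j <- iota 0 n) 8^-1 <= _).
    by rewrite big_const_seq count_predT size_iota iter_addr_0 mulr_natl.
  apply: ler_sum => j _; rewrite (_ : 8^-1 = (1 / 2) ^+ 3); last by field.
  apply: lerXn2r; rewrite ?nnegrE ?pos_ge0 ?divr_ge0//.
  by rewrite /pos le_max wj.
apply: le_trans (_ : 4 <= _).
  rewrite /ball_bump -[leRHS]mulr1 ler_pM2l//.
  apply: exprn_ile1; first exact: pos_ge0.
  by rewrite /pos ge_max ler01 andbT gerBl divr_ge0// ?sqr_dist_ge0// ltW.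
rewrite -[leLHS]mulr1 -mulrA ler_pM2l// /barrier -exprMn.
apply: exprn_ege1; rewrite -ler_pdivrMl//; lra.
Qed.

(** The bump is independent of time, so its pairings converge to the integral against [nu]. At small
    good times it lies below a multiple of the barrier, whose pairing equals the weak form and obeys
    [barrier_energy]. *)
Lemma trace_ball_le (m p T r : R) u (nu : {measure set 'rV[R]_N -> \bar R}) :
  1 <= m -> m < p -> 2 * p / (p - m) <= k.+3%:R -> 0 < r -> 2 * r <= rho 0%N ->
  s n.-1 < T -> solution_E m p T%:E u -> initial_trace u nu ->
  (nu (euclidean_ball z r) <= (4 * 8 ^+ k.+3 *
    \sum_(i < n) @shell_cost R N n k rho s m p i * ((4 * rho i) ^+ N * s i))%:E)%E.
Proof.
move=> hm hmp kp r0 rr sT E [_ tr].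
have T0 : (0 < T%:E)%E by rewrite lte_fin; apply: lt_trans sT.
have Cpsi := C2c_ball_bump z r0.
have [Z nZ cZ] := tr _ (C2c_continuous Cpsi) (C2c_compactly_supported Cpsi).
have gt := solution_E_good_times hm hmp T0 E.
have [Lu u0 wf] := E.
have Cb : C21c T%:E (barrier n k rho s z) by exact: barrier_C21c.
have {}wf := wf _ Cb.
set M := \sum_(i < n) _.
pose W := Z `|` ([set t | ~ (0 < t -> (t%:E < T%:E)%E -> good_time u t)] `|`
  [set t | ~ (0 < t -> (t%:E < T%:E)%E ->
    weak_form m p T%:E u (barrier n k rho s z) t =
    (\int[lebesgue_rV R N]_x (u x t * barrier n k rho s z x t)%:E)%E)]).
have nW : leb.-negligible W by do 2 apply: negligibleU => //.
have PW := negligible_proper nW.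
have {}cZ : (\int[lebesgue_rV R N]_x (u x t * ball_bump z r x)%:E)%E
    @[t --> within (~` W) (0 : R)^'+] --> (\int[nu]_x (ball_bump z r x)%:E)%E.
  by move=> A /cZ; apply: within_sub; exact: subsetUl.
apply: le_trans (_ : \int[nu]_x (ball_bump z r x)%:E <= _)%E.
  have mB : measurable (euclidean_ball z r).
    rewrite (_ : euclidean_ball z r = setT `&` sqr_dist z @^-1` `]-oo, r ^+ 2[%classic).
      by apply: measurable_sqr_dist => //; exact: measurable_itv.
    by rewrite euclidean_ballE// setTI; apply/seteqP; split => x /=; rewrite in_itv.
  rewrite -[X in nu X]setIT -integral_indic//.
  apply: ge0_le_integral => //.
  - by apply/measurable_EFinP; exact: measurable_indic.
  - by apply/measurable_EFinP; exact: continuous_measurable_rV (C2c_continuous Cpsi).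
  - move=> x _; rewrite lee_fin indicE; case: (boolP (x \in _)) => [|_]; last exact: ball_bump_ge0.
    by rewrite inE euclidean_ballE// => h; exact: ball_bump_ge1.
apply: (cvge_to_le cZ).
have H1 : \forall t \near within (~` W) (0 : R)^'+, good_time u t.
  by apply: near_good_time T0 _ => t h; right; left.
have H2 : \forall t \near within (~` W) (0 : R)^'+, weak_form m p T%:E u (barrier n k rho s z) t =
    (\int[lebesgue_rV R N]_x (u x t * barrier n k rho s z x t)%:E)%E.
  by apply: near_good_time T0 _ => t h; right; right.
have H3 : \forall t \near within (~` W) (0 : R)^'+, [/\ 0 <= t, 4 * t <= s 0%N & (t%:E < T%:E)%E].
  have H : \forall t \near (0 : R)^'+, [/\ 0 <= t, 4 * t <= s 0%N & (t%:E < T%:E)%E].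
    near=> t; split.
    - by near: t; exact: nbhs_right_ge.
    - rewrite -ler_pdivlMl// mulrC; near: t; apply: nbhs_right_le.
      by rewrite divr_gt0.
    - by rewrite lte_fin; near: t; apply: nbhs_right_lt.
  by rewrite near_withinE; apply: (filterS _ H).
apply: (filterS3 _ _ H1 H2 H3) => t [mt ut it] wt [t0 ts tT].
have [_ [r1 [s1 [_ _ _ van]]]] := (iffLR (C21cP _ T0)) Cb.
have bb : bounded_support (fun x => barrier n k rho s z x t).
  split; first exact: measurable_barrier.
  exists (Num.max r1 0), 1; split => //; first by rewrite le_max lexx orbT.
    move=> x; rewrite ger0_norm ?exprn_ge0 ?profile_ge0//.
    by apply: exprn_ile1; [exact: profile_ge0|exact: profile_le1].
  move=> x; rewrite gt_max => /andP[r1x _]; apply: van => //=.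
  by move=> [/= xr _]; move: r1x; rewrite ltNge xr.
have bpsi := C2c_bounded_support Cpsi.
pose c : R := 4 * 8 ^+ k.+3.
(* Written as a sum to fit the shape of [pairingDZ]. *)
have E1 : (fun x => c * barrier n k rho s z x t) =
    (fun x => barrier n k rho s z x t + (c - 1) * barrier n k rho s z x t).
  by apply/funext => x; ring.
have bc : bounded_support (fun x => c * barrier n k rho s z x t) by exact: bounded_supportZ.
rewrite (pairingE mt it bpsi) lee_fin.
apply: le_trans (pairing_le mt ut it bpsi bc (fun x => ball_bump_le_barrier x r0 rr t0 ts)) _.
rewrite E1 (pairingDZ mt it)//.
have C0 : 0 <= c by rewrite mulr_ge0// exprn_ge0.
have : pairing (lebesgue_rV R N) (u ^~ t) (fun x => barrier n k rho s z x t) <= M.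
  rewrite -lee_fin -(pairingE mt it bb) -wt.
  apply: barrier_energy => //.
by move=> h; have := ler_wpM2l C0 h; rewrite /c; lra.
Unshelve. all: by end_near. Qed.

End ball_bound.

End trace_bound.

(** * Scaling of the cost at dyadic scales *)

Section parameters.
Context {R : realType}.
Implicit Types (m p a b x y : R).

Lemma powR_div x y a : 0 <= x -> 0 < y -> (x / y) `^ a = x `^ a * y `^ (- a).
Proof.
move=> x0 y0; rewrite powRM ?invr_ge0 ?(ltW y0)//; congr (_ * _).
by rewrite -(powR_inv1 (ltW y0)) -powRrM mulN1r.
Qed.

Lemma powRD_gt0 x a b : 0 < x -> x `^ (a + b) = x `^ a * x `^ b.
Proof. by move=> x0; rewrite powRD// (gt_eqF x0) implybT. Qed.

(** The duration $\lambda x^{1/\theta}$ is the one for which both residues, times the volume of the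
    shell box, scale with the same power $x^{N-2/(p-m)}$. The free factor [la] only moves weight
    between the two. *)
Lemma shell_termE (N n k : nat) (rho s : nat -> R) m p la x i :
  (0 < n)%N -> 1 <= m -> m < p -> 0 < la -> 0 < x ->
  rho i = 2 * x -> s i = la * x `^ (2 * (p - 1) / (p - m)) ->
  @shell_cost R N n k rho s m p i * ((4 * rho i) ^+ N * s i) =
  8 ^+ N * x `^ (N%:R - 2 / (p - m)) *
    ((24 * k.+3%:R) `^ (p / (p - 1)) * (n%:R `^ (- (p / (p - 1))) * la `^ (1 - p / (p - 1))) +
     (54 * N%:R * k.+3%:R ^+ 2) `^ (p / (p - m)) * (n%:R `^ (- (p / (p - m))) * la)).
Proof.
move=> n0 hm hmp la0 x0 rhoi si; rewrite /shell_cost rhoi si.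
have n0' : 0 < n%:R :> R by rewrite ltr0n.
have p1 : p - 1 != 0 by rewrite gt_eqF// subr_gt0; lra.
have pm : p - m != 0 by rewrite gt_eqF// subr_gt0.
set be := 2 * (p - 1) / (p - m); set a := p / (p - 1); set b := p / (p - m).
have xb : 0 < x `^ be by exact: powR_gt0.
have vol : (4 * (2 * x)) ^+ N = 8 ^+ N * x ^+ N.
  by rewrite -exprMn; congr (_ ^+ _); ring.
have ea : x `^ (N%:R - 2 / (p - m)) = x `^ (be * - a) * x ^+ N * x `^ be.
  rewrite -(powR_mulrn N (ltW x0)) -!powRD_gt0//; congr (_ `^ _).
  by rewrite /be /a; field; rewrite p1 pm.
have eb : x `^ (N%:R - 2 / (p - m)) = x `^ (2 * - b) * x ^+ N * x `^ be.
  rewrite -(powR_mulrn N (ltW x0)) -!powRD_gt0//; congr (_ `^ _).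
  by rewrite /be /b; field.
have la1 : la `^ (1 - a) = la * la `^ (- a) by rewrite powRD_gt0// powRr1// ltW.
have -> : (24 * k.+3%:R / (n%:R * (la * x `^ be))) `^ a =
    (24 * k.+3%:R) `^ a * (n%:R `^ (- a) * (la `^ (- a) * x `^ (be * - a))).
  rewrite powR_div ?mulr_gt0//; congr (_ * _).
  by rewrite powRM ?(ltW n0')// ?mulr_ge0 ?(ltW la0) ?(ltW xb)// powRM ?(ltW la0) ?(ltW xb)// -powRrM.
have -> : (216 * N%:R * k.+3%:R ^+ 2 / (n%:R * (2 * x) ^+ 2)) `^ b =
    (54 * N%:R * k.+3%:R ^+ 2) `^ b * (n%:R `^ (- b) * x `^ (2 * - b)).
  rewrite (_ : 216 * N%:R * k.+3%:R ^+ 2 / (n%:R * (2 * x) ^+ 2) =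
    54 * N%:R * k.+3%:R ^+ 2 / (n%:R * x ^+ 2)); last by field; rewrite !gt_eqF.
  rewrite powR_div ?mulr_gt0 ?exprn_gt0//.
  by rewrite powRM ?(ltW n0')// ?exprn_ge0 ?(ltW x0)// -(powR_mulrn 2 (ltW x0)) -powRrM.
by rewrite vol la1 [LHS]mulrDl [RHS]mulrDr; congr (_ + _); [rewrite ea|rewrite eb]; ring.
Qed.

Lemma dyadic_powR x be : 0 < x -> 1 <= be ->
  forall j, 2 * (2 ^+ j * x) `^ be <= (2 ^+ j.+1 * x) `^ be.
Proof.
move=> x0 be1 j; have q0 : 0 <= 2 ^+ j * x by rewrite mulr_ge0 ?exprn_ge0 ?ltW.
rewrite exprS -mulrA [leRHS]powRM//; apply: ler_wpM2r; first exact: powR_ge0.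
by apply: le1r_powR => //; lra.
Qed.

Lemma dyadic_trace_bound (N n k : nat) m p T la sigma (u : 'rV[R]_N -> R -> R)
    (nu : {measure set 'rV[R]_N -> \bar R}) z :
  (0 < n)%N -> 1 <= m -> m < p -> 2 * p / (p - m) <= k.+3%:R -> 0 < la -> 0 < sigma ->
  la * (2 ^+ n.-1 * sigma) `^ (2 * (p - 1) / (p - m)) < T ->
  solution_E m p T%:E u -> initial_trace u nu ->
  (nu (euclidean_ball z sigma) <= (4 * 8 ^+ k.+3 * 8 ^+ N *
    ((\sum_(i < n) (2 ^+ i * sigma) `^ (N%:R - 2 / (p - m))) *
    ((24 * k.+3%:R) `^ (p / (p - 1)) * (n%:R `^ (- (p / (p - 1))) * la `^ (1 - p / (p - 1))) +
     (54 * N%:R * k.+3%:R ^+ 2) `^ (p / (p - m)) * (n%:R `^ (- (p / (p - m))) * la))))%:E)%E.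
Proof.
move=> n0 hm hmp kp la0 sg0 sT E tr.
pose x j : R := 2 ^+ j * sigma.
have x0 j : 0 < x j by rewrite mulr_gt0 ?exprn_gt0.
have be1 : 1 <= 2 * (p - 1) / (p - m) by rewrite ler_pdivlMr ?subr_gt0//; lra.
have rho0 j : 0 < 2 * x j by rewrite mulr_gt0.
have s0 j : 0 < la * x j `^ (2 * (p - 1) / (p - m)) by rewrite mulr_gt0// powR_gt0.
have rho2 j : 2 * (2 * x j) <= 2 * x j.+1 by rewrite /x exprS !mulrA.
have s2 j : 2 * (la * x j `^ (2 * (p - 1) / (p - m))) <=
    la * x j.+1 `^ (2 * (p - 1) / (p - m)).
  by rewrite mulrCA ler_pM2l//; exact: dyadic_powR.
have rr : 2 * sigma <= 2 * x 0%N by rewrite /x expr0 mul1r.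
have := trace_ball_le z n0 rho0 s0 rho2 s2 hm hmp kp sg0 rr sT E tr.
move=> /le_trans; apply; rewrite lee_fin -[leRHS]mulrA; apply: ler_wpM2l.
  by rewrite mulr_ge0 ?exprn_ge0.
rewrite mulrA mulr_sumr mulr_suml; apply: ler_sum => i _.
by rewrite (shell_termE N k n0 hm hmp la0 (x0 i) erefl erefl).
Qed.

End parameters.

(** * Number of scales and stretching of time *)

Section choice_of_parameters.
Context {R : realType}.
Implicit Types (m p T sigma : R).

Definition trace_constant (N k : nat) m p : R := 4 * 8 ^+ k.+3 * 8 ^+ N *
  ((24 * k.+3%:R) `^ (p / (p - 1)) + (54 * N%:R * k.+3%:R ^+ 2) `^ (p / (p - m))).

Lemma trace_constant_gt0 N k m p : 0 < trace_constant N k m p.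
Proof.
apply: mulr_gt0.
  by apply: mulr_gt0; [apply: mulr_gt0 => //|]; exact: exprn_gt0.
by apply: ltr_wpDr; [exact: powR_ge0|apply: powR_gt0; rewrite mulr_gt0].
Qed.

Section powers.
Variables (m p : R).
Hypotheses (hm : 1 <= m) (hmp : m < p).
Local Notation theta := ((p - m) / (2 * (p - 1))).

Let p1 : 0 < p - 1. Proof. by rewrite subr_gt0 (le_lt_trans hm). Qed.
Let pm : 0 < p - m. Proof. by rewrite subr_gt0. Qed.

Let theta_gt0 : 0 < theta. Proof. by rewrite divr_gt0// mulr_gt0. Qed.

Lemma lt_powR_theta x T : 0 <= x -> 0 < T ->
  (x < T `^ theta) -> x `^ (2 * (p - 1) / (p - m)) < T.
Proof.
move=> x0 T0 xT.
have : x `^ (2 * (p - 1) / (p - m)) < (T `^ theta) `^ (2 * (p - 1) / (p - m)).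
  by apply: gt0_ltr_powR; rewrite ?nnegrE ?powR_ge0// divr_gt0 ?mulr_gt0.
rewrite -powRrM (_ : theta * _ = 1) ?powRr1 ?(ltW T0)//.
by field; rewrite !gt_eqF.
Qed.

(** Since $m-1\le2(p-1)$ and $n\le2^{n-1}$, the stretching factor is at most $(2^{n-1})^{1/\theta}$;
    replacing $2^{n-1}$ by $4^{n-1}$ in the hypothesis pays for it. *)
Lemma critical_time n sigma T : (0 < n)%N -> 0 < sigma -> 0 < T ->
  4 ^+ n.-1 * sigma < T `^ theta ->
  n%:R `^ ((m - 1) / (p - m)) * (2 ^+ n.-1 * sigma) `^ (2 * (p - 1) / (p - m)) < T.
Proof.
move=> n0 sg0 T0 h.
have n1 : 1 <= n%:R :> R by rewrite ler1n.
have q0 : 0 <= 2 ^+ n.-1 * sigma by rewrite mulr_ge0 ?exprn_ge0 ?ltW.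
have := @lt_powR_theta (4 ^+ n.-1 * sigma) T _ T0 h.
rewrite mulr_ge0 ?exprn_ge0 ?(ltW sg0)// => /(_ isT); apply: le_lt_trans.
rewrite (_ : 4 ^+ n.-1 * sigma = 2 ^+ n.-1 * (2 ^+ n.-1 * sigma)); last first.
  by rewrite mulrA -exprMn; congr (_ ^+ _ * _); ring.
rewrite [leRHS]powRM ?exprn_ge0//; apply: ler_wpM2r; first exact: powR_ge0.
apply: le_trans (_ : n%:R `^ (2 * (p - 1) / (p - m)) <= _).
  apply: ler_powR => //; rewrite ler_pM2r ?invr_gt0//.
  apply: (@le_trans _ _ (p - 1)); first by rewrite lerD2r ltW.
  by rewrite ler_peMl ?(ltW p1)// ler1n.
apply: ge0_ler_powR; rewrite ?nnegrE ?exprn_ge0//.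
  by rewrite divr_ge0 ?mulr_ge0 ?ltW.
rewrite -natrX ler_nat -{1}(prednK n0); exact: ltn_expl.
Qed.

End powers.

(** A single scale without stretching suffices: $n=1$ and $\lambda=1$. *)
Lemma trace_bound (N k : nat) m p T sigma (u : 'rV[R]_N -> R -> R)
    (nu : {measure set 'rV[R]_N -> \bar R}) z :
  1 <= m -> m < p -> 2 * p / (p - m) <= k.+3%:R -> 0 < T -> 0 < sigma ->
  sigma < T `^ ((p - m) / (2 * (p - 1))) ->
  solution_E m p T%:E u -> initial_trace u nu ->
  (nu (euclidean_ball z sigma) <=
   (trace_constant N k m p * sigma `^ (N%:R - 2 / (p - m)))%:E)%E.
Proof.
move=> hm hmp kp T0 sg0 sgT E tr.
have sT : 1 * (2 ^+ 1.-1 * sigma) `^ (2 * (p - 1) / (p - m)) < T.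
  by rewrite /= expr0 !mul1r; exact: (lt_powR_theta hm hmp (ltW sg0) T0 sgT).
have := dyadic_trace_bound z (ltn0Sn 0) hm hmp kp ltr01 sg0 sT E tr.
rewrite big_ord1 expr0 mul1r !powR1 !mulr1 => /le_trans; apply.
by rewrite lee_fin le_eqVlt; apply/orP; left; apply/eqP; rewrite /trace_constant; ring.
Qed.

(** In the critical case all shells cost the same, so the sum contributes a factor $n$. The choice
    $\lambda=n^{(m-1)/(p-m)}$ makes both residues times $n$ equal to $n^{-1/(p-m)}=n^{-N/2}$, up to
    constants. *)
Lemma critical_trace_bound (N k n : nat) m p T sigma (u : 'rV[R]_N -> R -> R)
    (nu : {measure set 'rV[R]_N -> \bar R}) z :
  (0 < N)%N -> (0 < n)%N ->
  1 <= m -> m < p -> p = m + 2 / N%:R -> 2 * p / (p - m) <= k.+3%:R -> 0 < T -> 0 < sigma ->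
  4 ^+ n.-1 * sigma < T `^ ((p - m) / (2 * (p - 1))) ->
  solution_E m p T%:E u -> initial_trace u nu ->
  (nu (euclidean_ball z sigma) <=
   (trace_constant N k m p * n%:R `^ (- (N%:R / 2)))%:E)%E.
Proof.
move=> N0 n0 hm hmp pE kp T0 sg0 sgT E tr.
have N0R : 0 < N%:R :> R by rewrite ltr0n.
have n0R : 0 < n%:R :> R by rewrite ltr0n.
have p1 : p - 1 != 0 by rewrite gt_eqF// subr_gt0 (le_lt_trans hm).
have pm : p - m != 0 by rewrite gt_eqF// subr_gt0.
have pN : p - m = 2 / N%:R by rewrite pE; ring.
have N2 : N%:R / 2 = (p - m)^-1 by rewrite pN invf_div.
have NE : N%:R - 2 / (p - m) = 0 by rewrite -N2; field.
have la0 : 0 < n%:R `^ ((m - 1) / (p - m)) :> R by exact: powR_gt0.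
have sT := critical_time hm hmp n0 sg0 T0 sgT.
have := dyadic_trace_bound z n0 hm hmp kp la0 sg0 sT E tr.
rewrite (eq_bigr (fun=> 1)); last by move=> i _; rewrite NE powRr0.
rewrite big_const_ord iter_addr_0 -powRrM.
have e1 : n%:R * (n%:R `^ (- (p / (p - 1))) *
    n%:R `^ ((m - 1) / (p - m) * (1 - p / (p - 1)))) = n%:R `^ (- (N%:R / 2)) :> R.
  rewrite -{1}[n%:R](powRr1 (ltW n0R)) -!powRD_gt0//; congr (_ `^ _).
  by rewrite N2; field; rewrite p1 pm.
have e2 : n%:R * (n%:R `^ (- (p / (p - m))) * n%:R `^ ((m - 1) / (p - m))) =
    n%:R `^ (- (N%:R / 2)) :> R.
  rewrite -{1}[n%:R](powRr1 (ltW n0R)) -!powRD_gt0//; congr (_ `^ _).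
  by rewrite N2; field; rewrite pm.
move=> /le_trans; apply; rewrite lee_fin /trace_constant -[leRHS]mulrA.
apply: ler_wpM2l; first by rewrite mulr_ge0 ?exprn_ge0// mulr_ge0 ?exprn_ge0.
by rewrite mulrDr [X in X + _]mulrCA [X in _ + X]mulrCA e1 e2 -mulrDl.
Qed.

Lemma exists_scale (Y : R) : 1 < Y -> exists n, [/\ (0 < n)%N, 4 ^+ n.-1 < Y & Y <= 4 ^+ n].
Proof.
move=> Y1; have ex : exists n, Y <= 4 ^+ n.
  exists (Num.truncn Y).+1; apply: le_trans (ltW (truncnS_gt Y)) _.
  by rewrite -natrX ler_nat ltnW// ltn_expl.
have [n Yn minn] := ex_minnP ex; exists n.
have n0 : (0 < n)%N by case: n Yn {minn} => //; rewrite expr0 leNgt Y1.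
split => //; rewrite ltNge; apply/negP => /minn.
by rewrite leqNgt prednK ?leqnn.
Qed.

Definition log_constant : R := ln (4 * (expR 1 + 1)).

Lemma log_constant_gt0 : 0 < log_constant.
Proof. by apply: ln_gt0; have := expR_gt0 (1 : R); lra. Qed.

(** For $n\ge1$ one has $e+Y\le(e+1)4^n\le(4(e+1))^n$, so the number of scales dominates the
    logarithm with a constant free of all parameters. *)
Lemma log_scale (Y : R) n : (0 < n)%N -> 1 < Y -> Y <= 4 ^+ n ->
  ln (expR 1 + Y) <= n%:R * log_constant.
Proof.
move=> n0 Y1 Yn; have e0 := expR_gt0 (1 : R).
have c0 : 0 < 4 * (expR 1 + 1) :> R by lra.
rewrite mulr_natl -lnXn// ler_ln ?posrE ?exprn_gt0//; last by lra.
apply: le_trans (_ : (expR 1 + 1) * 4 ^+ n <= _).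
  rewrite mulrDl mul1r; apply: lerD => //.
  by rewrite ler_peMr ?(ltW e0)// exprn_ege1//; lra.
rewrite exprMn mulrC; apply: ler_wpM2l; first by rewrite exprn_ge0.
by rewrite -{1}[expR 1 + 1]expr1; apply: ler_weXn2l => //; lra.
Qed.

End choice_of_parameters.

(** * The logarithmic bound and the final assembly *)

Section bounds.
Context {R : realType}.
Implicit Types (m p T sigma : R).

Lemma critical_log_bound (N k : nat) m p T sigma (u : 'rV[R]_N -> R -> R)
    (nu : {measure set 'rV[R]_N -> \bar R}) z :
  (0 < N)%N -> 1 <= m -> m < p -> p = m + 2 / N%:R -> 2 * p / (p - m) <= k.+3%:R ->
  0 < T -> 0 < sigma -> sigma < T `^ ((p - m) / (2 * (p - 1))) ->
  solution_E m p T%:E u -> initial_trace u nu ->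
  (nu (euclidean_ball z sigma) <= (trace_constant N k m p * @log_constant R `^ (N%:R / 2) *
    ln (expR 1 + T `^ ((p - m) / (2 * (p - 1))) / sigma) `^ (- (N%:R / 2)))%:E)%E.
Proof.
move=> N0 hm hmp pE kp T0 sg0 sgT E tr.
set Y := T `^ _ / sigma.
have Y1 : 1 < Y by rewrite ltr_pdivlMr// mul1r.
have [n [n0 nY Yn]] := exists_scale Y1.
have sT : 4 ^+ n.-1 * sigma < T `^ ((p - m) / (2 * (p - 1))) by rewrite -ltr_pdivlMr.
apply: le_trans (critical_trace_bound z N0 n0 hm hmp pE kp T0 sg0 sT E tr) _.
rewrite lee_fin -[leRHS]mulrA ler_pM2l ?trace_constant_gt0//.
have L0 : 0 < ln (expR 1 + Y) by apply: ln_gt0; have := expR_gt0 (1 : R); lra.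
have D0 := @log_constant_gt0 R.
have n0R : 0 < n%:R :> R by rewrite ltr0n.
rewrite !powRN ler_pdivlMr ?powR_gt0// mulrC ler_pdivrMr ?powR_gt0//.
rewrite mulrC -powRM ?ler0n ?(ltW D0)//.
apply: ge0_ler_powR; rewrite ?nnegrE ?divr_ge0 ?mulr_ge0 ?(ltW L0) ?(ltW D0)//.
by rewrite mulrC; exact: log_scale.
Qed.

End bounds.

Theorem theorem1p1 (R : realType) (N : nat) (m p : R)
    (hN : (1 <= N)%N) (hm : 1 <= m) (hmp : m < p) :
  let p_m : R := m + 2 / N%:R in
  let theta : R := (p - m) / (2 * (p - 1)) in
  ((forall (T : R) (u : 'rV[R]_N -> R -> R),
      0 < T -> solution_E m p T%:E u ->
      exists nu : {measure set 'rV[R]_N -> \bar R},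
        initial_trace u nu /\
        forall nu' : {measure set 'rV[R]_N -> \bar R},
          initial_trace u nu' -> same_measure nu' nu) /\
   (exists C : R, 0 < C /\
      forall (T : R) (u : 'rV[R]_N -> R -> R)
        (nu : {measure set 'rV[R]_N -> \bar R}),
        0 < T -> solution_E m p T%:E u -> initial_trace u nu ->
        forall sigma : R, 0 < sigma -> sigma < T `^ theta ->
          (ereal_sup [set nu (euclidean_ball z sigma) | z in [set: 'rV[R]_N]] <=
           (if p == p_m
            then C * ln (expR 1 + T `^ theta / sigma) `^ (- (N%:R / 2))
            else C * sigma `^ (N%:R - 2 / (p - m)))%:E)%E)) /\
  (forall (mu : {measure set 'rV[R]_N -> \bar R}) (T : \bar R)
      (u : 'rV[R]_N -> R -> R),
      radon mu -> (0 < T)%E -> solution_P m p T mu u ->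
      solution_E m p T u /\
      initial_trace u mu /\
      forall nu : {measure set 'rV[R]_N -> \bar R},
        initial_trace u nu -> same_measure nu mu).
Proof.
move=> p_m theta.
(* The exponent of the barrier depends on [m] and [p] alone, and hence the constant depends only on
   [N], [m] and [p]. *)
have [k kp] : exists k : nat, 2 * p / (p - m) <= k.+3%:R.
  exists (Num.truncn (2 * p / (p - m))); apply: le_trans (ltW (truncnS_gt _)) _.
  by rewrite ler_nat ltnS leqW.
split; [split|].
- move=> T u T0 E; have [nu tr] := solution_E_has_trace hm hmp T0 E.
  by exists nu; split => // nu' tr'; exact: trace_unique tr' tr.
- exists (if p == p_m then trace_constant N k m p * @log_constant R `^ (N%:R / 2)
          else trace_constant N k m p); split.
    case: ifP => _; last exact: trace_constant_gt0.
    apply: mulr_gt0; first exact: trace_constant_gt0.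
    exact/powR_gt0/log_constant_gt0.
  move=> T u nu T0 E tr sigma sg0 sgT; apply: ge_ereal_sup => _ [z _ <-].
  have [pE|_] := eqVneq p p_m.
    exact: (critical_log_bound z hN hm hmp pE kp T0 sg0 sgT E tr).
  exact: (trace_bound z hm hmp kp T0 sg0 sgT E tr).
- move=> mu T u rmu T0 P.
  have tr := solution_P_initial_trace hm hmp rmu T0 P.
  split; first exact: (solution_PE hm hmp T0 P).
  by split => // nu tr'; exact: trace_unique tr' tr.
Qed.
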